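(* The tied--boxed Hecke algebra $bH_n(q)$ is cellular (in the sense of Graham--Lehrer), with cellular basis \[B=\{\mathbf{m}^{\boldsymbol\lambda}_{\mathfrak{s}\mathfrak{t}}\mid \boldsymbol\lambda \text{ a multipartition of } n,\ \mathfrak{s},\mathfrak{t}\in T(\boldsymbol\lambda)\},\] where $\mathbf{m}^{\boldsymbol\lambda}_{\mathfrak{s}\mathfrak{t}}=z_{d(\mathfrak{s})}^{*}\,\mathbf{m}_{\boldsymbol\lambda}\,z_{d(\mathfrak{t})}$ and $\mathbf{m}_{\boldsymbol\lambda}=\mathbb{E}_{\mathbf{I}_{\boldsymbol\lambda}}\sum_{w\in\mathfrak{S}_{\boldsymbol\lambda}}q^{\ell(w)}z_w$, the poset being the multipartitions of $n$ under the dominance order and $*$ being the anti-automorphism.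
   Context: $\mathbb{S}=\mathbb{C}[q,q^{-1}]$. $bH_n(q)$ is the $\mathbb{S}$--algebra presented by generators $e_1,\dots,e_{n-1}$, $z_1,\dots,z_{n-1}$ and relations: $e_i^2=e_i$, $e_ie_j=e_je_i$; $z_iz_jz_i=z_jz_iz_j$ if $|i-j|=1$, $z_iz_j=z_jz_i$ if $|i-j|>1$; $e_iz_i=z_i$; $e_iz_j=z_je_i$; $z_i^2=e_i+(q-q^{-1})z_i$. $*$ is the $\mathbb{S}$--linear anti-automorphism of $bH_n(q)$ fixing every $e_i$ and $z_i$. For $w\in\mathfrak{S}_n$ with reduced expression $s_{i_1}\cdots s_{i_r}$, $z_w=z_{i_1}\cdots z_{i_r}$ and $\ell(w)=r$. A multipartition of $n$ is a tuple $\boldsymbol\lambda=(\lambda^{(1)},\dots,\lambda^{(k)})$ of nonempty partitions with total size $n$; $\operatorname{comp}(\boldsymbol\lambda)=(|\lambda^{(1)}|,\dots,|\lambda^{(k)}|)$. $\mathbf{I}_{\boldsymbol\lambda}$ is the linear set partition of $[n]$ whose blocks are the consecutive intervals of lengths $|\lambda^{(1)}|,\dots,|\lambda^{(k)}|$. Linear set partitions are ordered by $\mathbf{I}\preceq\mathbf{J}$ iff each block of $\mathbf{J}$ is a union of blocks of $\mathbf{I}$; $\operatorname{E}_\mathbf{J}=\prod e_i$ over $i$ with $i,i+1$ in the same block of $\mathbf{J}$; $\mathbb{E}_\mathbf{I}=\sum_{\mathbf{J}\succeq\mathbf{I}}(-1)^{|\mathbf{I}|-|\mathbf{J}|}\operatorname{E}_\mathbf{J}$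 ($|\cdot|$ = number of blocks). A $\boldsymbol\lambda$-multitableau is a filling of the Young diagrams of the components by $1,\dots,n$ bijectively; $\mathfrak{S}_n$ acts on the right by permuting entries. $\mathfrak{t}^{\boldsymbol\lambda}$ is the multitableau with $1,\dots,n$ entered in order along rows of the first component, then the second, etc.; $\mathfrak{S}_{\boldsymbol\lambda}$ is its row stabilizer; for a row-standard $\mathfrak{s}$, $d(\mathfrak{s})$ is the unique permutation with $\mathfrak{t}^{\boldsymbol\lambda}d(\mathfrak{s})=\mathfrak{s}$. A multitableau is standard if in each component entries increase along rows and down columns; it is of the initial kind if its $i$th component contains exactly the entries of the $i$th component of $\mathfrak{t}^{\boldsymbol\lambda}$. $T(\boldsymbol\lambda)$ is the set of standard $\boldsymbol\lambda$-multitableaux of the initial kind. *)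

(* Defs.v *)
From HB Require Import structures.
From mathcomp Require Import all_boot all_order all_algebra all_fingroup.
From mathcomp Require Import complex.
From mathcomp Require Import Rstruct.

Set Implicit Arguments.
Unset Strict Implicit.
Unset Printing Implicit Defensive.

Import GRing.Theory.
Local Open Scope ring_scope.

Definition CC : fieldType := (Rdefinitions.R)[i].

Definition is_laurent_ring (S : comUnitAlgType CC) (q : S) : Prop :=
  [/\ q \is a GRing.unit,
      (forall s : S, exists (l : seq int) (c : int -> CC),
          s = \sum_(k <- l) c k *: q ^ k)
    & (forall (l : seq int) (c : int -> CC), uniq l ->
          \sum_(k <- l) c k *: q ^ k = 0 -> forall k, k \in l -> c k = 0)].

(* The defining relations of bH_n(q), generators e_i, z_i (1 <= i <= n-1),
   indexed by natural numbers (values outside 1..n-1 are irrelevant).   *)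
Definition bH_relations (n : nat) (S : comUnitAlgType CC) (q : S)
    (B : algType S) (e z : nat -> B) : Prop :=
  forall i j : nat, (0 < i < n)%N -> (0 < j < n)%N ->
  e i * e i = e i /\
  e i * e j = e j * e i /\
  ((i.+1 = j \/ j.+1 = i) -> z i * z j * z i = z j * z i * z j) /\
  ((i.+1 < j \/ j.+1 < i)%N -> z i * z j = z j * z i) /\
  e i * z i = z i /\
  e i * z j = z j * e i /\
  z i * z i = e i + (q - q^-1) *: z i.

Definition is_alg_morph (S : comUnitAlgType CC) (A B : algType S)
    (f : A -> B) : Prop :=
  [/\ forall a b, f (a + b) = f a + f b,
      forall (c : S) a, f (c *: a) = c *: f a,
      forall a b, f (a * b) = f a * f b
    & f 1 = 1].

Definition is_bH (n : nat) (S : comUnitAlgType CC) (q : S)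
    (A : algType S) (e z : nat -> A) : Prop :=
  bH_relations n q e z /\
  forall (B : algType S) (e' z' : nat -> B), bH_relations n q e' z' ->
    exists f : A -> B,
      [/\ is_alg_morph f,
          (forall i, (0 < i < n)%N -> f (e i) = e' i /\ f (z i) = z' i)
        & forall g : A -> B, is_alg_morph g ->
            (forall i, (0 < i < n)%N -> g (e i) = e' i /\ g (z i) = z' i) ->
            forall a, g a = f a].

Definition is_bH_star (n : nat) (S : comUnitAlgType CC)
    (A : algType S) (e z : nat -> A) (star : A -> A) : Prop :=
  [/\ forall a b, star (a + b) = star a + star b,
      forall (c : S) a, star (c *: a) = c *: star a,
      forall a b, star (a * b) = star b * star a,
      bijective star
    & forall i, (0 < i < n)%N -> star (e i) = e i /\ star (z i) = z i].

(* Symmetric group S_n = 'S_n acting on {0,..,n-1} (entry x of a tableau,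
   1 <= x <= n, corresponds to the point x-1).  MathComp's product is
   (u * v) x = v (u x), i.e. permutations act on the right.            *)
Local Open Scope group_scope.

(* the simple transposition s_{j+1}, exchanging the points j and j+1 *)
Definition sref (n : nat) (j : nat) : 'S_n :=
  match (insub j : option 'I_n), (insub j.+1 : option 'I_n) with
  | Some a, Some b => tperm a b
  | _, _ => 1
  end.

Definition has_word (n k : nat) (w : 'S_n) : bool :=
  [exists s : k.-tuple 'I_n.-1, \prod_(j <- s) sref n j == w].

(* length l(w): the length of a reduced expression of w (the search bound
   n*n exceeds n(n-1)/2, the maximal length).                          *)
Definition ell (n : nat) (w : 'S_n) : nat :=
  find (fun k => has_word k w) (iota 0 (n * n).+1).

Definition redword (n : nat) (w : 'S_n) : seq 'I_n.-1 :=
  if [pick s : (ell w).-tuple 'I_n.-1 | \prod_(j <- s) sref n j == w]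
    is Some s then val s else [::].

Local Close Scope group_scope.

Definition zw (n : nat) (S : comUnitAlgType CC) (A : algType S)
    (z : nat -> A) (w : 'S_n) : A :=
  \prod_(j <- redword w) z (j.+1).

Definition is_part (p : seq nat) : bool :=
  [&& p != [::], sorted geq p & all (fun x => 0 < x)%N p].

Definition is_mpart (n : nat) (la : seq (seq nat)) : bool :=
  all is_part la && (sumn (map sumn la) == n).

Definition comp (la : seq (seq nat)) : seq nat := map sumn la.
Definition offset (la : seq (seq nat)) (k : nat) : nat :=
  sumn (take k (comp la)).

(* Dominance order on multipartitions:  la dominates mu  iff for all k, j,
   |la^(1)|+...+|la^(k-1)| + la^(k)_1+...+la^(k)_j  >=  the same for mu
   (components beyond the last one are empty).                         *)
Definition dominates (n : nat) (la mu : seq (seq nat)) : bool :=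
  all (fun k => all (fun j =>
         (offset mu k + sumn (take j (nth [::] mu k))
           <= offset la k + sumn (take j (nth [::] la k)))%N)
       (iota 0 n.+1))
    (iota 0 (maxn (size la) (size mu))).

(* Multitableaux: a multitableau is a list of components, each a list
   of rows, each a list of entries.                                    *)
Definition mtab := seq (seq (seq nat)).

Definition mshape (T : mtab) : seq (seq nat) := map (map size) T.

Definition is_mtab (n : nat) (la : seq (seq nat)) (T : mtab) : bool :=
  (mshape T == la) && perm_eq (flatten (map flatten T)) (iota 1 n).

Definition comp_standard (c : seq (seq nat)) : bool :=
  all (sorted ltn) c &&
  all (fun r => all (fun j =>
          (nth 0 (nth [::] c r) j < nth 0 (nth [::] c r.+1) j)%N)
        (iota 0 (size (nth [::] c r.+1))))
      (iota 0 (size c).-1).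

Definition is_standard (T : mtab) : bool := all comp_standard T.

Definition tlam (la : seq (seq nat)) : mtab :=
  map (fun k => reshape (nth [::] la k)
                  (iota (offset la k).+1 (sumn (nth [::] la k))))
      (iota 0 (size la)).

Definition is_initial (la : seq (seq nat)) (T : mtab) : bool :=
  all (fun k => perm_eq (flatten (nth [::] T k)) (flatten (nth [::] (tlam la) k)))
      (iota 0 (size la)).

Definition inT (n : nat) (la : seq (seq nat)) (T : mtab) : bool :=
  [&& is_mtab n la T, is_standard T & is_initial la T].

Definition act_entry (n : nat) (w : 'S_n) (x : nat) : nat :=
  if (insub x.-1 : option 'I_n) is Some i then (w i).+1 else x.

Definition tab_act (n : nat) (T : mtab) (w : 'S_n) : mtab :=
  map (map (map (act_entry w))) T.

Definition dperm (n : nat) (la : seq (seq nat)) (s : mtab) : 'S_n :=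
  odflt 1%g [pick w : 'S_n | tab_act (tlam la) w == s].

Definition rowstab (n : nat) (la : seq (seq nat)) : {set 'S_n} :=
  [set w : 'S_n | all2 (fun c c' => all2 (fun r r' => perm_eq r r') c c')
                       (tlam la) (tab_act (tlam la) w)].

Definition is_interval (n : nat) (B : {set 'I_n}) : bool :=
  [forall x in B, forall y in B, forall t : 'I_n,
     ((x <= t <= y)%N) ==> (t \in B)].

Definition is_linsp (n : nat) (P : {set {set 'I_n}}) : bool :=
  partition P [set: 'I_n] && [forall B in P, is_interval B].

Definition lsp_le (n : nat) (I J : {set {set 'I_n}}) : bool :=
  [forall B in J, B == \bigcup_(C in I | C \subset B) C].

Section HeckeElements.
Variables (n : nat) (S : comUnitAlgType CC) (q : S) (A : algType S).
Variables (e z : nat -> A) (star : A -> A).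

(* E_J = product of the e_i (1-based) with i, i+1 in the same block of J;
   in 0-based points: the points i-1, i. *)
Definition EJ (J : {set {set 'I_n}}) : A :=
  \prod_(i : 'I_n | [exists j : 'I_n,
                       (val j == i.+1) && (pblock J i == pblock J j)])
     e i.+1.

Definition bEI (I : {set {set 'I_n}}) : A :=
  \sum_(J : {set {set 'I_n}} | is_linsp J && lsp_le I J)
     (-1) ^+ (#|I| - #|J|) * EJ J.

Definition Ila (la : seq (seq nat)) : {set {set 'I_n}} :=
  [set [set x : 'I_n | (offset la k <= x < offset la k + nth 0 (comp la) k)%N]
     | k : 'I_(size la)].

Definition mla (la : seq (seq nat)) : A :=
  bEI (Ila la) * \sum_(w in rowstab n la) (q ^+ ell w) *: zw z w.

Definition mst (la : seq (seq nat)) (s t : mtab) : A :=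
  star (zw z (dperm n la s)) * mla la * zw z (dperm n la t).

Definition bindex (x : seq (seq nat) * mtab * mtab) : bool :=
  [&& is_mpart n x.1.1, inT n x.1.1 x.1.2 & inT n x.1.1 x.2].

Definition belt (x : seq (seq nat) * mtab * mtab) : A := mst x.1.1 x.1.2 x.2.

Definition in_span (P : pred (seq (seq nat) * mtab * mtab)) (a : A) : Prop :=
  exists (l : seq (seq (seq nat) * mtab * mtab)) (c : _ -> S),
    all P l /\ a = \sum_(x <- l) c x *: belt x.

Definition cellular_bH : Prop :=
  [/\
      (forall a : A, in_span bindex a),
      (forall (l : seq (seq (seq nat) * mtab * mtab)) (c : _ -> S),
          uniq l -> all bindex l -> \sum_(x <- l) c x *: belt x = 0 ->
          forall x, x \in l -> c x = 0),
      (forall a b : A, star (a * b) = star b * star a) /\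
      (forall a : A, star (star a) = a) /\
      (forall la s t, bindex (la, s, t) -> star (mst la s t) = mst la t s)
    &
      (forall la s, is_mpart n la -> inT n la s -> forall a : A,
         exists (us : seq mtab) (r : mtab -> S),
           all (inT n la) us /\
           forall t, inT n la t ->
             in_span (fun x => bindex x && dominates n x.1.1 la
                                        && (x.1.1 != la))
               (a * mst la s t - \sum_(u <- us) r u *: mst la u t))].

End HeckeElements.

(* Main.v *)
(** A multipartition of n with composition K is encoded by the nondecreasing word
    pi : 'I_n -> 'I_n sending a position of t^lambda to a label of its row: the first
    position of the component plus the index of the row.  Then lambda dominates mu
    iff pi_lambda <= pi_mu pointwise, and a row-standard tableau t = t^lambda d is the
    word f = pi o d^-1, with m_lambda z_d a multiple of the sum of q^l(w) E z_w over
    the w with f o w = pi; t is standard iff f is a lattice word.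

    Spanning.  Let i, i+1 be labels of one component and let x be a word with more
    letters i than pi.  Summing, with suitable powers of q, over all ways to raise
    letters i of x to i+1 gives an element of the ideal I of the strictly more
    dominant compositions.  Peeling off one letter at a time, the same holds when only
    a final segment of the letters i of x, longer than row i of pi, may be raised;
    this is the Garnir relation.  It rewrites a word violating the lattice condition,
    modulo I, through words with fewer inversions.  Hence m_lambda A is spanned modulo I
    by the standard m_lambda z_d(t), and Murphy's elements span A.  Working with
    compositions rather than partitions costs nothing: a composition that is not a
    partition has no lattice word, so its m lies in I.

    Independence.  The z_w with w in the Young subgroup S_K are independent on E_K A by
    the regular representation, and pairs of lattice words of equal content are at most
    as many as S_K, by the relation DU - UD = 1 for adding and removing boxes.  A
    spanning family that is no larger than a free one is a basis. *)
Require Import Defs.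
From HB Require Import structures.
From mathcomp Require Import all_boot all_order all_algebra all_fingroup.
From mathcomp Require Import complex boolp zify ring.
Import GRing.Theory.
Local Open Scope ring_scope.
Set Implicit Arguments.
Unset Strict Implicit.
Unset Printing Implicit Defensive.

(** * Inversions and reduced words in the symmetric group *)

(** The central idempotents [EK K] cut the algebra into pieces [EK K * A], one for each composition
    of n; on such a piece z_k vanishes for k outside [K], and the other z_k satisfy the Hecke
    relations of a Young subgroup. Hence only multipartitions with the same composition interact,
    and dominance is compared for these alone. Because row labels are positions, words are maps from
    ['I_n] to itself, and one block function [bst] serves both for positions and for letters; a
    component always has room for its labels, having at least as many boxes as rows. The sums
    [fibsum pi f] depend on two words which [star] exchanges, so statements on right multiplication
    have left counterparts. The powers of q in the raising sums are forced: exchanging two adjacent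
    letters of x through z_k must carry the sum for x to the sum for the exchanged word. For
    independence no correspondence of Robinson-Schensted type is constructed; an upper bound for the
    number of pairs of lattice words and a lower bound for the order of the Young subgroup
    suffice. *)

Section Inversions.
Variable n : nat.
Implicit Types (k : 'I_n.-1) (p : 'I_n) (w : 'S_n).

Lemma ltn_lo k : (k < n)%N. Proof. by have := ltn_ord k; lia. Qed.
Lemma ltn_hi k : (k.+1 < n)%N. Proof. by have := ltn_ord k; lia. Qed.
Definition lo k : 'I_n := Ordinal (ltn_lo k).
Definition hi k : 'I_n := Ordinal (ltn_hi k).

Lemma srefE k : sref n k = tperm (lo k) (hi k).
Proof. by rewrite /sref (insubT (fun x => x < n)%N (ltn_lo k)) (insubT (fun x => x < n)%N (ltn_hi k)). Qed.

Lemma sref_lo k : sref n k (lo k) = hi k. Proof. by rewrite srefE tpermL. Qed.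
Lemma sref_hi k : sref n k (hi k) = lo k. Proof. by rewrite srefE tpermR. Qed.
Lemma srefD k p : p != lo k -> p != hi k -> sref n k p = p.
Proof. by move=> *; rewrite srefE tpermD // eq_sym. Qed.
Lemma srefK k : involutive (sref n k).
Proof. by move=> p; rewrite srefE tpermK. Qed.
Lemma sref2 k : (sref n k * sref n k = 1)%g.
Proof. by rewrite srefE tperm2. Qed.
Lemma srefV k : ((sref n k)^-1 = sref n k)%g.
Proof. by rewrite srefE tpermV. Qed.

Variant sref_spec k p : 'I_n -> Type :=
| SrefLo of p = lo k : sref_spec k p (hi k)
| SrefHi of p = hi k : sref_spec k p (lo k)
| SrefD of p <> k :> nat & p <> k.+1 :> nat : sref_spec k p p.

Lemma srefP k p : sref_spec k p (sref n k p).
Proof.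
have [->|np] := eqVneq p (lo k); first by rewrite sref_lo; constructor.
have [->|np'] := eqVneq p (hi k); first by rewrite sref_hi; constructor.
by rewrite srefD //; constructor=> h; [case/eqP: np | case/eqP: np']; apply: val_inj.
Qed.

(** Kept general in [h]: inversions, the statistic [crs] and the correction term of [inv_raise] are
    all sums of this kind, and the effect of an adjacent exchange is computed once, in
    [psum_sref]. *)
Definition psum (h : 'I_n -> 'I_n -> nat) : nat :=
  (\sum_(u : 'I_n * 'I_n | (u.1 < u.2)%N) h u.1 u.2)%N.

(* [sref n k] permutes the pairs [p < p'] except for [(lo k, hi k)], which it reverses. *)
Lemma psum_sref k h :
  (psum (fun p p' => h (sref n k p) (sref n k p')) + h (lo k) (hi k)
   = psum h + h (hi k) (lo k))%N.
Proof.
set s := sref n k; have sK : involutive (fun u : 'I_n * 'I_n => (s u.1, s u.2)).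
  by case=> a b /=; rewrite !srefK.
rewrite /psum (bigD1 (lo k, hi k)) //= [in RHS](bigD1 (lo k, hi k)) //=.
rewrite [in RHS](reindex_inj (inv_inj sK)) /= {1 2}/s sref_lo sref_hi.
rewrite addnC addnA [RHS]addnAC; congr (_ + _)%N; apply: eq_bigl.
case=> a b /=; rewrite /s -!pair_eqE /= /pair_eq /= -!val_eqE /=.
by case: srefP => [->|->|??]; case: srefP => [->|->|??] /=; lia.
Qed.

Lemma psum_eq h h' : (forall p p', (p < p')%N -> h p p' = h' p p') -> psum h = psum h'.
Proof. by move=> e; apply: eq_bigr => -[a b] /= /e. Qed.

Lemma psumD h h' : (psum h + psum h' = psum (fun p p' => h p p' + h' p p'))%N.
Proof. by rewrite /psum big_split. Qed.

Lemma psum_card (r : rel 'I_n) :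
  psum r = #|[set u : 'I_n * 'I_n | (u.1 < u.2)%N && r u.1 u.2]|.
Proof.
rewrite -sum1_card /psum big_mkcond [RHS]big_mkcond; apply: eq_bigr => u _.
by rewrite inE; case: (_ < _)%N; case: (r _ _).
Qed.

Definition inv (f : 'I_n -> 'I_n) : nat := psum (fun p p' => f p' < f p)%N.

Lemma eq_inv f g : f =1 g -> inv f = inv g.
Proof. by move=> e; apply: psum_eq => p p' _; rewrite !e. Qed.

Lemma inv_sref k (f : 'I_n -> 'I_n) :
  (inv (fun p => f (sref n k p)) + (f (hi k) < f (lo k)) = inv f + (f (lo k) < f (hi k)))%N.
Proof. exact: (psum_sref k (fun p p' => f p' < f p : nat)%N). Qed.

(** Taken for the inverse, because [(w * s)^-1] is [w^-1] precomposed with [s]: multiplication by a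
    simple transposition on the right exchanges two adjacent arguments. The count for [w] itself is
    the same by [winvV]. *)
Definition winv w : nat := inv (w^-1)%g.

Lemma winvM k w :
  (winv (w * sref n k)%g + ((w^-1)%g (hi k) < (w^-1)%g (lo k)) =
   winv w + ((w^-1)%g (lo k) < (w^-1)%g (hi k)))%N.
Proof.
rewrite /winv -(inv_sref k); congr addn; apply: eq_inv => p.
by rewrite invMg srefV permM.
Qed.

Definition asc w k := ((w^-1)%g (lo k) < (w^-1)%g (hi k))%N.

Lemma ascPn w k : ((w^-1)%g (hi k) < (w^-1)%g (lo k))%N = ~~ asc w k.
Proof.
rewrite /asc ltn_neqAle -leqNgt andb_idl // => _; apply/eqP => /val_inj/perm_inj.
by move/(congr1 val) => /=; lia.
Qed.

Lemma winv_asc w k : asc w k -> winv (w * sref n k)%g = (winv w).+1.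
Proof. by move=> a; have := winvM k w; rewrite ascPn -/(asc w k) a /=; lia. Qed.
Lemma winv_desc w k : ~~ asc w k -> winv w = (winv (w * sref n k)%g).+1.
Proof. by move=> a; have := winvM k w; rewrite ascPn -/(asc w k) (negbTE a) /=; lia. Qed.

Lemma mulKsref w k : (w * sref n k * sref n k = w)%g.
Proof. by rewrite -mulgA sref2 mulg1. Qed.

Lemma ascM w k : asc (w * sref n k)%g k = ~~ asc w k.
Proof. by rewrite -ascPn /asc invMg srefV !permM sref_lo sref_hi. Qed.

Lemma winv1 : winv 1 = 0%N.
Proof.
rewrite /winv /inv /psum big1 // => -[a b] /= ab.
by rewrite invg1 !perm1 ltnNge ltnW.
Qed.

(** The bound [t] is for words of which only a prefix is sorted; elsewhere it is n. *)
Lemma adj_homo (r : rel nat) (g : 'I_n -> nat) t : transitive r ->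
  (forall k, (k.+1 < t)%N -> r (g (lo k)) (g (hi k))) ->
  forall p p' : 'I_n, (p < p')%N -> (p' < t)%N -> r (g p) (g p').
Proof.
move=> rT h p [m hm]; elim: m hm => [//|m IH] hm /= pm mt.
have hk : (m < n.-1)%N by lia.
have e1 : hi (Ordinal hk) = Ordinal hm by apply: val_inj.
have := h (Ordinal hk) mt; rewrite e1.
have hm' : (m < n)%N by lia.
have -> : lo (Ordinal hk) = Ordinal hm' by apply: val_inj.
have [/val_inj|ne] := eqVneq (val p) (val (Ordinal hm')); first by move->.
by apply: rT; apply: IH => /=; [move: ne => /=|]; lia.
Qed.

(** A strictly increasing permutation moves no point down; its inverse is increasing too, which
    gives the opposite inequality. *)
Lemma perm_incr_id w : (forall p p', (p < p')%N -> (w p < w p')%N) -> w = 1%g.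
Proof.
have key (u : 'S_n) : (forall p p', (p < p')%N -> (u p < u p')%N) -> forall p, (p <= u p)%N.
  move=> h [m hm]; elim: m hm => [//|m IH] hm.
  have hm' : (m < n)%N by lia.
  have := h (Ordinal hm') (Ordinal hm) (ltnSn _); have := IH hm'; move=> /=; lia.
move=> h; apply/permP => p; rewrite perm1; apply: val_inj; apply/eqP => /=.
rewrite eqn_leq key // andbT.
have h' : forall p p', (p < p')%N -> ((w^-1)%g p < (w^-1)%g p')%N.
  move=> a b ab; rewrite ltnNge leq_eqVlt; apply/negP => /orP[/eqP/val_inj/perm_inj e|/h].
    by move: ab; rewrite e ltnn.
  by rewrite !permKV ltnNge ltnW.
by have := key _ h' (w p); rewrite permK.
Qed.

Lemma perm_asc_id w : (forall k, asc w k) -> w = 1%g.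
Proof.
move=> h; apply: invg_inj; rewrite invg1; apply: perm_incr_id => p p' pp.
exact: (@adj_homo ltn (fun p => (w^-1)%g p) n ltn_trans (fun k _ => h k)).
Qed.

Lemma exists_desc w : w != 1%g -> exists k, ~~ asc w k.
Proof.
move=> nw; apply/existsP; rewrite -negb_forall; apply: contra nw => /forallP h.
by apply/eqP; apply: perm_asc_id.
Qed.

Definition wprod (s : seq 'I_n.-1) : 'S_n := (\prod_(j <- s) sref n j)%g.

Lemma wprod0 : wprod [::] = 1%g. Proof. exact: big_nil. Qed.
Lemma wprod_cons k s : wprod (k :: s) = (sref n k * wprod s)%g. Proof. exact: big_cons. Qed.
Lemma wprod_rcons s k : wprod (rcons s k) = (wprod s * sref n k)%g.
Proof. by rewrite /wprod -cats1 big_cat big_seq1. Qed.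

Lemma winv_word (s : seq 'I_n.-1) : (winv (wprod s) <= size s)%N.
Proof.
elim/last_ind: s => [|s k IH]; first by rewrite wprod0 winv1.
rewrite wprod_rcons size_rcons.
by case: (boolP (asc (wprod s) k)) => [/winv_asc ->|/winv_desc]; lia.
Qed.

Lemma exists_word w : exists2 s : seq 'I_n.-1, wprod s = w & size s = winv w.
Proof.
move em : (winv w) => m; elim: m w em => [|m IH] w em; have [w1|nw] := eqVneq w 1%g; rewrite ?w1.
- by exists [::]; rewrite ?wprod0.
- by have [k /winv_desc] := exists_desc nw; rewrite em.
- by move: em; rewrite w1 winv1.
have [k dk] := exists_desc nw; have := winv_desc dk; rewrite em => -[/esym/IH] [s es ss].
by exists (rcons s k); rewrite ?size_rcons ?ss // wprod_rcons es mulKsref.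
Qed.

Lemma winv_bound w : (winv w <= n * n)%N.
Proof.
rewrite /winv /inv /psum; apply: (@leq_trans (\sum_(u : 'I_n * 'I_n) 1)).
  by rewrite big_mkcond /=; apply: leq_sum => u _; do 2 case: (_ < _)%N.
by rewrite sum1_card card_prod card_ord.
Qed.

Lemma has_wordP m w : reflect (exists2 s : seq 'I_n.-1, wprod s = w & size s = m) (has_word m w).
Proof.
apply: (iffP existsP) => [[s /eqP e]|[s e /eqP z]]; first by exists s => //; rewrite size_tuple.
by exists (Tuple z); rewrite /= -/(wprod s) e.
Qed.

(** The search stops at the shortest word: [exists_word] provides one of length [winv w],
    [winv_word] excludes shorter ones, and [winv_bound] keeps this length within the range
    searched. *)
Lemma ellE w : ell w = winv w.
Proof.
rewrite /ell; set P := (X in find X _).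
have hP : P (winv w) by apply/has_wordP; have [s] := exists_word w; exists s.
have hin : winv w \in iota 0 (n * n).+1 by rewrite mem_iota /= add0n ltnS winv_bound.
have hh : has P (iota 0 (n * n).+1) by apply/hasP; exists (winv w).
have := nth_find 0 hh; have := hh; rewrite has_find size_iota => hlt.
rewrite nth_iota // add0n => /has_wordP [s es ss].
apply/eqP; rewrite eqn_leq -{2}ss -{2}es winv_word andbT leqNgt; apply/negP => hl.
have := before_find 0 hl; rewrite nth_iota ?add0n ?hP //.
by have := winv_bound w; lia.
Qed.

Lemma redwordP w : wprod (redword w) = w /\ size (redword w) = winv w.
Proof.
rewrite /redword; case: pickP => [s /eqP e|h]; first by rewrite /wprod e size_tuple ellE.
have [s e ss] := exists_word w; have /eqP ss' : size s = ell w by rewrite ellE.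
by have := h (Tuple ss'); rewrite /= -/(wprod s) e eqxx.
Qed.

Lemma winvV w : winv (w^-1)%g = winv w.
Proof.
have key u : (winv (u^-1)%g <= winv u)%N.
  have [s es <-] := exists_word u; rewrite -es.
  suff -> : ((wprod s)^-1 = wprod (rev s))%g by rewrite -size_rev winv_word.
  elim: s {es} => [|k s IH]; first by rewrite wprod0 invg1.
  by rewrite wprod_cons invMg IH rev_cons wprod_rcons srefV.
by apply/eqP; rewrite eqn_leq key -{1}(invgK w) key.
Qed.

End Inversions.

(** * Reduced words and braid relations *)

Section Matsumoto.
Variables (n : nat) (R : pzRingType) (z : nat -> R).
Implicit Types (k i j : 'I_n.-1) (p : 'I_n) (w : 'S_n).

Lemma sref_braid i j : i.+1 = j ->
  (sref n i * sref n j * sref n i = sref n j * sref n i * sref n j)%g.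
Proof.
move=> ij; have e : lo j = hi i by apply: val_inj; rewrite /= -ij.
have -> : (sref n i * sref n j * sref n i = sref n j ^ sref n i)%g by rewrite conjgE srefV !mulgA.
have -> : (sref n j * sref n i * sref n j = sref n i ^ sref n j)%g by rewrite conjgE srefV !mulgA.
rewrite [in LHS]srefE [X in _ = (X ^ _)%g]srefE !tpermJ e sref_hi -e sref_lo.
by rewrite !srefD // -val_eqE /=; lia.
Qed.

Lemma sref_comm i j : (i.+1 < j)%N -> (sref n i * sref n j = sref n j * sref n i)%g.
Proof.
move=> ij; have : (sref n j ^ sref n i = sref n j)%g.
  by rewrite [sref n j]srefE tpermJ !srefD // -val_eqE /=; lia.
by move=> e; rewrite [RHS]conjgC e.
Qed.

Hypothesis z_braid : forall i j, i.+1 = j ->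
  z i.+1 * z j.+1 * z i.+1 = z j.+1 * z i.+1 * z j.+1.
Hypothesis z_comm : forall i j, (i.+1 < j)%N -> z i.+1 * z j.+1 = z j.+1 * z i.+1.

Definition zprod (s : seq 'I_n.-1) : R := \prod_(j <- s) z j.+1.

Lemma zprod_rcons s k : zprod (rcons s k) = zprod s * z k.+1.
Proof. by rewrite /zprod -cats1 big_cat big_seq1. Qed.
Definition reduced (s : seq 'I_n.-1) := winv (wprod s) = size s.

Lemma reduced_rcons s k : reduced (rcons s k) -> reduced s /\ asc (wprod s) k.
Proof.
rewrite /reduced wprod_rcons size_rcons => h.
have := winv_word s; case: (boolP (asc (wprod s) k)) => [a|/winv_desc]; last by lia.
by move=> _; split=> //; move: h; rewrite winv_asc // => -[].
Qed.

Lemma rcons_reduced s k : reduced s -> asc (wprod s) k -> reduced (rcons s k).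
Proof. by rewrite /reduced wprod_rcons size_rcons => <- /winv_asc. Qed.

Lemma exists_reduced w : exists2 s, wprod s = w & reduced s.
Proof. by have [s es ss] := exists_word w; exists s => //; rewrite /reduced es. Qed.

(* Matsumoto's theorem: if a reduced word can end in [i] or in [j], then both
   endings extend to the longest word in [i], [j]. *)
Lemma matsumoto s s' : reduced s -> reduced s' -> wprod s = wprod s' -> zprod s = zprod s'.
Proof.
move em : (size s) => m; elim: m s s' em => [|m IH] s s' em rs rs' e.
  have /size0nil -> : size s' = 0%N by rewrite -rs' -e rs.
  by rewrite (size0nil em).
have em' : size s' = m.+1 by rewrite -rs' -e rs.
case/lastP: s rs em e => // u i ri; case/lastP: s' rs' em' => // v j rj.
rewrite !size_rcons => -[sv] -[su]; rewrite !wprod_rcons => e.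
have [[ru ai] [rv aj]] := (reduced_rcons ri, reduced_rcons rj).
rewrite !zprod_rcons.
wlog ij : i j u v ri rj ru rv ai aj su sv e / (i <= j)%N.
  by move=> H; case: (leqP i j) => [|/ltnW] ij; [apply: H|symmetry; apply: H].
have [eij|nij] := eqVneq i j.
  by congr (_ * _); last rewrite eij //; apply: IH => //; move: e; rewrite eij; apply: mulIg.
set w := (wprod u * sref n i)%g in e; have ew : w = (wprod u * sref n i)%g by [].
clearbody w.
have di : ~~ asc w i by rewrite ew ascM negbK.
have dj : ~~ asc w j by rewrite e ascM negbK.
have eu : wprod u = (w * sref n i)%g by rewrite ew mulKsref.
have ev : wprod v = (w * sref n j)%g by rewrite e mulKsref.
have {}ij : (i < j)%N by rewrite ltn_neqAle ij andbT val_eqE.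
have [ij1|ij1] := eqVneq (i.+1) j; last first.
  have {}ij1 : (i.+1 < j)%N by lia.
  have [x ex rx] := exists_reduced (w * sref n i * sref n j)%g.
  have ax : asc (wprod x) j.
    by rewrite ex ascM /asc invMg srefV !permM !(srefD (k := i)) -?val_eqE /=; try lia.
  have ay : asc (wprod x) i.
    rewrite ex -mulgA sref_comm // mulgA.
    by rewrite ascM /asc invMg srefV !permM !(srefD (k := j)) -?val_eqE /=; try lia.
  have -> : zprod u = zprod (rcons x j).
    apply: IH => //; first exact: rcons_reduced.
    by rewrite wprod_rcons ex eu mulKsref.
  have -> : zprod v = zprod (rcons x i).
    apply: IH => //; first exact: rcons_reduced.
    by rewrite wprod_rcons ex ev -(mulgA w) sref_comm // mulgA mulKsref.
  by rewrite !zprod_rcons -!mulrA (z_comm ij1).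
have e1 : lo j = hi i by apply: val_inj; rewrite /= -ij1.
have di' : ((w^-1)%g (hi i) < (w^-1)%g (lo i))%N by rewrite ascPn.
have dj' : ((w^-1)%g (hi j) < (w^-1)%g (hi i))%N by rewrite -e1 ascPn.
have nlo : sref n j (lo i) = lo i by rewrite srefD // -val_eqE /=; lia.
have nhi : sref n i (hi j) = hi j by rewrite srefD // -val_eqE /=; lia.
have nlo' : sref n i (lo j) = lo i by rewrite e1 sref_hi.
have nhi' : sref n j (hi i) = hi j by rewrite -e1 sref_lo.
have eb : (w * sref n i * sref n j * sref n i = w * sref n j * sref n i * sref n j)%g.
  by have := congr1 (fun u => w * u)%g (sref_braid ij1); rewrite !mulgA.
(* [w] has descents at both [i] and [j], so it is a reduced product of some element, here spelled by
   [x], and the longest element of the group generated by the two reflections. *)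
have [x ex rx] := exists_reduced (w * sref n i * sref n j * sref n i)%g.
have rxi : reduced (rcons x i).
  apply: rcons_reduced => //; rewrite ex ascM -ascPn !invMg !srefV !permM.
  by rewrite nlo nhi' nhi sref_lo.
have rxj : reduced (rcons x j).
  apply: rcons_reduced => //; rewrite ex eb ascM -ascPn !invMg !srefV !permM.
  by rewrite nhi nlo' nlo sref_hi e1.
have rxij : reduced (rcons (rcons x i) j).
  apply: rcons_reduced => //; rewrite wprod_rcons ex mulKsref ascM -ascPn !invMg !srefV !permM.
  by rewrite nlo' nhi; apply: ltn_trans dj' di'.
have rxji : reduced (rcons (rcons x j) i).
  apply: rcons_reduced => //; rewrite wprod_rcons ex eb mulKsref ascM -ascPn !invMg !srefV !permM.
  by rewrite nlo nhi'; apply: ltn_trans dj' di'.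
have -> : zprod u = zprod (rcons (rcons x i) j).
  by apply: IH => //; rewrite !wprod_rcons ex eu !mulKsref.
have -> : zprod v = zprod (rcons (rcons x j) i).
  by apply: IH => //; rewrite !wprod_rcons ex ev eb !mulKsref.
by have := congr1 (fun u => zprod x * u) (z_braid ij1); rewrite !zprod_rcons !mulrA.
Qed.

Lemma redword_reduced w : reduced (redword w).
Proof. by have [e s] := redwordP w; rewrite /reduced e s. Qed.

End Matsumoto.

(** * Structure of bH_n(q) *)

Section Generation.
Variables (n : nat) (S : comUnitAlgType CC) (q : S) (A : algType S) (e z : nat -> A).
Hypothesis HA : is_bH n q e z.
Variable P : A -> Prop.
Hypotheses (P1 : P 1) (PD : forall a b, P a -> P b -> P (a + b))
  (PZ : forall c a, P a -> P (c *: a)) (PM : forall a b, P a -> P b -> P (a * b))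
  (Pe : forall i, (0 < i < n)%N -> P (e i)) (Pz : forall i, (0 < i < n)%N -> P (z i)).

Definition genpred : pred A := fun a => `[< P a >].

Lemma genpred_closed : GRing.subsemialg_closed genpred.
Proof.
split; first exact/asboolP.
- split; first by apply/asboolP; rewrite -(scale0r (1 : A)); apply: PZ.
  by move=> a b /asboolP Pa /asboolP Pb; apply/asboolP/PD.
- by move=> c a /asboolP Pa; apply/asboolP/PZ.
- by move=> a b /asboolP Pa /asboolP Pb; apply/asboolP/PM.
Qed.

Definition gensub := {a : A | genpred a}.
HB.instance Definition _ := SubType.on gensub.
HB.instance Definition _ := Choice.on gensub.
HB.instance Definition _ :=
  GRing.SubChoice_isSubAlgebra.Build S A genpred gensub genpred_closed.

(* The elements satisfying [P] form a subalgebra; the universal property gives a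
   retraction of [A] onto it, which is the identity by uniqueness. *)
Lemma bH_ind a : P a.
Proof.
have [rel univ] := HA.
pose lift (f : nat -> A) (i : nat) : gensub := insubd (0 : gensub) (f i).
have liftE f i : P (f i) -> val (lift f i) = f i.
  by move=> h; rewrite /lift /insubd insubT //; apply/asboolP.
have [] := univ (gensub : algType S) (lift e) (lift z).
  move=> i j hi hj; have [r1 [r2 [r3 [r4 [r5 [r6 r7]]]]]] := rel i j hi hj.
  do ![split] => *; apply: val_inj; rewrite ?rmorphM ?raddfD ?linearZ /= ?rmorphM /= ?liftE; auto.
move=> f [[fD fZ fM f1] fg _].
have [g [_ _ gu]] := univ A e z rel.
have h1 : val (f a) = g a.
  apply: (gu (fun a => val (f a))).
    by split=> *; rewrite ?fD ?fZ ?fM ?f1 ?raddfD ?linearZ ?rmorphM ?rmorph1.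
  by move=> i hi; have [-> ->] := fg i hi; rewrite !liftE; auto.
have h2 : a = g a by apply: (gu id).
by rewrite h2 -h1; apply/asboolP/(valP (f a)).
Qed.
End Generation.

Section Structure.
Variables (n : nat) (S : comUnitAlgType CC) (q : S) (A : algType S) (e z : nat -> A) (star : A -> A).
Hypotheses (HA : is_bH n q e z) (HS : is_bH_star n e z star).
Implicit Types (k i j : 'I_n.-1) (p : 'I_n) (w : 'S_n) (K : {set 'I_n.-1}).

Lemma gen_bound k : (0 < k.+1 < n)%N. Proof. by have := ltn_hi k. Qed.

Lemma rels i j : let i' := i.+1 in let j' := j.+1 in
  e i' * e i' = e i' /\  e i' * e j' = e j' * e i' /\
  ((i'.+1 = j' \/ j'.+1 = i') -> z i' * z j' * z i' = z j' * z i' * z j') /\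
  ((i'.+1 < j' \/ j'.+1 < i')%N -> z i' * z j' = z j' * z i') /\
  e i' * z i' = z i' /\ e i' * z j' = z j' * e i' /\
  z i' * z i' = e i' + (q - q^-1) *: z i'.
Proof. by apply: (HA.1); apply: gen_bound. Qed.

Lemma e_idem i : e i.+1 * e i.+1 = e i.+1. Proof. by have [] := rels i i. Qed.
Lemma e_comm i j : GRing.comm (e i.+1) (e j.+1). Proof. by have [_ []] := rels i j. Qed.
Lemma ez_comm i j : GRing.comm (e i.+1) (z j.+1). Proof. by have [_ [_ [_ [_ [_ []]]]]] := rels i j. Qed.
Lemma e_z i : e i.+1 * z i.+1 = z i.+1. Proof. by have [_ [_ [_ [_ []]]]] := rels i i. Qed.
Lemma z_sqr i : z i.+1 * z i.+1 = e i.+1 + (q - q^-1) *: z i.+1.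
Proof. by have [_ [_ [_ [_ [_ []]]]]] := rels i i. Qed.
Lemma z_braid i j : i.+1 = j -> z i.+1 * z j.+1 * z i.+1 = z j.+1 * z i.+1 * z j.+1.
Proof. by move=> ij; have [_ [_ [h _]]] := rels i j; apply: h; left; rewrite ij. Qed.
Lemma z_comm i j : (i.+1 < j)%N -> z i.+1 * z j.+1 = z j.+1 * z i.+1.
Proof. by move=> ij; have [_ [_ [_ [h _]]]] := rels i j; apply: h; left; lia. Qed.

Lemma bH_ind' (P : A -> Prop) : P 1 -> (forall a b, P a -> P b -> P (a + b)) ->
  (forall c a, P a -> P (c *: a)) -> (forall a b, P a -> P b -> P (a * b)) ->
  (forall k, P (e k.+1)) -> (forall k, P (z k.+1)) -> forall a, P a.
Proof.
move=> h1 hD hZ hM he hz; apply: (bH_ind HA) => // -[//|i] hi.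
  by have hk : (i < n.-1)%N by [lia]; apply: (he (Ordinal hk)).
by have hk : (i < n.-1)%N by [lia]; apply: (hz (Ordinal hk)).
Qed.

(** Prescribing for each [i] whether e_i acts as 1 or as 0 makes orthogonality and completeness of
    the idempotents visible. Expanding the product gives the signed sum that defines the idempotent
    of a linear set partition ([EK_expand], [bEI_PK]). *)
Definition Efac K i : A := if i \in K then e i.+1 else 1 - e i.+1.
Definition EK K : A := \prod_(i < n.-1) Efac K i.

Lemma Efac_comm K i x : (forall i, GRing.comm x (e i.+1)) -> GRing.comm x (Efac K i).
Proof.
move=> h; rewrite /Efac; case: ifP => _ //; apply: commrB => //; exact: commr1.
Qed.

Lemma EK_comm K x : (forall i, GRing.comm x (e i.+1)) -> GRing.comm x (EK K).
Proof. by move=> h; apply: commr_prod => i _; apply: Efac_comm. Qed.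

Lemma EK_central K a : EK K * a = a * EK K.
Proof.
elim/bH_ind': a => [|a b ha hb|c a ha|a b ha hb|k|k].
- by rewrite mulr1 mul1r.
- by rewrite mulrDr mulrDl ha hb.
- by rewrite -scalerAr -scalerAl ha.
- by rewrite mulrA ha -mulrA hb mulrA.
- by apply: esym; apply: EK_comm => i; apply: e_comm.
- by apply: esym; apply: EK_comm => i; apply/esym/ez_comm.
Qed.

Lemma prod_absorb (F : 'I_n.-1 -> A) x k (c : S) : (forall i, GRing.comm x (F i)) ->
  x * F k = c *: F k -> x * \prod_i F i = c *: \prod_i F i.
Proof.
move=> xF xk; have : k \in index_enum 'I_n.-1 by rewrite mem_index_enum.
elim: (index_enum _) => [//|a r IH]; rewrite inE !big_cons => /orP[/eqP <-|/IH h].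
  by rewrite mulrA xk scalerAl.
by rewrite mulrA xF -mulrA h scalerAr.
Qed.

Lemma e_EK k K : k \in K -> e k.+1 * EK K = EK K.
Proof.
move=> kK; rewrite /EK (@prod_absorb _ _ k 1) ?scale1r //.
  by move=> i; apply: Efac_comm => j; apply: e_comm.
by rewrite /Efac kK e_idem.
Qed.

Lemma e_EK0 k K : k \notin K -> e k.+1 * EK K = 0.
Proof.
move=> kK; rewrite /EK (@prod_absorb _ _ k 0) ?scale0r //.
  by move=> i; apply: Efac_comm => j; apply: e_comm.
by rewrite /Efac (negbTE kK) mulrBr mulr1 e_idem subrr.
Qed.

Lemma EK_e k K : EK K * e k.+1 = (k \in K)%:R *: EK K.
Proof.
rewrite EK_central; case: (boolP (k \in K)) => h; first by rewrite e_EK // mulr1n scale1r.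
by rewrite e_EK0 // mulr0n scale0r.
Qed.

Lemma EK_Efac K K' k : EK K * Efac K' k = ((k \in K) == (k \in K'))%:R *: EK K.
Proof.
rewrite /Efac; case: (k \in K') => /=; first by rewrite EK_e eqb_id.
by rewrite mulrBr mulr1 EK_e; case: (k \in K); rewrite ?mulr1n ?mulr0n ?scale1r ?scale0r ?subr0 ?subrr.
Qed.

Lemma EK_mul K K' : EK K * EK K' = (K == K')%:R *: EK K.
Proof.
rewrite [X in _ * X]/EK; have [->|] := eqVneq K K'.
  rewrite mulr1n scale1r; elim: (index_enum _) => [|k r IH]; first by rewrite big_nil mulr1.
  by rewrite big_cons mulrA EK_Efac eqxx mulr1n scale1r.
move=> nK; have [k nk] : exists k, (k \in K) != (k \in K').
  apply/existsP; apply: contraNT nK; rewrite negb_exists => /forallP h.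
  by apply/eqP/setP => k; apply/eqP; have := h k; rewrite negbK.
rewrite mulr0n scale0r; have : k \in index_enum 'I_n.-1 by rewrite mem_index_enum.
elim: (index_enum _) => [//|a r IH]; rewrite inE !big_cons mulrA EK_Efac.
case/orP => [/eqP<-|/IH h]; first by rewrite (negbTE nk) mulr0n scale0r mul0r.
by rewrite -scalerAl h scaler0.
Qed.

Lemma EK_idem K : EK K * EK K = EK K. Proof. by rewrite EK_mul eqxx mulr1n scale1r. Qed.

Lemma sum_EK : \sum_K EK K = 1.
Proof.
have -> : 1 = \prod_(i < n.-1) (e i.+1 + (1 - e i.+1)) :> A.
  by rewrite big1 // => i _; rewrite addrC subrK.
rewrite bigA_distr; apply: eq_big => [K|K _]; [by rewrite inE|by []].
Qed.

Lemma starD a b : star (a + b) = star a + star b. Proof. by have [] := HS. Qed.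
Lemma starZ c a : star (c *: a) = c *: star a. Proof. by have [] := HS. Qed.
Lemma starM a b : star (a * b) = star b * star a. Proof. by have [] := HS. Qed.
Lemma star_e k : star (e k.+1) = e k.+1.
Proof. by have [_ _ _ _ h] := HS; have [] := h _ (gen_bound k). Qed.
Lemma star_z k : star (z k.+1) = z k.+1.
Proof. by have [_ _ _ _ h] := HS; have [] := h _ (gen_bound k). Qed.
Lemma star0 : star 0 = 0. Proof. by have := starZ 0 0; rewrite !scale0r. Qed.
Lemma star1 : star 1 = 1.
Proof.
have [_ _ _ [g gK sK] _] := HS.
by rewrite -[LHS]mulr1 -{2}(sK 1) -starM mulr1 sK.
Qed.
Lemma starN a : star (- a) = - star a. Proof. by rewrite -scaleN1r starZ scaleN1r. Qed.
Lemma star_sum (I : Type) (r : seq I) (P : pred I) (F : I -> A) :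
  star (\sum_(i <- r | P i) F i) = \sum_(i <- r | P i) star (F i).
Proof. exact: (big_morph star starD star0). Qed.

Lemma starK a : star (star a) = a.
Proof.
elim/bH_ind': a => [|a b ha hb|c a ha|a b ha hb|k|k].
- by rewrite !star1.
- by rewrite !starD ha hb.
- by rewrite !starZ ha.
- by rewrite !starM ha hb.
- by rewrite !star_e.
- by rewrite !star_z.
Qed.

Lemma star_EK K : star (EK K) = EK K.
Proof.
rewrite /EK; elim: (index_enum _) => [|k r IH]; first by rewrite big_nil star1.
rewrite big_cons starM IH.
have -> : star (Efac K k) = Efac K k.
  by rewrite /Efac; case: ifP; rewrite ?starD ?starN ?star1 ?star_e.
apply/esym/commr_prod => i _; apply: Efac_comm => j; apply/commr_sym.
by apply: Efac_comm => l; apply: e_comm.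
Qed.

Notation zp := (@zprod n A z).

Lemma zw_reduced s : reduced s -> zw z (wprod s) = zp s.
Proof.
move=> rs; apply: (matsumoto z_braid z_comm) => //; first exact: redword_reduced.
by have [] := redwordP (wprod s).
Qed.

Lemma zw1 : zw z (1 : 'S_n) = 1.
Proof. by rewrite -(@wprod0 n) zw_reduced /zprod ?big_nil // /reduced wprod0 winv1. Qed.

Lemma zw_asc w k : asc w k -> zw z (w * sref n k)%g = zw z w * z k.+1.
Proof.
move=> a; have [s es rs] := exists_reduced w.
rewrite -es in a *; rewrite -wprod_rcons !zw_reduced ?zprod_rcons //.
exact: rcons_reduced.
Qed.

Lemma star_zw w : star (zw z w) = zw z (w^-1)%g.
Proof.
have [s es rs] := exists_reduced w; rewrite -es.
have eV : wprod (rev s) = ((wprod s)^-1)%g.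
  elim: s {es rs} => [|k s IH]; first by rewrite wprod0 invg1.
  by rewrite wprod_cons invMg -IH rev_cons wprod_rcons srefV.
rewrite -eV !zw_reduced //; last by rewrite /reduced eV winvV rs size_rev.
elim: {es rs eV} s => [|k s IH]; first by rewrite /zprod !big_nil star1.
by rewrite rev_cons zprod_rcons -IH /zprod big_cons starM star_z.
Qed.

(** The standard basis element T_w of the Hecke algebra of the Young subgroup of [K]. On [EK K * A]
    the quadratic relation reads z_k^2 = 1 + (q - q^-1) z_k for [k] in [K], since e_k acts as 1
    there; for other [k], z_k = e_k z_k acts as 0. *)
Definition TT K w : A := EK K * zw z w.

Lemma TT_asc K w k : asc w k -> TT K w * z k.+1 = TT K (w * sref n k)%g.
Proof. by move=> a; rewrite /TT zw_asc // mulrA. Qed.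

Lemma EK_z K k : k \notin K -> EK K * z k.+1 = 0.
Proof. by move=> kK; rewrite -e_z mulrA EK_e (negbTE kK) mulr0n scale0r mul0r. Qed.

Lemma TT_z0 K w k : k \notin K -> TT K w * z k.+1 = 0.
Proof. by move=> kK; rewrite /TT EK_central -mulrA EK_z // mulr0. Qed.

Lemma TT_EK K w : TT K w * EK K = TT K w.
Proof. by rewrite /TT -EK_central mulrA EK_idem. Qed.
Lemma star_TT K w : star (TT K w) = TT K (w^-1)%g.
Proof. by rewrite /TT starM star_EK star_zw EK_central. Qed.

Lemma TT_desc K w k : k \in K -> ~~ asc w k ->
  TT K w * z k.+1 = TT K (w * sref n k)%g + (q - q^-1) *: TT K w.
Proof.
move=> kK nd; have a : asc (w * sref n k)%g k by rewrite ascM nd.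
rewrite -{1 3}(mulKsref w k) -TT_asc // -mulrA z_sqr mulrDr -scalerAr TT_asc //.
by rewrite mulKsref -{1}TT_EK -mulrA EK_e kK mulr1n scale1r TT_EK.
Qed.

End Structure.

(** * The regular representation *)

Section Rep.
Variables (n : nat) (S : comUnitAlgType CC) (q : S) (K : {set 'I_n.-1}).
Implicit Types (k i j : 'I_n.-1) (w : 'S_n).
Notation N := (#|{: 'S_n}|.-1.+1).

(** The size is written as a successor so that square matrices form an [algType], as the universal
    property requires. *)
Lemma card_perm_pos : N = #|{: 'S_n}|.
Proof. by rewrite prednK //; apply/card_gt0P; exists 1%g. Qed.

Definition bv w : 'rV[S]_N := delta_mx 0 (cast_ord (esym card_perm_pos) (enum_rank w)).
Definition bval (i : 'I_N) : 'S_n := enum_val (cast_ord card_perm_pos i).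
(** Right multiplication of T_w by z_k, with [bv w] standing for T_w. *)
Definition Rrow k w : 'rV[S]_N :=
  bv (w * sref n k)%g + (if asc w k then 0 else (q - q^-1) *: bv w).
Definition Rmx k : 'M[S]_N := \matrix_i Rrow k (bval i).

Lemma bv_Rmx k w : bv w *m Rmx k = Rrow k w.
Proof. by rewrite -rowE rowK /bval cast_ordKV enum_rankK. Qed.

Lemma bv_mulmx_inj (M M' : 'M[S]_N) : (forall w, bv w *m M = bv w *m M') -> M = M'.
Proof.
by move=> h; apply/row_matrixP => i; have := h (bval i); rewrite /bv /bval -!rowE enum_valK cast_ordK.
Qed.

Lemma Rmx_asc k w : asc w k -> bv w *m Rmx k = bv (w * sref n k)%g.
Proof. by move=> a; rewrite bv_Rmx /Rrow a addr0. Qed.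
Lemma Rmx_desc k w : ~~ asc w k -> bv w *m Rmx k = bv (w * sref n k)%g + (q - q^-1) *: bv w.
Proof. by move=> a; rewrite bv_Rmx /Rrow (negbTE a). Qed.

Lemma Rmx_sqr k : Rmx k * Rmx k = 1 + (q - q^-1) *: Rmx k.
Proof.
apply: bv_mulmx_inj => w; rewrite mulmxA mulmxDr -scalemxAr mulmx1.
case: (boolP (asc w k)) => a.
  by rewrite (Rmx_asc a) Rmx_desc ?mulKsref // ascM negbK.
by rewrite (Rmx_desc a) mulmxDl -scalemxAl (Rmx_desc a) Rmx_asc ?mulKsref // ascM.
Qed.

Lemma ascM_far i j w : (i.+1 < j)%N || (j.+1 < i)%N -> asc (w * sref n i)%g j = asc w j.
Proof.
by move=> ij; rewrite /asc invMg srefV !permM !srefD // -val_eqE /=; move: ij; lia.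
Qed.

Lemma Rmx_comm i j : (i.+1 < j)%N -> Rmx i * Rmx j = Rmx j * Rmx i.
Proof.
move=> ij; apply: bv_mulmx_inj => w; rewrite !mulmxA !bv_Rmx /Rrow.
have ai : asc (w * sref n j)%g i = asc w i by apply: ascM_far; rewrite ij orbT.
have aj : asc (w * sref n i)%g j = asc w j by apply: ascM_far; rewrite ij.
have ws : (w * sref n i * sref n j = w * sref n j * sref n i)%g.
  by rewrite -[LHS]mulgA sref_comm // mulgA.
rewrite !mulmxDl !bv_Rmx /Rrow ai aj ws.
case Ei: (asc w i); case Ej: (asc w j);
  do ?rewrite -?scalemxAl ?mul0mx ?addr0 ?bv_Rmx /Rrow ?Ei ?Ej //.
by apply/rowP => x; rewrite !mxE; ring.
Qed.

(** On [bv w] everything depends on the relative order of the values of [w^-1] at three consecutive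
    points. All ascents met along the two braid words reduce to [asc w i], [asc w j] and the
    comparison [x] of the outer two values; every consistent case is an identity between
    coefficients. *)
Lemma Rmx_braid i j : i.+1 = j -> Rmx i * Rmx j * Rmx i = Rmx j * Rmx i * Rmx j.
Proof.
move=> ij; apply: bv_mulmx_inj => w; rewrite !mulmxA.
have e1 : lo j = hi i by apply: val_inj; rewrite /= -ij.
have nlo : sref n j (lo i) = lo i by rewrite srefD // -val_eqE /=; lia.
have nhi : sref n i (hi j) = hi j by rewrite srefD // -val_eqE /=; lia.
have nlo' : sref n i (lo j) = lo i by rewrite e1 sref_hi.
have nhi' : sref n j (hi i) = hi j by rewrite -e1 sref_lo.
have Ai : asc (w * sref n i)%g j = ((w^-1)%g (lo i) < (w^-1)%g (hi j))%N.
  by rewrite /asc invMg srefV !permM nlo' nhi.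
have Aj : asc (w * sref n j)%g i = ((w^-1)%g (lo i) < (w^-1)%g (hi j))%N.
  by rewrite /asc invMg srefV !permM nlo nhi'.
have Aii : asc (w * sref n i)%g i = ~~ asc w i by rewrite ascM.
have Ajj : asc (w * sref n j)%g j = ~~ asc w j by rewrite ascM.
have Aij : asc (w * sref n i * sref n j)%g i = asc w j.
  by rewrite /asc !invMg !srefV !permM nlo nhi' nhi sref_lo e1.
have Aji : asc (w * sref n j * sref n i)%g j = asc w i.
  by rewrite /asc !invMg !srefV !permM nlo' nhi nlo sref_hi e1.
have eb : (w * sref n i * sref n j * sref n i = w * sref n j * sref n i * sref n j)%g.
  by have := congr1 (fun u => w * u)%g (sref_braid ij); rewrite !mulgA.
have tr : asc w i -> asc w j -> ((w^-1)%g (lo i) < (w^-1)%g (hi j))%N.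
  by rewrite /asc e1; apply: ltn_trans.
have tr' : ~~ asc w i -> ~~ asc w j -> ((w^-1)%g (lo i) < (w^-1)%g (hi j))%N = false.
  by rewrite -!ascPn e1 => a b; apply/negbTE; rewrite -leqNgt ltnW // (ltn_trans b a).
move: tr tr'; set x := (_ < _)%N => tr tr'.
rewrite !bv_Rmx /Rrow !mulmxDl !bv_Rmx /Rrow.
move: Ai Aj; rewrite -/x.
case Ei : (asc w i) tr tr' Aii Aji => tr tr' Aii Aji; case Ej : (asc w j) tr tr' Ajj Aij => tr tr' Ajj Aij;
  case Ex : x tr tr' => tr tr' Ai Aj; try (by have := tr isT isT); try (by have := tr' isT isT);
  do ?(progress rewrite ?Ei ?Ej ?Ai ?Aj ?Aii ?Ajj ?Aij ?Aji ?eb ?mulKsref ?mulmxDl -?scalemxAl ?mul0mx ?addr0 ?bv_Rmx ?/Rrow /=);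
  apply/rowP => y; rewrite !mxE; ring.
Qed.

Definition nth_gen (T : Type) (x0 : T) (F : 'I_n.-1 -> T) (i : nat) : T :=
  if insub i.-1 is Some k then F k else x0.

Lemma nth_genE (T : Type) (x0 : T) (F : 'I_n.-1 -> T) k : nth_gen x0 F k.+1 = F k.
Proof. by rewrite /nth_gen /= valK. Qed.

(** This choice sends [EK K] to 1. Since z_k = e_k z_k, the z_k with [k] outside [K] must go to 0;
    the others act as in the regular representation for the whole symmetric group, which saves
    building one for the Young subgroup. *)
Definition rep_e := nth_gen 0 (fun k => if k \in K then 1 else 0 : 'M[S]_N).
Definition rep_z := nth_gen 0 (fun k => if k \in K then Rmx k else 0).

Lemma rep_rels : bH_relations n q rep_e rep_z.
Proof.
move=> [//|i'] [//|j'] hi hj.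
have ltk m : (0 < m.+1 < n)%N -> (m < n.-1)%N by lia.
pose i := Ordinal (ltk _ hi); pose j := Ordinal (ltk _ hj).
rewrite -[i'.+1]/(i.+1) -[j'.+1]/(j.+1) /rep_e /rep_z !nth_genE.
do ![split].
- by case: ifP => _; rewrite ?mulr1 ?mulr0.
- by case: ifP => _; case: ifP => _; rewrite ?mulr1 ?mulr0 ?mul1r ?mul0r.
- case: ifP => _; case: ifP => _; rewrite ?mulr0 ?mul0r ?mulr0 ?mul0r //.
  by case=> ij; [|symmetry]; apply: Rmx_braid; move: ij => /= -[].
- case: ifP => _; case: ifP => _; rewrite ?mulr0 ?mul0r //.
  by case=> ij; [|symmetry]; apply: Rmx_comm; move: ij => /=; lia.
- by case: ifP => _; rewrite ?mul1r ?mul0r.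
- by case: ifP => _; case: ifP => _; rewrite ?mulr1 ?mulr0 ?mul1r ?mul0r.
- by case: ifP => _; rewrite ?Rmx_sqr ?mulr0 ?scaler0 ?addr0.
Qed.
End Rep.

(** * Young subgroups and freeness of their standard basis *)

Section Blocks.
Variables (n : nat) (K : {set 'I_n.-1}).
Implicit Types (k i j : 'I_n.-1) (p : 'I_n) (w : 'S_n).

Definition glue (p : nat) : bool := [exists k : 'I_n.-1, (k == p :> nat) && (k \in K)].

Lemma glueE k : glue k = (k \in K).
Proof.
apply/existsP/idP => [[k' /andP[/eqP/val_inj-> //]]|kK]; by exists k; rewrite eqxx.
Qed.

(* The first position of the block of [p], when [k] and [k+1] are glued for [k] in [K]. *)
Fixpoint bst (p : nat) : nat :=
  if p is p'.+1 then if glue p' then bst p' else p else 0%N.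

Lemma bst_le (p : nat) : (bst p <= p)%N.
Proof. by elim: p => //= p IH; case: (glue p) => //; rewrite (leq_trans IH). Qed.

Lemma bst_mono (p p' : nat) : (p <= p')%N -> (bst p <= bst p')%N.
Proof.
elim: p' => [|p' IH]; first by rewrite leqn0 => /eqP->.
rewrite leq_eqVlt => /orP[/eqP-> //|]; rewrite ltnS => h /=; case: (glue p'); first exact: IH.
by rewrite (leq_trans (bst_le p)) // (leq_trans h).
Qed.

Lemma bst_hi k : bst (hi k) = if k \in K then bst (lo k) else k.+1.
Proof. by rewrite /= glueE. Qed.

Lemma mem_K k : (k \in K) = (bst (lo k) == bst (hi k)).
Proof.
rewrite bst_hi; case: ifP => _; first by rewrite eqxx.
by apply/esym/negbTE; have := bst_le (lo k) => /=; lia.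
Qed.

Lemma bst_idem (p : nat) : bst (bst p) = bst p.
Proof. by elim: p => //= p IH; case E: (glue p) => //=; rewrite E. Qed.

Definition SK : {set 'S_n} := [set w : 'S_n | [forall p, bst (w p) == bst p]].

Lemma SKP w : reflect (forall p, bst (w p) = bst p) (w \in SK).
Proof. by rewrite inE; apply: (iffP forallP) => h p; apply/eqP; have := h p. Qed.

Lemma SKV w : w \in SK -> (w^-1)%g \in SK.
Proof. by move/SKP=> h; apply/SKP => p; rewrite -{2}(permKV w p) h. Qed.
Lemma SKM w u : w \in SK -> u \in SK -> (w * u)%g \in SK.
Proof. by move=> /SKP hw /SKP hu; apply/SKP => p; rewrite permM hu hw. Qed.
Lemma SK1 : 1%g \in SK.
Proof. by apply/SKP => p; rewrite perm1. Qed.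
Lemma SK_sref k : k \in K -> sref n k \in SK.
Proof.
rewrite mem_K => /eqP e; apply/SKP => p.
by case: srefP => [->|->|]; rewrite ?e.
Qed.

(** [bst] is monotone and preserved by [f], so a weak descent at [k] forces [k] and [k+1] into one
    block. *)
Lemma desc_mem_K (f : 'I_n -> 'I_n) k : (forall p, bst (f p) = bst p) ->
  (f (hi k) <= f (lo k))%N -> k \in K.
Proof.
move=> h /bst_mono; rewrite !h mem_K eqn_leq => ->.
by rewrite bst_mono //=.
Qed.

Lemma SK_desc w k : w \in SK -> ~~ asc w k -> k \in K.
Proof.
move=> /SKV/SKP h; rewrite -ascPn => /ltnW; exact: (desc_mem_K h).
Qed.

(** Descents of an element of [SK] lie in [K], so shortening it never leaves the Young subgroup. *)
Lemma SK_ind (P : 'S_n -> Prop) : P 1%g ->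
  (forall w k, w \in SK -> k \in K -> asc w k -> P w -> P (w * sref n k)%g) ->
  forall w, w \in SK -> P w.
Proof.
move=> P1 PM w; move em : (winv w) => m; elim: m w em => [|m IH] w em wK.
  have [-> //|/exists_desc[k /winv_desc]] := eqVneq w 1%g; by rewrite em.
have [-> //|/exists_desc[k dk]] := eqVneq w 1%g.
have kK := SK_desc wK dk; have := winv_desc dk; rewrite em => -[/esym e].
rewrite -(mulKsref w k); apply: PM => //; first by apply: SKM => //; apply: SK_sref.
  by rewrite ascM.
by apply: IH => //; apply: SKM => //; apply: SK_sref.
Qed.
End Blocks.

Section Free.
Variables (n : nat) (S : comUnitAlgType CC) (q : S) (A : algType S) (e z : nat -> A).
Hypotheses (HA : is_bH n q e z).
Implicit Types (k i j : 'I_n.-1) (p : 'I_n) (w : 'S_n) (K : {set 'I_n.-1}).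

(** In the representation [EK K] acts as 1, and z_w with [w] in [SK K] moves the vector of the
    identity, along ascents only, to the unit vector of [w]. *)
Lemma TT_free K (c : 'S_n -> S) : \sum_(w in SK K) c w *: TT e z K w = 0 ->
  forall w, w \in SK K -> c w = 0.
Proof.
have [f [[fD fZ fM f1] fg _]] := HA.2 _ _ _ (rep_rels q K).
have f0 : f 0 = 0 by have := fZ 0 0; rewrite !scale0r.
have fE : f (EK e K) = 1.
  have -> : f (EK e K) = \prod_i f (Efac e K i) by apply: (big_morph f fM f1).
  apply: big1 => i _; have [fe _] := fg _ (gen_bound i).
  rewrite /Efac; case: ifP => iK; first by rewrite fe /rep_e nth_genE iK.
  by rewrite fD f1 -scaleN1r fZ fe /rep_e nth_genE iK scaler0 addr0.
have fT w : w \in SK K -> bv S 1%g *m f (zw z w) = bv S w.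
  elim/SK_ind => [|{}w k wK kK aw IH]; first by rewrite (zw1 HA) f1 mulmx1.
  rewrite (zw_asc HA) // fM; have [_ ->] := fg _ (gen_bound k).
  by rewrite mulmxA IH /rep_z nth_genE kK Rmx_asc.
move=> h w wK; have : bv S 1%g *m f (\sum_(w in SK K) c w *: TT e z K w) = \sum_(w in SK K) c w *: bv S w.
  rewrite (big_morph f fD f0) mulmx_sumr; apply: eq_bigr => u uK.
  by rewrite fZ /TT fM fE mul1r -scalemxAr fT.
rewrite h f0 mulmx0 => /matrixP/(_ 0 (cast_ord (esym (card_perm_pos n)) (enum_rank w))).
rewrite mxE summxE (bigD1 w) //= big1 => [|u /andP[_ uw]].
  by rewrite !mxE !eqxx mulr1 addr0.
by rewrite !mxE eqxx /= (inj_eq (@cast_ord_inj _ _ _)) (inj_eq enum_rank_inj) eq_sym (negbTE uw) mulr0.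
Qed.
End Free.

(** * Straightening *)

Section Span.
Variables (S : comUnitAlgType CC) (A : algType S).
Implicit Types (G : A -> Prop) (a b : A) (c : S).

(** Generators are given by a predicate and combinations by induction, so that linear maps and
    changes of generators are handled by [spn_lin]. Families of coefficients are extracted only
    where they are wanted, by [spn_fin] and [spn_list]. *)
Inductive spn G : A -> Prop :=
| spn0 : spn G 0
| spn_cons c a b : G a -> spn G b -> spn G (c *: a + b).

Lemma spn_gen G a : G a -> spn G a.
Proof. by move=> Ga; rewrite -[a]scale1r -[X in spn _ X]addr0; apply: spn_cons => //; apply: spn0. Qed.

Lemma spnD G a b : spn G a -> spn G b -> spn G (a + b).
Proof.
elim=> [|c x y Gx _ IH] hb; first by rewrite add0r.
by rewrite -addrA; apply: spn_cons => //; apply: IH.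
Qed.

Lemma spn_lin G G' (f : A -> A) : f 0 = 0 -> (forall x y, f (x + y) = f x + f y) ->
  (forall c x, f (c *: x) = c *: f x) ->
  (forall a, G a -> spn G' (f a)) -> forall a, spn G a -> spn G' (f a).
Proof.
move=> f0 fD fZ h a; elim=> [|c x y Gx _ IH]; first by rewrite f0; apply: spn0.
rewrite fD fZ; apply: spnD => //; elim: (h x Gx) => [|c' x' y' G'x' _ IH'].
  by rewrite scaler0; apply: spn0.
by rewrite scalerDr scalerA; apply: spn_cons.
Qed.

Lemma spn_bind G G' : (forall a, G a -> spn G' a) -> forall a, spn G a -> spn G' a.
Proof. by move=> h; apply: (spn_lin (f := id)). Qed.

Lemma spn_sub G G' : (forall a, G a -> G' a) -> forall a, spn G a -> spn G' a.
Proof. by move=> h; apply: spn_bind => a Ga; apply/spn_gen/h. Qed.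

Lemma spnZ G c a : spn G a -> spn G (c *: a).
Proof.
apply: (spn_lin (f := fun x => c *: x)) => [|x y|c' x|x Gx].
- by rewrite scaler0.
- by rewrite scalerDr.
- by rewrite !scalerA mulrC.
by rewrite -[_ *: _]addr0; apply: spn_cons => //; apply: spn0.
Qed.

Lemma spnN G a : spn G a -> spn G (- a).
Proof. by rewrite -scaleN1r; apply: spnZ. Qed.

Lemma spnB G a b : spn G a -> spn G b -> spn G (a - b).
Proof. by move=> ha hb; apply: spnD => //; apply: spnN. Qed.

Lemma spn_sum G (I : Type) (r : seq I) (P : pred I) (F : I -> A) :
  (forall i, P i -> spn G (F i)) -> spn G (\sum_(i <- r | P i) F i).
Proof. by move=> h; apply: (big_ind (spn G)) => //; [apply: spn0|apply: spnD]. Qed.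

Lemma spn_mulr G G' b : (forall a, G a -> spn G' (a * b)) -> forall a, spn G a -> spn G' (a * b).
Proof.
move=> h; apply: (spn_lin (f := fun x => x * b)) => //; first by rewrite mul0r.
  by move=> x y; rewrite mulrDl.
by move=> c x; rewrite scalerAl.
Qed.

Lemma spn_mull G G' b : (forall a, G a -> spn G' (b * a)) -> forall a, spn G a -> spn G' (b * a).
Proof.
move=> h; apply: (spn_lin (f := fun x => b * x)) => //; first by rewrite mulr0.
  by move=> x y; rewrite mulrDr.
by move=> c x; rewrite scalerAr.
Qed.

Lemma spn_unit G (c : S) a : c \is a GRing.unit -> spn G (c *: a) -> spn G a.
Proof. by move=> uc /(spnZ c^-1); rewrite scalerA mulVr // scale1r. Qed.
End Span.

Section Words.
Variable n : nat.
Implicit Types (k i j : 'I_n.-1) (p : 'I_n) (w : 'S_n) (f g x : 'I_n -> 'I_n).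

Definition ndec f := forall p p', (p <= p')%N -> (f p <= f p')%N.

Lemma no_desc_ndec f : (forall k, (f (lo k) <= f (hi k))%N) -> ndec f.
Proof.
move=> h p p'; rewrite leq_eqVlt => /orP[/eqP/val_inj-> //|pp].
exact: (@adj_homo _ leq (fun p => f p) n leq_trans (fun k _ => h k)).
Qed.

Lemma ndecP f : ndec f \/ exists k, (f (hi k) < f (lo k))%N.
Proof.
case: (boolP [exists k, (f (hi k) < f (lo k))%N]) => [/existsP|]; first by right.
rewrite negb_exists => /forallP h; left; apply: no_desc_ndec => k.
by rewrite leqNgt; apply: h.
Qed.

(** Pigeonhole: among the positions up to [p] some [p'] has [w p'] at least [p], and then f p <= f
    (w p') <= g p' <= g p. This turns a comparison up to rearrangement into dominance. *)
Lemma ndec_le_perm f g w : ndec f -> ndec g -> (forall p, (f (w p) <= g p)%N) ->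
  forall p, (f p <= g p)%N.
Proof.
move=> nf ng h p.
have [p' p'p wp'] : exists2 p' : 'I_n, (p' <= p)%N & (p <= w p')%N.
  apply/exists_inP; rewrite -[X in is_true X]negbK negb_exists_in; apply/negP => /forall_inP H.
  have sub : w @: [set p' : 'I_n | (p' <= p)%N] \subset [set p' : 'I_n | (p' < p)%N].
    apply/subsetP => y /imsetP[p']; rewrite !inE => /H; rewrite -ltnNge => lt ->; exact: lt.
  have := subset_leq_card sub; rewrite card_imset; last exact: perm_inj.
  apply/negP; rewrite -ltnNge; apply: proper_card; apply/properP; split.
    by apply/subsetP => y; rewrite !inE => /ltnW.
  by exists p; rewrite !inE ?ltnn.
apply: leq_trans (nf _ _ wp') _; apply: leq_trans (h _) _; exact: ng.
Qed.

Lemma ndec_perm_eq f g w : ndec f -> ndec g -> (forall p, f (w p) = g p) -> f =1 g.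
Proof.
move=> nf ng h p; apply: val_inj; apply/eqP; rewrite /= eqn_leq.
rewrite (@ndec_le_perm f g w) // => [|p']; last by rewrite h.
by rewrite (@ndec_le_perm g f (w^-1)%g) // => p'; rewrite -h permKV.
Qed.

Lemma inv_desc k f : (f (hi k) < f (lo k))%N -> inv f = (inv (fun p => f (sref n k p))).+1.
Proof. by move=> h; have := inv_sref k f; rewrite h ltnNge (ltnW h) /=; lia. Qed.

Lemma leq_inv_sref k f : (inv (fun p => f (sref n k p)) <= (inv f).+1)%N.
Proof. by have := inv_sref k f; case: (f (lo k) < _)%N => /=; lia. Qed.

Definition cnt f (v : 'I_n) := #|[set p | f p == v]|.

Lemma cnt_perm f g w v : (forall p, f (w p) = g p) -> cnt f v = cnt g v.
Proof.
move=> h; rewrite /cnt -[RHS](card_imset _ (@perm_inj _ w)); apply: eq_card => p; rewrite inE.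
apply/eqP/imsetP => [e|[p' + ->]]; last by rewrite inE -h => /eqP.
by exists ((w^-1)%g p); rewrite ?permKV // inE -h permKV e.
Qed.

End Words.

Section Core.
Variables (n : nat) (S : comUnitAlgType CC) (q : S) (A : algType S) (e z : nat -> A) (star : A -> A).
Hypotheses (HA : is_bH n q e z) (HS : is_bH_star n e z star) (Uq : q \is a GRing.unit).
Variable K : {set 'I_n.-1}.
Implicit Types (k i j : 'I_n.-1) (p : 'I_n) (w : 'S_n) (f g x pi : 'I_n -> 'I_n) (P Y : {set 'I_n}).
Notation T := (TT e z K).

Definition cpt f := forall p, bst K (f p) = bst K p.

(* A multiple of [m_pi z_d] when [f = pi o d^-1] with [d] increasing on the rows of [pi];
   zero when [f] and [pi] do not have the same content. *)
Definition fibsum pi f : A := \sum_(w : 'S_n | [forall p, f (w p) == pi p]) q ^+ winv w *: T w.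

Lemma eq_fibsum pi pi' f f' : pi =1 pi' -> f =1 f' -> fibsum pi f = fibsum pi' f'.
Proof.
move=> e1 e2; apply: eq_bigl => w; apply: eq_forallb => p; by rewrite e1 e2.
Qed.

Lemma fibsum_neq0 pi f : fibsum pi f <> 0 -> exists w : 'S_n, forall p, f (w p) = pi p.
Proof.
case: (boolP [exists w : 'S_n, [forall p, f (w p) == pi p]]) => [/existsP[w /forallP h] _|].
  by exists w => p; apply/eqP.
rewrite negb_exists => /forallP h []; apply: big_pred0 => w; exact/negbTE.
Qed.

Lemma star_fibsum pi f : star (fibsum pi f) = fibsum f pi.
Proof.
rewrite /fibsum (star_sum HS) (reindex_inj invg_inj) /=; apply: eq_big => [w|w _].
  apply/forallP/forallP => h p; first by have := h (w p); rewrite permK eq_sym.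
  by have := h ((w^-1)%g p); rewrite permKV eq_sym.
by rewrite winvV (starZ HS) (star_TT HA HS) invgK.
Qed.

Lemma fib_asc pi f w k : ndec pi -> (forall p, f (w p) = pi p) ->
  (f (lo k) < f (hi k))%N -> asc w k.
Proof.
move=> nd h; apply: contraTT => /= na; rewrite -leqNgt.
by rewrite -{1}(permKV w (hi k)) -{1}(permKV w (lo k)) !h; apply: nd; rewrite ltnW // ascPn.
Qed.

(** By [fib_asc] all permutations in the sum ascend at [k], so right multiplication by s_k maps them
    onto those for the exchanged word and lengthens each by one. *)
Lemma fibsum_asc pi f k : ndec pi -> (f (lo k) < f (hi k))%N ->
  fibsum pi f * z k.+1 = q^-1 *: fibsum pi (fun p => f (sref n k p)).
Proof.
move=> nd lt; rewrite /fibsum mulr_suml [in RHS](reindex_inj (mulIg (sref n k))) scaler_sumr.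
apply: eq_big => [w|w /forallP h].
  by apply: eq_forallb => p; rewrite permM srefK.
have a : asc w k by apply: (fib_asc nd _ lt) => p; apply/eqP.
by rewrite -scalerAl (TT_asc HA) // scalerA winv_asc // exprS mulKr.
Qed.

Lemma fibsum_z0 pi f k : k \notin K -> fibsum pi f * z k.+1 = 0.
Proof.
by move=> kK; rewrite mulr_suml big1 // => w _; rewrite -scalerAl (TT_z0 HA) // scaler0.
Qed.

Lemma fibsum_EK pi f : fibsum pi f * EK e K = fibsum pi f.
Proof. by rewrite mulr_suml; apply: eq_bigr => w _; rewrite -scalerAl (TT_EK HA). Qed.

Lemma EK_fibsum pi f : EK e K * fibsum pi f = fibsum pi f.
Proof. by rewrite (EK_central HA) fibsum_EK. Qed.

Lemma fibsum_e pi f k : fibsum pi f * e k.+1 = (k \in K)%:R *: fibsum pi f.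
Proof. by rewrite -{1}fibsum_EK -mulrA (EK_e HA) -scalerAr fibsum_EK. Qed.

Lemma fibsum_desc pi f k : k \in K -> ndec pi -> (f (hi k) < f (lo k))%N ->
  fibsum pi f * z k.+1 = q *: fibsum pi (fun p => f (sref n k p)) + (q - q^-1) *: fibsum pi f.
Proof.
move=> kK nd lt; have a := @fibsum_asc pi (fun p => f (sref n k p)) k nd.
rewrite sref_lo sref_hi in a; have {}a := a lt.
have e1 : fibsum pi f = q *: fibsum pi (fun p => f (sref n k p)) * z k.+1.
  by rewrite -scalerAl a scalerA divrr // scale1r; apply: eq_fibsum => // p; rewrite srefK.
rewrite {1}e1 -mulrA (z_sqr HA) mulrDr -scalerAr -e1; congr (_ + _).
by rewrite -scalerAl fibsum_e kK mulr1n scale1r.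
Qed.

(** The permutations in the sum are paired by w -> w s_k, and if w ascends at [k] and has length l,
    then q^l T_w + q^(l+1) T_(w s_k) is an eigenvector of z_k with eigenvalue q. *)
Lemma fibsum_eq pi f k : k \in K -> f (lo k) = f (hi k) -> fibsum pi f * z k.+1 = q *: fibsum pi f.
Proof.
move=> kK ek; have fs p : f (sref n k p) = f p.
  case: srefP => // ->; by rewrite ek.
rewrite /fibsum (bigID (fun w => asc w k)) /= mulrDl.
have re (F : 'S_n -> A) : \sum_(w : 'S_n | [forall p, f (w p) == pi p] && ~~ asc w k) F w
   = \sum_(w : 'S_n | [forall p, f (w p) == pi p] && asc w k) F (w * sref n k)%g.
  rewrite (reindex_inj (mulIg (sref n k))); apply: eq_bigl => w; rewrite ascM negbK.
  by congr (_ && _); apply: eq_forallb => p; rewrite permM fs.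
rewrite !re !mulr_suml -!big_split /= scaler_sumr; apply: eq_bigr => w /andP[_ a].
rewrite -!scalerAl (TT_asc HA) // (TT_desc HA) // ?ascM ?a // mulKsref winv_asc // !scalerDr !scalerA.
have ce : q ^+ winv w + q ^+ (winv w).+1 * (q - q^-1) = q * q ^+ (winv w).+1.
  have qq := divrr Uq; rewrite !exprS; set y := q ^+ _.
  transitivity (y + q * y * q - q / q * y); first by ring.
  by rewrite qq; ring.
by rewrite [LHS]addrCA -scalerDl ce !exprS.
Qed.

Definition rowsymm pi := fibsum pi pi.
Lemma star_rowsymm pi : star (rowsymm pi) = rowsymm pi. Proof. exact: star_fibsum. Qed.

(* On nondecreasing words, the pointwise order is the reverse of dominance. *)
Definition dom_gen pi (v : A) : Prop := exists a b pi',
  [/\ ndec pi', cpt pi', (forall p, pi' p <= pi p)%N, (exists p, pi' p != pi p) & v = a * rowsymm pi' * b].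
Definition dom_ideal pi := spn (dom_gen pi).

Lemma dom_ideal_mulr pi v b : dom_ideal pi v -> dom_ideal pi (v * b).
Proof.
apply: spn_mulr => {}v [a [b' [pi' [h1 h2 h3 h4 ->]]]]; apply: spn_gen.
by exists a, (b' * b), pi'; split=> //; rewrite !mulrA.
Qed.
Lemma dom_ideal_mull pi v b : dom_ideal pi v -> dom_ideal pi (b * v).
Proof.
apply: spn_mull => {}v [a [b' [pi' [h1 h2 h3 h4 ->]]]]; apply: spn_gen.
by exists (b * a), b', pi'; split=> //; rewrite !mulrA.
Qed.
Lemma dom_ideal_star pi v : dom_ideal pi v -> dom_ideal pi (star v).
Proof.
apply: (spn_lin (star0 HS) (starD HS) (starZ HS)) => {}v [a [b [pi' [h1 h2 h3 h4 ->]]]].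
apply: spn_gen; exists (star b), (star a), pi'; split=> //.
by rewrite !(starM HS) star_rowsymm mulrA.
Qed.

Definition rowinc pi (d : 'S_n) := forall p p', (p < p')%N -> pi p = pi p' -> (d p < d p')%N.

Lemma cpt_desc f k : cpt f -> (f (hi k) <= f (lo k))%N -> k \in K.
Proof. exact: desc_mem_K. Qed.

Lemma cpt_sref f k : k \in K -> cpt f -> cpt (fun p => f (sref n k p)).
Proof. by move=> kK h p; rewrite h; have /SKP := SK_sref kK. Qed.

(** Sorting [f] by adjacent exchanges leads to [pi]; read backwards, each exchange multiplies by a
    z_k and appends s_k to [d]. The rows stay increasing because the two letters exchanged are
    different. The constant [c] is a power of q. *)
Lemma fibsum_rowinc pi f : ndec pi -> cpt pi -> cpt f -> (exists w : 'S_n, forall p, f (w p) = pi p) ->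
  exists d c, [/\ rowinc pi d, d \in SK K, forall p, f (d p) = pi p & fibsum pi f = c *: (rowsymm pi * zw z d)].
Proof.
move=> npi cpi; move em : (inv f) => m; elim: m f em => [|m IH] f em cf [w hw];
 have [nf|[k dk]] := ndecP f.
- have ef := ndec_perm_eq nf npi hw; exists 1%g, 1; split.
  + by move=> p p'; rewrite !perm1.
  + exact: SK1.
  + by move=> p; rewrite perm1 ef.
  + by rewrite (zw1 HA) mulr1 scale1r; apply: eq_fibsum.
- by have := inv_desc dk; rewrite em.
- have ef := ndec_perm_eq nf npi hw; exists 1%g, 1; split.
  + by move=> p p'; rewrite !perm1.
  + exact: SK1.
  + by move=> p; rewrite perm1 ef.
  + by rewrite (zw1 HA) mulr1 scale1r; apply: eq_fibsum.
have := inv_desc dk; rewrite em => -[/esym em'].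
have kK : k \in K by apply: cpt_desc cf (ltnW dk).
have [||d [c [h1 h2 h3 h4]]] := IH _ em'.
- exact: cpt_sref.
- by exists (w * sref n k)%g => p; rewrite permM srefK.
have lt : ((fun p => f (sref n k p)) (lo k) < (fun p => f (sref n k p)) (hi k))%N.
  by rewrite sref_lo sref_hi.
exists (d * sref n k)%g, (q * c); split.
- move=> p p' pp pe; have := h1 _ _ pp pe; rewrite !permM.
  case: srefP => [e1|e1|n1 n2]; case: srefP => [e2|e2|n3 n4] /=; rewrite ?e1 ?e2 /=; try lia.
  by have := lt; rewrite -e1 -e2 !h3 pe ltnn.
- by apply: SKM => //; apply: SK_sref.
- by move=> p; rewrite permM h3.
have ad : asc d k by exact: (fib_asc (f := fun p => f (sref n k p)) npi h3 lt).
rewrite (zw_asc HA) // mulrA -scalerA scalerAl -h4 fibsum_asc // scalerA divrr // scale1r.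
by apply: eq_fibsum => // p; rewrite srefK.
Qed.

Lemma fibsum_in_rowsymm pi f : ndec pi -> cpt pi -> cpt f -> exists b, fibsum pi f = rowsymm pi * b.
Proof.
move=> npi cpi cf; have [->|/eqP/fibsum_neq0 ex] := eqVneq (fibsum pi f) 0; first by exists 0; rewrite mulr0.
by have [d [c [_ _ _ ->]]] := fibsum_rowinc npi cpi cf ex; exists (c *: zw z d); rewrite scalerAr.
Qed.

(** * Raising operators and Garnir relations *)

Section Garnir.
Variables (pi : 'I_n -> 'I_n) (i : 'I_n.-1).
Hypotheses (npi : ndec pi) (cpi : cpt pi) (iK : i \in K).

Definition raise x Y (p : 'I_n) : 'I_n := if p \in Y then hi i else x p.
Definition low x : {set 'I_n} := [set p | x p == lo i].
Definition crs x Y := psum (fun p p' => (x p == hi i) && (p' \in Y)).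
(* The word-level form of a divided power of a raising operator of quantum gl_n. *)
Definition raisesum x P : A := \sum_(Y : {set 'I_n} | Y \subset P) q ^+ (2 * crs x Y) *: fibsum pi (raise x Y).

Lemma hi_neq_lo : (hi i == lo i) = false.
Proof. by apply/eqP => /(congr1 val) /=; lia. Qed.

Lemma lowP x Y p : Y \subset low x -> p \in Y -> x p = lo i.
Proof. by move=> /subsetP h /h; rewrite inE => /eqP. Qed.

Lemma cpt_raise x Y : cpt x -> Y \subset low x -> cpt (raise x Y).
Proof.
move=> cx sY p; rewrite /raise; case: ifP => pY //.
by rewrite -(cx p) (lowP sY pY); move: iK; rewrite mem_K => /eqP.
Qed.

(** This identity dictates the weight q^(2 crs). When raising makes both letters at [k] and [k+1]
    equal to [hi i], z_k acts by q instead of q^-1, while the exchange adds one to [crs]; in all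
    other terms the raised letters still ascend and [crs] is unchanged. *)
Lemma raisesum_asc x k : cpt x -> (x (lo k) < x (hi k))%N ->
  raisesum x (low x) * z k.+1 = q^-1 *: raisesum (fun p => x (sref n k p)) (low (fun p => x (sref n k p))).
Proof.
move=> cx lt; set s := sref n k.
have sK : involutive (fun Y : {set 'I_n} => [set p | s p \in Y]).
  by move=> Y; apply/setP => p; rewrite !inE srefK.
rewrite /raisesum mulr_suml [in RHS](reindex_inj (inv_inj sK)) scaler_sumr.
apply: eq_big => [Y|Y sY].
  apply/subsetP/subsetP => h p; first by rewrite inE => /h; rewrite !inE.
  by move=> pY; have := h (s p); rewrite !inE srefK => /(_ pY).
have rs p : raise (fun p => x (s p)) [set p | s p \in Y] p = raise x Y (s p).
  by rewrite /raise inE.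
have := psum_sref k (fun p p' => (x p == hi i) && (p' \in Y) : nat).
rewrite -/(crs x Y).
set cc := psum _ => hc.
have -> : crs (fun p => x (s p)) [set p | s p \in Y] = cc.
  by apply: psum_eq => p p' _; rewrite inE.
have e1 : (x (lo k) == hi i) && (hi k \in Y) = false.
  apply/negP => /andP[/eqP ex1 /(lowP sY) ex2]; move: lt; rewrite ex1 ex2 /=; lia.
rewrite e1 addn0 in hc; rewrite -!scalerAl.
case: (boolP ((x (hi k) == hi i) && (lo k \in Y))) hc => [/andP[/eqP xh lY]|nb] hc.
  have xl := lowP sY lY.
  have kK : k \in K by rewrite mem_K -(cx (lo k)) -(cx (hi k)) xl xh -mem_K.
  have hY : hi k \notin Y by apply/negP => /(lowP sY); rewrite xh => /eqP; rewrite hi_neq_lo.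
  have er : raise x Y (lo k) = raise x Y (hi k) by rewrite /raise lY (negbTE hY) xh.
  rewrite fibsum_eq // !scalerA hc; congr (_ *: _).
    have -> : (2 * (crs x Y + true) = (2 * crs x Y).+2)%N by rewrite /=; lia.
    by rewrite exprS mulKr // exprSr.
  apply: eq_fibsum => // p; rewrite rs; case: srefP => // ->; by rewrite er.
rewrite addn0 in hc; rewrite hc.
have ltr : (raise x Y (lo k) < raise x Y (hi k))%N.
  rewrite /raise; case: ifP => lY; case: ifP => hY //.
  - by move: lt; rewrite (lowP sY lY) (lowP sY hY) ltnn.
  - move: lt nb; rewrite (lowP sY lY) lY andbT -val_eqE /=; lia.
  - move: lt; rewrite (lowP sY hY) /=; lia.
rewrite fibsum_asc // scalerA mulrC -scalerA; congr (_ *: (_ *: _)).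
by apply: eq_fibsum.
Qed.

Lemma low_sref x k : #|low (fun p => x (sref n k p))| = #|low x|.
Proof.
apply: esym; apply: (@cnt_perm _ _ _ (sref n k)) => p /=; exact.
Qed.

(* The permutations occurring in the sum are closed under right multiplication by the
   row stabilizer of [x], so the sum also splits into elements [star (fibsum x h)]. *)
Lemma raisesum_ndec x : cpt x -> ndec x -> (#|low pi| < #|low x|)%N -> dom_ideal pi (raisesum x (low x)).
Proof.
move=> cx nx lt.
pose D := [pred w : 'S_n | [forall p, (x (w p) == pi p) || (x (w p) == lo i) && (pi p == hi i)]].
pose F (w : 'S_n) := q ^+ winv w *: T w.
have -> : raisesum x (low x) = \sum_(w | D w) F w.
  pose Yof (w : 'S_n) := [set p | (x p == lo i) && (pi ((w^-1)%g p) == hi i)].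
  rewrite (partition_big Yof (fun Y => Y \subset low x)) /=; last first.
    by move=> w _; apply/subsetP => p; rewrite !inE => /andP[].
  apply: eq_bigr => Y sY; have -> : crs x Y = 0%N.
    rewrite /crs /psum big1 // => -[p p'] /= pp; apply/eqP; rewrite eqb0; apply/negP.
    by move=> /andP[/eqP ex1 /(lowP sY) ex2]; have := nx _ _ (ltnW pp); rewrite ex1 ex2 /=; lia.
  rewrite expr0 scale1r; apply: eq_bigl => w; apply/forallP/andP => [h|[/forallP h /eqP <-] p].
    split; last first.
      apply/eqP/setP => p; rewrite !inE; have := h ((w^-1)%g p); rewrite permKV /raise.
      case: ifP => [pY /eqP <-|pY /eqP <-]; first by rewrite (lowP sY pY) !eqxx.
      by case: eqP => // ->; rewrite eq_sym hi_neq_lo.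
    apply/forallP => p; have := h p; rewrite /raise; case: ifP => [wY /eqP <-|_ ->//].
    by rewrite (lowP sY wY) !eqxx orbT.
  rewrite /raise inE permK; have := h p.
  case: (eqVneq (x (w p)) (lo i)) => [->|n1] /=; last by rewrite orbF.
  by case: (eqVneq (pi p) (hi i)) => [->|n2] //; rewrite orbF.
have [w0|[w wD]] : (forall w, D w = false) \/ exists w, D w.
  case: (boolP [exists w, D w]) => [/existsP|]; first by right.
  by rewrite negb_exists => /forallP h; left => w; apply/negbTE.
  by rewrite big_pred0 //; apply: spn0.
have xpi : forall p, (x p <= pi p)%N.
  apply: (@ndec_le_perm _ x pi w) => // p; have /forallP/(_ p) := wD.
  by case/orP => [/eqP->//|/andP[/eqP-> /eqP->]] /=; lia.
have xnpi : exists p, x p != pi p.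
  apply/existsP; rewrite -[X in is_true X]negbK negb_exists; apply/negP => /forallP h.
  move: lt; rewrite (_ : low x = low pi) ?ltnn //.
  by apply/setP => p; rewrite !inE; have := h p; rewrite negbK => /eqP->.
pose xof (w : 'S_n) : {ffun 'I_n -> 'I_n} := [ffun p => x (w p)].
pose Dh (h : {ffun 'I_n -> 'I_n}) := [forall p, (h p == pi p) || (h p == lo i) && (pi p == hi i)].
rewrite (partition_big xof Dh) /=; last first.
  by move=> u /forallP h; apply/forallP => p; rewrite ffunE.
apply: spn_sum => h hD.
have -> : \sum_(u | D u && (xof u == h)) F u = star (fibsum x h).
  rewrite star_fibsum; apply: eq_bigl => u; apply/andP/forallP => [[_ /eqP <-] p|hu].
    by rewrite ffunE.
  have e1 : xof u = h by apply/ffunP => p; rewrite ffunE; apply/eqP.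
  split; last by rewrite e1.
  by apply/forallP => p; have /forallP/(_ p) := hD; rewrite -e1 ffunE.
have ch : cpt h.
  move=> p; have /forallP/(_ p) := hD; case/orP => [/eqP->//|/andP[/eqP-> /eqP e']].
  by rewrite -(cpi p) e'; apply/eqP; rewrite -mem_K.
have [b ->] := fibsum_in_rowsymm nx cx ch.
rewrite (starM HS) star_rowsymm; apply: spn_gen; exists (star b), 1, x; split=> //.
by rewrite mulr1.
Qed.

(** The ideal is stable under z_k and q is a unit, so [raisesum_asc] carries the nondecreasing case
    to the other arrangements of the letters. *)
Lemma raisesum_low x : cpt x -> (#|low pi| < #|low x|)%N -> dom_ideal pi (raisesum x (low x)).
Proof.
move em : (inv x) => m; elim: m x em => [|m IH] x em cx lt; have [nx|[k dk]] := ndecP x.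
- exact: raisesum_ndec.
- by have := inv_desc dk; rewrite em.
- exact: raisesum_ndec.
have := inv_desc dk; rewrite em => -[/esym em'].
have kK : k \in K by apply: cpt_desc cx (ltnW dk).
have := IH _ em' (cpt_sref kK cx); rewrite low_sref => /(_ lt) /(dom_ideal_mulr (z k.+1)).
rewrite raisesum_asc; last by rewrite sref_lo sref_hi.
  move/spn_unit; rewrite unitrV => /(_ Uq).
  have ess p : x (sref n k (sref n k p)) = x p by rewrite srefK.
  suff -> : raisesum (fun p => x (sref n k (sref n k p))) (low (fun p => x (sref n k (sref n k p)))) = raisesum x (low x) by [].
  have -> : low (fun p => x (sref n k (sref n k p))) = low x by apply/setP => p; rewrite !inE ess.
  apply: eq_bigr => Y _; congr (_ *: _); last by apply: eq_fibsum => // p; rewrite /raise ess.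
  by congr (_ ^+ (_ * _)); apply: psum_eq => p p' _; rewrite ess.
exact: cpt_sref.
Qed.

(** The raised word must have the content of [pi], so all terms that survive raise the same number
    of letters. *)
Lemma card_raise x Y : Y \subset low x -> fibsum pi (raise x Y) <> 0 -> (#|Y| + #|low pi| = #|low x|)%N.
Proof.
move=> sY /fibsum_neq0[w /cnt_perm h]; have := h (lo i); rewrite /cnt -/(low pi) => <-.
rewrite -(cardsID Y (low x)) (setIidPr sY); congr (_ + _)%N.
apply: eq_card => p; rewrite !inE /raise; case: ifP => //=.
by rewrite hi_neq_lo.
Qed.

(* Garnir relation, by induction on the letters of [x] that are not allowed to rise:
   releasing one of them, [b], adds the sum in which [b] has already been raised. *)
Lemma raisesum_dom x P : cpt x -> P \subset low x ->
  (forall b p, b \in low x :\: P -> p \in P -> (b < p)%N) ->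
  (#|low pi| < #|P|)%N -> dom_ideal pi (raisesum x P).
Proof.
move em : #|low x :\: P| => m; elim: m x P em => [|m IH] x P em cx sP bP lt.
  have <- : low x = P.
    by apply/eqP; rewrite eqEsubset sP andbT -setD_eq0 -cards_eq0 em.
  by apply: raisesum_low => //; apply: leq_trans lt (subset_leq_card sP).
have [b0 b0B] : exists b, b \in low x :\: P by apply/card_gt0P; rewrite em.
(* The last of the letters held back is released, so that the others still precede [b |: P]. *)
have [b bB0 bmax] := arg_maxnP (P := fun b => b \in low x :\: P) val b0B.
have bB : b \in low x :\: P := bB0.
have [bx bnP] : x b = lo i /\ b \notin P by move: (bB); rewrite !inE => /andP[-> /eqP].
have blow : b \in low x by rewrite inE bx.
have sbP : b |: P \subset low x by rewrite subUset sub1set blow.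
have h1 : dom_ideal pi (raisesum x (b |: P)).
  have e1 : low x :\: (b |: P) = (low x :\: P) :\ b.
    by apply/setP => p; rewrite !inE negb_or andbA.
  apply: IH => //; last by rewrite cardsU1 bnP; lia.
    by apply/eqP; rewrite e1 -eqSS -em [in X in _ == X](cardsD1 b) bB.
  move=> c p; rewrite e1 !inE => /andP[nc hc] /orP[/eqP->|pP].
    rewrite ltn_neqAle val_eqE nc /=; apply: bmax; by rewrite !inE.
  by apply: bP => //; rewrite !inE.
pose xb := raise x [set b].
have lxb : low xb = low x :\ b.
  apply/setP => p; rewrite !inE /xb /raise inE; case: (eqVneq p b) => //= _.
  by rewrite hi_neq_lo.
have h2 : dom_ideal pi (raisesum xb P).
  have e1 : low xb :\: P = (low x :\: P) :\ b by rewrite lxb !setDDl setUC.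
  apply: IH => //.
  - by apply/eqP; rewrite e1 -eqSS -em [in X in _ == X](cardsD1 b) bB.
  - by apply: cpt_raise => //; rewrite sub1set.
  - apply/subsetP => p pP; rewrite lxb !inE (lowP sP pP) eqxx andbT.
    by apply: contraNneq bnP => <-.
  - by move=> c p; rewrite e1 => /setD1P[_ hc]; apply: bP.
have split_b : raisesum x (b |: P) = raisesum x P + \sum_(Y : {set 'I_n} | Y \subset P)
    q ^+ (2 * crs x (b |: Y)) *: fibsum pi (raise x (b |: Y)).
  rewrite /raisesum (bigID (fun Y : {set 'I_n} => b \in Y)) /= addrC; congr (_ + _).
    apply: eq_bigl => Y; apply/andP/idP => [[/subsetP h nb]|h].
      apply/subsetP => p pY; have := h p pY; rewrite !inE => /orP[/eqP e'|//].
      by rewrite -e' pY in nb.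
    by split; [apply: subset_trans h (subsetUr _ _)|apply: contra bnP => /(subsetP h)].
  rewrite (reindex_onto (fun Y => b |: Y) (fun Y => Y :\ b)) /=; last first.
    by move=> Y /andP[_ bY]; rewrite setD1K.
  apply: eq_bigl => Y; rewrite setU11 andbT; apply/andP/idP => [[h /eqP e']|h].
    rewrite -e'; apply/subsetP => p; rewrite !inE => /andP[np].
    by rewrite (negbTE np) /= => pY; have := subsetP h p; rewrite !inE pY (negbTE np) orbT => /(_ isT).
  split; first exact: setUS.
  by rewrite setU1K //; apply: contra bnP => /(subsetP h).
(* By [card_raise] the nonzero terms raise exactly [c0] letters besides [b]. All of these come after
   [b], so turning [b] into [hi i] beforehand adds the constant [c0] to [crs], and a power of q
   leaves the sum. *)
pose c0 := (#|low x| - #|low pi|).-1.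
have key : \sum_(Y : {set 'I_n} | Y \subset P) q ^+ (2 * crs x (b |: Y)) *: fibsum pi (raise x (b |: Y))
   = (q ^+ (2 * crs x [set b]) * q ^- (2 * c0)) *: raisesum xb P.
  rewrite scaler_sumr; apply: eq_bigr => Y sY.
  have er : raise x (b |: Y) =1 raise xb Y.
    by move=> p; rewrite /xb /raise !inE; case: (p == b); rewrite ?if_same.
  rewrite (eq_fibsum (fun p => erefl (pi p)) er).
  have [->|/eqP n0] := eqVneq (fibsum pi (raise xb Y)) 0; first by rewrite !scaler0.
  have bnY : b \notin Y by apply: contra bnP => /(subsetP sY).
  have sbY : b |: Y \subset low x by apply: subset_trans sbP; apply: setUS.
  have cY : #|Y| = c0.
    have := @card_raise x (b |: Y) sbY; rewrite (eq_fibsum (fun p => erefl (pi p)) er) => /(_ n0).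
    by rewrite cardsU1 bnY /c0; lia.
  have e1 : crs x (b |: Y) = (crs x [set b] + crs x Y)%N.
    rewrite /crs psumD; apply: psum_eq => p p' _; rewrite !inE.
    case: (eqVneq p' b) => [->|_]; rewrite ?(negbTE bnY) ?andbF ?andbT ?addn0 //.
  have e2 : crs xb Y = (crs x Y + c0)%N.
    have -> : c0 = psum (fun p p' => (p == b) && (p' \in Y)).
      rewrite (psum_card (fun p p' => (p == b) && (p' \in Y))) -cY.
      have ij : injective (fun p' : 'I_n => (b, p')) by move=> ? ? [].
      rewrite -(card_imset _ ij); apply: eq_card => -[p p']; rewrite inE /=.
      apply/imsetP/andP => [[p1 p1Y [-> ->]]|[_ /andP[/eqP-> pY]]]; last by exists p'.
      by rewrite eqxx p1Y (bP _ _ bB (subsetP sY _ p1Y)).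
    rewrite /crs psumD; apply: psum_eq => p p' _; rewrite /xb /raise inE.
    by case: (eqVneq p b) => [->|_]; rewrite ?bx ?eqxx ?addn0 //= eq_sym hi_neq_lo.
  rewrite scalerA e1 e2; congr (_ *: _).
  by rewrite (mulnDr 2 (crs x [set b])) (mulnDr 2 (crs x Y)) !(exprD _ (2 * _)) -mulrA [q ^+ (2 * crs x Y) * _]mulrC mulKr // unitrX.
have -> : raisesum x P = raisesum x (b |: P) - (q ^+ (2 * crs x [set b]) * q ^- (2 * c0)) *: raisesum xb P.
  by rewrite split_b key addrK.
by apply: spnB => //; apply: spnZ.
Qed.

Definition straight_gen (Q : ('I_n -> 'I_n) -> Prop) (v : A) : Prop :=
  (exists2 g, cpt g /\ Q g & v = fibsum pi g) \/ dom_gen pi v.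

Lemma straight_ideal Q v : dom_ideal pi v -> spn (straight_gen Q) v.
Proof. by apply: spn_sub => {}v; right. Qed.

Definition pcnt f (t : nat) (v : 'I_n) := #|[set p : 'I_n | (p < t)%N && (f p == v)]|.

(** The letters [lo i] and [hi i] are consecutive, so raising affects only pairs formed by these
    two: inversions with an earlier [hi i] disappear, and inversions with a later unraised [lo i]
    arise. *)
Lemma inv_raise x Y : Y \subset low x ->
  (inv (raise x Y) + crs x Y = inv x + psum (fun p p' => (p \in Y) && (p' \in low x :\: Y)))%N.
Proof.
move=> sY; rewrite /inv /crs !psumD; apply: psum_eq => p p' _; rewrite /raise !inE.
case: (boolP (p \in Y)) => pY; case: (boolP (p' \in Y)) => pY' /=.
- by rewrite (lowP sY pY) (lowP sY pY') -!val_eqE /=; lia.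
- by rewrite (lowP sY pY) -!val_eqE /=; lia.
- by rewrite (lowP sY pY') -!val_eqE /=; lia.
- by rewrite andbF !addn0.
Qed.

(** Multiplication by z_k exchanges at most one pair of adjacent letters, hence creates at most one
    inversion. *)
Lemma straight_mulz m k v : spn (straight_gen (fun g => inv g < m)%N) v ->
  spn (straight_gen (fun g => inv g < m.+1)%N) (v * z k.+1).
Proof.
apply: spn_mulr => {}v [[g [cg lt] ->]|dg]; last first.
  by apply: straight_ideal; apply: dom_ideal_mulr; apply: spn_gen.
case: (boolP (k \in K)) => kK; last by rewrite fibsum_z0 //; apply: spn0.
have gs : spn (straight_gen (fun g => inv g < m.+1)%N) (fibsum pi (fun p => g (sref n k p))).
  apply: spn_gen; left; exists (fun p => g (sref n k p)) => //; split; first exact: cpt_sref.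
  by apply: leq_ltn_trans (leq_inv_sref k g) _; rewrite ltnS.
have g0 : spn (straight_gen (fun g => inv g < m.+1)%N) (fibsum pi g).
  by apply: spn_gen; left; exists g => //; split=> //; apply: leqW.
case: (ltngtP (g (lo k)) (g (hi k))) => [h|h|/val_inj h].
- by rewrite fibsum_asc //; apply: spnZ.
- by rewrite fibsum_desc //; apply: spnD; apply: spnZ.
- by rewrite fibsum_eq //; apply: spnZ.
Qed.

Lemma pcnt_sref f t k v : (k.+1 < t)%N -> pcnt (fun p => f (sref n k p)) t v = pcnt f t v.
Proof.
move=> kt; rewrite /pcnt -[LHS](card_imset _ (@perm_inj _ (sref n k))); apply: eq_card => p.
rewrite inE; apply/imsetP/andP => [[p' + ->]|[pt fp]].
  by rewrite inE => /andP[pt ->]; split=> //; case: srefP pt => [->|->|//] /=; lia.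
exists (sref n k p); rewrite ?srefK // inE srefK fp andbT.
by case: srefP pt => [->|->|//] /=; lia.
Qed.

(** Lower the letters [hi i] of the prefix (the set [Z]) to get [x], and let them rise again
    together with the letters [lo i] behind the prefix (the set [W]). The letters [lo i] of the
    prefix precede all of these, the prefix being sorted, and the violation makes [Z :|: W] larger
    than the row of [lo i] in [pi]: [raisesum_dom] applies. Its term for [Z] is [f]; the other
    nonzero terms raise as many letters, some of them further right, and have fewer inversions. *)
Lemma straight_sorted_prefix f t : cpt f -> (pcnt f t (lo i) < pcnt f t (hi i))%N ->
  (forall k, (k.+1 < t)%N -> (f (lo k) <= f (hi k))%N) ->
  spn (straight_gen (fun g => inv g < inv f)%N) (fibsum pi f).
Proof.
move=> cf V nd.
have nf (p p' : 'I_n) : (p <= p')%N -> (p' < t)%N -> (f p <= f p')%N.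
  rewrite leq_eqVlt => /orP[/eqP/val_inj-> //|pp pt].
  apply: (@adj_homo _ leq (fun p => f p) t leq_trans) pp pt => k kt.
  exact: nd.
have [->|/eqP n0] := eqVneq (fibsum pi f) 0; first exact: spn0.
pose Z := [set p : 'I_n | (p < t)%N && (f p == hi i)].
pose W := [set p : 'I_n | (t <= p)%N && (f p == lo i)].
pose x p := if p \in Z then lo i else f p.
pose P := Z :|: W.
have xlow : low x = low f :|: Z.
  by apply/setP => p; rewrite inE [RHS]inE /x [p \in low f]inE; case: (p \in Z); rewrite ?eqxx ?orbT ?orbF.
have sZ : Z \subset low x by rewrite xlow subsetUr.
have sP : P \subset low x.
  rewrite subUset sZ xlow; apply/subsetP => p; rewrite !inE => /andP[_ ->]; by rewrite ?orbT.
have rx : raise x Z =1 f.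
  move=> p; rewrite /raise /x; case: (boolP (p \in Z)) => // ; by rewrite inE => /andP[_ /eqP->].
have cx : cpt x.
  move=> p; rewrite /x; case: ifP => //; rewrite inE => /andP[_ /eqP fp].
  by rewrite -(cf p) fp; move: iK; rewrite mem_K => /eqP.
have BP b : b \in low x :\: P -> (b < t)%N && (f b == lo i).
  rewrite xlow !inE negb_or => /andP[/andP[nz nw] /orP[fb|zb]]; last by rewrite zb in nz.
  by rewrite fb andbT ltnNge; rewrite fb andbT in nw.
have bP b p : b \in low x :\: P -> p \in P -> (b < p)%N.
  move=> /BP/andP[bt /eqP fb]; rewrite !inE => /orP[/andP[pt /eqP fp]|/andP[tp _]]; last exact: leq_trans bt tp.
  rewrite ltnNge; apply/negP => pb; have := nf _ _ pb bt; rewrite fp fb /=; lia.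
have ltP : (#|low pi| < #|P|)%N.
  have [w /cnt_perm hw] := fibsum_neq0 n0.
  have := hw (lo i); rewrite /cnt -/(low pi) -/(low f) => <-.
  have -> : low f = [set p : 'I_n | (p < t)%N && (f p == lo i)] :|: W.
    by apply/setP => p; rewrite !inE -andb_orl ltnNge orNb.
  rewrite !cardsU.
  have -> : Z :&: W = set0.
    apply/setP => p; rewrite !inE; case: (_ == hi i) / eqP => [->|]; rewrite ?hi_neq_lo ?andbF //.
  have -> : [set p : 'I_n | (p < t)%N && (f p == lo i)] :&: W = set0.
    by apply/setP => p; rewrite !inE ltnNge; case: (t <= p)%N; rewrite ?andbF.
  rewrite cards0 !subn0 ltn_add2r; exact: V.
have G := raisesum_dom cx sP bP ltP.
have crs0 : crs x Z = 0%N.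
  rewrite /crs /psum big1 // => -[p p'] /= pp; apply/eqP; rewrite eqb0; apply/negP.
  rewrite /x !inE => /andP[+ /andP[pt fp']]; case: ifP.
    by move=> _ /eqP/(congr1 val) /=; lia.
  by move=> /negP h /eqP fp; apply: h; rewrite fp eqxx andbT (ltn_trans pp pt).
have invf : inv f = inv (raise x Z) by apply: eq_inv => p; rewrite rx.
rewrite /raisesum (bigD1 Z) ?subsetUl //= in G.
rewrite (eq_fibsum (fun p => erefl (pi p)) rx) in G.
have H : spn (straight_gen (fun g => inv g < inv f)%N)
   (\sum_(Y : {set 'I_n} | (Y \subset P) && (Y != Z)) q ^+ (2 * crs x Y) *: fibsum pi (raise x Y)).
  apply: spn_sum => Y /andP[sYP nYZ]; apply: spnZ.
  have [->|/eqP n0'] := eqVneq (fibsum pi (raise x Y)) 0; first exact: spn0.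
  have sY : Y \subset low x by apply: subset_trans sP.
  have cYZ : #|Y| = #|Z|.
    have n0Z : fibsum pi (raise x Z) <> 0.
      by rewrite (eq_fibsum (fun p => erefl (pi p)) rx).
    by apply: (@addIn #|low pi|); rewrite (card_raise sY n0') (card_raise sZ n0Z).
  apply: spn_gen; left; exists (raise x Y) => //; split; first exact: cpt_raise.
  rewrite invf; have := inv_raise sZ; rewrite crs0 addn0 => ->.
  rewrite -(leq_add2r (crs x Y)) addSn inv_raise // -addnS.
  apply: leq_trans (leq_addr _ _); rewrite leq_add2l.
  rewrite (psum_card (fun p p' => (p \in Y) && (p' \in low x :\: Y))).
  rewrite (psum_card (fun p p' => (p \in Z) && (p' \in low x :\: Z))).
  (* Letters outside [P] precede [P] and give no pair, so only [Y] times [P :\: Y] matters. It has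
     as many elements as [Z] times [P :\: Z], all of whose pairs are in increasing order, whereas
     [Y] contains some [y] of [W] and misses some [u] of [Z]. *)
  apply: (@leq_trans #|setX Y (P :\: Y)|); last first.
    have -> : #|setX Y (P :\: Y)| = #|setX Z (P :\: Z)|.
      by rewrite !cardsX !cardsD (setIidPr sYP) (setIidPr (subsetUl Z W)) cYZ.
    apply: subset_leq_card; apply/subsetP => -[p p']; rewrite in_setX inE /=.
    move=> /andP[pZ p'D]; rewrite pZ; move: (p'D); rewrite !inE => /andP[np' /orP[h|/andP[tp' fp']]].
      by rewrite h in np'.
    move: pZ; rewrite inE => /andP[pt _]; rewrite (leq_trans pt tp') /= np' /=.
    by have := subsetP sP p'; rewrite !inE tp' fp' orbT => /(_ isT).
  apply: proper_card; apply/properP; split.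
    apply/subsetP => -[p p']; rewrite in_setX inE /= => /and3P[pp pY]; rewrite pY /= !(in_setD, pY).
    move=> /andP[-> lp'] /=; apply: contraTT pp => npP; rewrite -leqNgt ltnW //.
    by apply: bP; rewrite ?(subsetP sYP) // inE npP.
  have [u uZ uY] : exists2 u, u \in Z & u \notin Y.
    apply/subsetPn; apply: contra nYZ => sZY; rewrite eq_sym eqEcard sZY cYZ; exact: leqnn.
  have [y yY yZ] : exists2 y, y \in Y & y \notin Z.
    apply/subsetPn; apply: contra nYZ => sZY; rewrite eqEcard sZY cYZ; exact: leqnn.
  have yW : y \in W by have := subsetP sYP y yY; rewrite in_setU (negbTE yZ).
  exists (y, u); first by rewrite in_setX yY in_setD uY in_setU uZ.
  rewrite inE /= negb_and -leqNgt ltnW //; move: uZ yW; rewrite !inE => /andP[ut _] /andP[ty _].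
  exact: leq_trans ut ty.
move/(straight_ideal (fun g => inv g < inv f)%N): G => /spnB/(_ H); rewrite addrK.
apply: spn_unit; exact: unitrX.
Qed.

(** A descent inside the prefix is removed by an exchange that leaves the counts of the prefix
    unchanged. Multiplying back by z_k may add one inversion, which is the one that [f] has more
    than the exchanged word. *)
Lemma straight_nonlattice f t : cpt f -> (pcnt f t (lo i) < pcnt f t (hi i))%N ->
  spn (straight_gen (fun g => inv g < inv f)%N) (fibsum pi f).
Proof.
move em : (inv f) => m; elim: m f em => [|m IH] f em cf V.
  rewrite -em; apply: straight_sorted_prefix V _ => // k _; rewrite leqNgt; apply/negP => /inv_desc.
  by rewrite em.
have [/existsP[k /andP[kt dk]]|] := boolP [exists k : 'I_n.-1, (k.+1 < t)%N && (f (hi k) < f (lo k))%N].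
  have := inv_desc dk; rewrite em => -[/esym em'].
  have kK : k \in K by apply: cpt_desc cf (ltnW dk).
  have lt : ((fun p => f (sref n k p)) (lo k) < (fun p => f (sref n k p)) (hi k))%N.
    by rewrite sref_lo sref_hi.
  have := IH _ em' (cpt_sref kK cf); rewrite !pcnt_sref // => /(_ V)/(straight_mulz k).
  rewrite fibsum_asc // (@eq_fibsum pi pi _ f) //; last by move=> p; rewrite srefK.
  by apply: spn_unit; rewrite unitrV.
rewrite negb_exists => /forallP nd; rewrite -em; apply: straight_sorted_prefix V _ => // k kt.
by have := nd k; rewrite kt /= -leqNgt.
Qed.

End Garnir.

Definition lattice f := forall (i : 'I_n.-1) (t : nat), i \in K -> (pcnt f t (hi i) <= pcnt f t (lo i))%N.

Lemma straighten pi f : ndec pi -> cpt pi -> cpt f -> spn (straight_gen pi lattice) (fibsum pi f).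
Proof.
move=> npi cpi; have [m] := ubnP (inv f); elim: m f => // m IH f lt cf.
have [lf|nlf] := pselect (lattice f); first by apply: spn_gen; left; exists f.
have [i [t [iK V]]] : exists i t, i \in K /\ (pcnt f t (lo i) < pcnt f t (hi i))%N.
  apply: contrapT => h; apply: nlf => i t iK; rewrite leqNgt; apply/negP => V.
  by apply: h; exists i, t.
apply: spn_bind (straight_nonlattice npi cpi iK cf V) => v [[g [cg ltg] ->]|dg].
  by apply: IH => //; apply: leq_trans ltg _; rewrite -ltnS.
by apply: spn_gen; right.
Qed.

(** Membership of [T(la)] read on the permutation: rows increase, the initial kind is membership in
    the Young subgroup, and the lattice property replaces the column condition ([stdp_inT]). *)
Definition stdp pi (d : 'S_n) :=
  [/\ rowinc pi d, d \in SK K & lattice (fun p => pi ((d^-1)%g p))].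

Lemma rowsymm_mul_span pi a : ndec pi -> cpt pi ->
  spn (fun v => (exists2 d, stdp pi d & v = rowsymm pi * zw z d) \/ dom_gen pi v) (rowsymm pi * a).
Proof.
move=> npi cpi.
pose G v := exists2 f, cpt f & v = fibsum pi f.
have H : spn G (rowsymm pi * a).
  have : spn G (rowsymm pi) by apply: spn_gen; exists pi.
  move: (rowsymm pi); elim/(bH_ind' HA): a => [|a b ha hb|c a ha|a b ha hb|k|k] v hv.
  - by rewrite mulr1.
  - by rewrite mulrDr; apply: spnD; auto.
  - by rewrite -scalerAr; apply: spnZ; auto.
  - by rewrite mulrA; auto.
  - apply: spn_mulr hv => {}v [f cf ->]; rewrite fibsum_e; apply/spnZ/spn_gen; by exists f.
  apply: spn_mulr hv => {}v [f cf ->].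
  case: (boolP (k \in K)) => kK; last by rewrite fibsum_z0 //; apply: spn0.
  have g0 : spn G (fibsum pi f) by apply: spn_gen; exists f.
  have g1 : spn G (fibsum pi (fun p => f (sref n k p))).
    by apply: spn_gen; exists (fun p => f (sref n k p)) => //; apply: cpt_sref.
  case: (ltngtP (f (lo k)) (f (hi k))) => [h|h|/val_inj h].
  - by rewrite fibsum_asc //; apply: spnZ.
  - by rewrite fibsum_desc //; apply: spnD; apply: spnZ.
  - by rewrite fibsum_eq //; apply: spnZ.
apply: spn_bind H => v [f cf ->]; apply: spn_bind (straighten npi cpi cf) => {}v [[g [cg lg] ->]|dg].
  have [->|/eqP/fibsum_neq0 ex] := eqVneq (fibsum pi g) 0; first exact: spn0.
  have [d [c [h1 h2 h3 ->]]] := fibsum_rowinc npi cpi cg ex.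
  apply/spnZ/spn_gen; left; exists d => //; split=> // i t iK.
  have e1 v' : pcnt (fun p => pi ((d^-1)%g p)) t v' = pcnt g t v'.
    by apply: eq_card => p; rewrite !inE -h3 permKV.
  by rewrite !e1; apply: lg.
by apply: spn_gen; right.
Qed.

Lemma mul_rowsymm_span pi a : ndec pi -> cpt pi ->
  spn (fun v => (exists2 d, stdp pi d & v = star (zw z d) * rowsymm pi) \/ dom_gen pi v) (a * rowsymm pi).
Proof.
move=> npi cpi; have := rowsymm_mul_span (star a) npi cpi.
move/(@spn_lin _ _ _ (fun v => (exists2 d, stdp pi d & v = star (zw z d) * rowsymm pi) \/ dom_gen pi v) star (star0 HS) (starD HS) (starZ HS)).
rewrite (starM HS) star_rowsymm (starK HA HS); apply => v [[d hd ->]|dg].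
  by apply: spn_gen; left; exists d => //; rewrite (starM HS) star_rowsymm.
have : dom_ideal pi v by apply: spn_gen.
by move/dom_ideal_star; apply: spn_sub => u; right.
Qed.

Definition bas_elt pi (d d' : 'S_n) := star (zw z d) * rowsymm pi * zw z d'.

Definition bas_gen pi (v : A) : Prop := exists pi' (d d' : 'S_n),
  [/\ ndec pi', cpt pi', (forall p, pi' p <= pi p)%N & [/\ stdp pi' d, stdp pi' d' & v = bas_elt pi' d d']].

Definition bas_gen_lt pi (v : A) : Prop := exists pi' (d d' : 'S_n),
  [/\ ndec pi', cpt pi', (forall p, pi' p <= pi p)%N, (exists p, pi' p != pi p) &
      [/\ stdp pi' d, stdp pi' d' & v = bas_elt pi' d d']].

Lemma bas_span pi a b : ndec pi -> cpt pi -> spn (bas_gen pi) (a * rowsymm pi * b).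
Proof.
(* The words of the dominance ideal lie pointwise below [pi] and differ from it, so the sum of the
   letters decreases. *)
have [m] := ubnP (\sum_p pi p)%N; elim: m pi a b => // m IH pi a b lt npi cpi.
have idl v : dom_ideal pi v -> spn (bas_gen pi) v.
  apply: spn_bind => {}v [a' [b' [pi' [h1 h2 h3 [p0 hp0] ->]]]].
  have : spn (bas_gen pi') (a' * rowsymm pi' * b').
    apply: IH => //; rewrite ltnS in lt; apply: leq_trans lt.
    rewrite (bigD1 p0) //= [in X in (_ < X)%N](bigD1 p0) //= -addSn; apply: leq_add.
      by rewrite ltn_neqAle h3 andbT val_eqE.
    by apply: leq_sum => p _; apply: h3.
  apply: spn_sub => u [pi2 [d [d' [k1 k2 k3 k4]]]]; exists pi2, d, d'; split=> // p.
  exact: leq_trans (k3 p) (h3 p).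
rewrite -mulrA; apply: spn_mull (rowsymm_mul_span b npi cpi) => v [[d' sd' ->]|dg]; last first.
  by apply: idl; apply: dom_ideal_mull; apply: spn_gen.
rewrite mulrA; apply: spn_mulr (mul_rowsymm_span a npi cpi) => {}v [[d sd ->]|dg]; last first.
  by apply: idl; apply: dom_ideal_mulr; apply: spn_gen.
by apply: spn_gen; exists pi, d, d'; split.
Qed.

Lemma dom_ideal_span pi v : dom_ideal pi v -> spn (bas_gen_lt pi) v.
Proof.
apply: spn_bind => {}v [a' [b' [pi' [h1 h2 h3 [p0 hp0] ->]]]].
apply: spn_sub (bas_span a' b' h1 h2) => u [pi2 [d [d' [k1 k2 k3 k4]]]].
exists pi2, d, d'; split=> //; first by move=> p; apply: leq_trans (k3 p) (h3 p).
exists p0; rewrite -val_eqE ltn_eqF //; apply: leq_ltn_trans (k3 p0) _.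
by rewrite ltn_neqAle h3 andbT val_eqE.
Qed.

(** The combination [v] comes from the left factor alone and is fixed before [d']: this is the
    independence of the coefficients from the second tableau that cellularity demands. *)
Lemma cell_span pi a d : ndec pi -> cpt pi -> 
  exists2 v, spn (fun v => exists2 d', stdp pi d' & v = star (zw z d') * rowsymm pi) v &
    forall d', spn (bas_gen_lt pi) (a * bas_elt pi d d' - v * zw z d').
Proof.
move=> npi cpi.
have : exists2 v, spn (fun v => exists2 d', stdp pi d' & v = star (zw z d') * rowsymm pi) v &
   dom_ideal pi (a * star (zw z d) * rowsymm pi - v).
  elim: (mul_rowsymm_span (a * star (zw z d)) npi cpi) => [|c x y hx _ [v sv dv]].
    by exists 0; [apply: spn0|rewrite subr0; apply: spn0].
  case: hx => [hx|hx].
    exists (c *: x + v); first exact: spn_cons.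
    by rewrite opprD addrACA subrr add0r.
  exists v => //; rewrite -addrA; exact: spn_cons.
case=> v sv dv; exists v => // d'; apply: dom_ideal_span.
by rewrite /bas_elt !mulrA -mulrBl; apply: dom_ideal_mulr.
Qed.

End Core.

(** * Counting pairs of lattice words *)

Section Count.
Variables (n : nat) (K : {set 'I_n.-1}).
Implicit Types (i j : 'I_n) (t : nat) (s : seq 'I_n).
Notation content := {ffun 'I_n -> nat}.
Implicit Types (c : content).
Local Open Scope nat_scope.
Notation bst := (bst K).

Definition inB t i := bst i == bst t.
Definition succ j i := (j.+1 == i) && (bst j == bst i).
(** Contents are read as row lengths, so that [part], [addable] and [remov] are the notions of
    Young's lattice, taken block by block. *)
Definition part c := [forall j, forall i, succ j i ==> (c i <= c j)].
Definition addable c i := [forall j, succ j i ==> (c i < c j)].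
Definition remov c j := (0 < c j) && [forall i, succ j i ==> (c i < c j)].
Definition inc c i : content := [ffun v => c v + (v == i)].
Definition dec c i : content := [ffun v => c v - (v == i)].
Definition cont s : content := [ffun v => count_mem v s].

Lemma partP c : reflect (forall j i, succ j i -> c i <= c j) (part c).
Proof. by apply: (iffP forallP) => [h j i|h j]; [have /forallP/(_ i)/implyP := h j|apply/forallP => i; apply/implyP/h]. Qed.

Lemma addableP c i : reflect (forall j, succ j i -> c i < c j) (addable c i).
Proof. by apply: (iffP forallP) => h j; apply/implyP/h. Qed.

Lemma removP c j : reflect (0 < c j /\ forall i, succ j i -> c i < c j) (remov c j).
Proof.
by apply: (iffP andP) => -[c0 h]; split=> //; [move=> i; apply/implyP; move: i; apply/forallP|apply/forallP => i; apply/implyP/h].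
Qed.

Lemma cont_rcons s i : cont (rcons s i) = inc (cont s) i.
Proof. by apply/ffunP => v; rewrite !ffunE -cats1 count_cat /= addn0 eq_sym. Qed.

(** Each letter names the row that receives the next box: these words are the growing walks in
    Young's lattice, run through one block after the other. *)
Fixpoint latwords t : seq (seq 'I_n) :=
  if t is t'.+1 then
    [seq rcons s i | s <- latwords t', i <- enum [pred i | inB t' i && addable (cont s) i]]
  else [:: [::]].

Lemma sum_latwordsS t (G : seq 'I_n -> nat) :
  \sum_(s <- latwords t.+1) G s = \sum_(s <- latwords t) \sum_(i | inB t i && addable (cont s) i) G (rcons s i).
Proof. by rewrite /= big_allpairs_dep; apply: eq_bigr => s _; rewrite big_enum. Qed.

Lemma mem_latwordsS t s i : rcons s i \in latwords t.+1 <-> [/\ s \in latwords t, inB t i & addable (cont s) i].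
Proof.
split=> [/allpairsPdep[s' [i' [hs' + /rcons_inj[-> ->]]]]|[hs h1 h2]].
  by rewrite mem_enum inE => /andP[].
by apply/allpairsPdep; exists s, i; split=> //; rewrite mem_enum inE h1.
Qed.

Lemma latwords_ind (P : nat -> seq 'I_n -> Prop) : P 0 [::] ->
  (forall t s i, s \in latwords t -> inB t i -> addable (cont s) i -> P t s -> P t.+1 (rcons s i)) ->
  forall t s, s \in latwords t -> P t s.
Proof.
move=> P0 PS; elim=> [s|t IH s]; first by rewrite inE => /eqP->.
case/lastP: s => [/allpairsPdep[s [i [_ _ /(congr1 size)]]]|s i]; first by rewrite size_rcons.
by move=> /mem_latwordsS[h1 h2 h3]; apply: PS => //; apply: IH.
Qed.

Lemma succ_inj j j' i : succ j i -> succ j' i -> j = j'.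
Proof. by move=> /andP[/eqP h _] /andP[/eqP h' _]; apply: val_inj; apply: succn_inj; rewrite h. Qed.
Lemma succ_inj' j i i' : succ j i -> succ j i' -> i = i'.
Proof. by move=> /andP[/eqP h _] /andP[/eqP h' _]; apply: val_inj; rewrite /= -h -h'. Qed.
Lemma succ_neq j i : succ j i -> j != i.
Proof. by move=> /andP[/eqP h _]; rewrite -val_eqE /= -h neq_ltn ltnSn. Qed.

Lemma part_inc c i : part c -> addable c i -> part (inc c i).
Proof.
move=> /partP pc /addableP ac; apply/partP => j j' sjj'; rewrite !ffunE.
have := pc _ _ sjj'; case: (eqVneq j' i) sjj' => [->|_] h; last by lia.
by have := ac _ h; lia.
Qed.

Lemma part_dec c i : part c -> remov c i -> part (dec c i).
Proof.
move=> /partP pc /removP[c0 rc]; apply/partP => j j' sjj'; rewrite !ffunE.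
have := pc _ _ sjj'; case: (eqVneq j i) sjj' => [->|_] h; last by lia.
by have := rc _ h; lia.
Qed.

Lemma latwords_part t s : s \in latwords t -> part (cont s).
Proof.
elim/latwords_ind => [|{}t {}s i _ _ a p]; first by apply/partP => j i _; rewrite !ffunE.
by rewrite cont_rcons; apply: part_inc.
Qed.

Lemma latwords_bst t s : s \in latwords t -> map (fun i => bst i) s = map bst (iota 0 t).
Proof.
elim/latwords_ind => [//|{}t {}s i _ /eqP b _ e].
by rewrite map_rcons e b -map_rcons -cats1 -[t.+1]addn1 iotaD.
Qed.

Definition latcount t c := \sum_(s <- latwords t) (cont s == c).

Lemma latcount_rec t c : part c -> latcount t.+1 c = \sum_(j | inB t j && remov c j) latcount t (dec c j).
Proof.
move=> pc; rewrite /latcount sum_latwordsS.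
under eq_bigr do rewrite big_mkcond /=.
rewrite exchange_big [RHS]big_mkcond /=; apply: eq_bigr => i _.
case: (boolP (inB t i)) => /= bi; last by rewrite big1.
case: (boolP (remov c i)) => /= ri.
  apply: eq_bigr => s _; rewrite cont_rcons.
  have /removP[c0 rc] := ri.
  have -> : (inc (cont s) i == c) = (cont s == dec c i).
    apply/eqP/eqP => [<-|->]; apply/ffunP => v; rewrite !ffunE; first by rewrite addnK.
    by case: (eqVneq v i) => [->|_] /=; rewrite ?subn0 ?addn0 // subnK.
  case: (eqVneq (cont s) (dec c i)) => [->|]; last by case: ifP.
  case: ifP => // /negP[]; apply/addableP => j sj; rewrite !ffunE eqxx.
  have := (partP _ pc) _ _ sj; case: eqP (succ_neq sj) => //= _ _; lia.
rewrite big_seq big1 // => s sL; case: ifP => // a; apply/eqP; rewrite eqb0 cont_rcons.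
apply: contra ri => /eqP <-; apply/removP; rewrite ffunE eqxx; split; first by lia.
move=> j sj; rewrite ffunE eq_sym (negbTE (succ_neq sj)) addn0 addn1 ltnS.
exact: (partP _ (latwords_part sL)).
Qed.

Definition bsize t c := \sum_(i | inB t i) c i.

(** A removable row is followed by an addable one and conversely; only the first row of the block,
    always addable, has no partner. *)
Lemma card_add_rem t c : t < n -> part c -> bsize t c = t - bst t ->
  #|[pred i | inB t i && addable c i]| = #|[pred j | inB t j && remov c j]|.+1.
Proof.
move=> tn pc sc; have bt := bst_le K t; have ltb : bst t < n by lia.
pose a : 'I_n := Ordinal ltb.
have ba : inB t a by rewrite /inB /= bst_idem.
have aa : addable c a.
  apply/addableP => j /andP[/eqP e1 /eqP e2]; exfalso.
  by have := bst_le K j; rewrite e2 /= bst_idem; move: e1 => /=; lia.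
rewrite (cardD1x (j := a)) /=; last by rewrite ba aa.
rewrite add1n; congr _.+1; symmetry.
(* The finite supply of labels matters here: a removable last row would make all rows of the block
   nonempty, but the block has more than [t - bst t] labels and holds only [t - bst t] boxes. *)
have sucB j : inB t j -> remov c j -> exists2 i, succ j i & inB t i.
  move=> bj /removP[c0 rc].
  have [i /andP[si bi]|none] := pickP (fun i => succ j i && inB t i); first by exists i.
  exfalso; have jmax (i : 'I_n) : inB t i -> i <= j.
    move=> bi; rewrite leqNgt; apply/negP => ji.
    have jn : j.+1 < n by have := ltn_ord i; lia.
    have e1 : bst j.+1 = bst t.
      apply/eqP; rewrite eqn_leq -{1}(eqP bi) -(eqP bj).
      by rewrite (bst_mono K (leqnSn j)) (bst_mono K ji).
    have b1 : inB t (Ordinal jn) by exact/eqP.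
    have := none (Ordinal jn); rewrite b1 andbT => /negP[].
    by apply/andP; split=> //; rewrite (eqP bj) (eqP b1).
  have cpos (i : 'I_n) : inB t i -> 0 < c i.
    move=> bi; have ij := jmax i bi; have [m] := ubnP (j - i); elim: m i ij bi => // m IH i ij bi h.
    have [-> //|ne] := eqVneq i j.
    have lij : i < j by rewrite ltn_neqAle ne ij.
    have i1n : i.+1 < n by have := ltn_ord j; lia.
    have e1 : bst i.+1 = bst t.
      apply/eqP; rewrite eqn_leq -{1}(eqP bj) -(eqP bi).
      by rewrite (bst_mono K (leqnSn i)) (bst_mono K lij).
    have b1 : inB t (Ordinal i1n) by exact/eqP.
    have s1 : succ i (Ordinal i1n).
      by apply/andP; split=> //; rewrite (eqP bi) (eqP b1).
    apply: leq_trans ((partP _ pc) _ _ s1); apply: IH => //=; lia.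
  have : #|[pred i : 'I_n | inB t i]| <= t - bst t.
    rewrite -sc /bsize -sum1_card; apply: leq_sum => i; exact: cpos.
  apply/negP; rewrite -ltnNge.
  have fb (m : 'I_(t - bst t).+1) : bst t + m < n by have := ltn_ord m; lia.
  pose f m := Ordinal (fb m).
  have fi : injective f by move=> m m' /(congr1 val) /= /addnI/val_inj.
  have := card_imset predT fi; rewrite card_ord => <-.
  apply: subset_leq_card; apply/subsetP => i /imsetP[m _ ->]; rewrite inE /inB eqn_leq /=.
  rewrite bst_mono /=; last by have := ltn_ord m; lia.
  by rewrite -{1}(bst_idem K t); apply: bst_mono; apply: leq_addr.
pose nx j := odflt j [pick i | succ j i].
have nxE j i : succ j i -> nx j = i.
  by rewrite /nx; case: pickP => [i' /succ_inj' h /h|/(_ i) ->].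
have inj : {in [pred j | inB t j && remov c j] &, injective nx}.
  move=> j j' /andP[bj rj] /andP[bj' rj'].
  have [i si _] := sucB _ bj rj; have [i' si' _] := sucB _ bj' rj'.
  by rewrite (nxE _ _ si) (nxE _ _ si') => e; apply: (succ_inj si); rewrite e.
rewrite -(card_in_imset inj); apply: eq_card => i; apply/imsetP/idP => [[j /andP[bj rj] ->]|].
  have [i' si bi'] := sucB _ bj rj; rewrite (nxE _ _ si) inE bi' /=; apply/andP; split.
    by apply/addableP => j' sj'; rewrite -(succ_inj si sj'); case/removP: rj => _; apply.
  apply/eqP => e; move: si; rewrite e => /andP[/eqP e1 /eqP e2].
  by have := bst_le K j; rewrite e2 /= bst_idem; move: e1 => /=; lia.
rewrite inE => /andP[/andP[bi /addableP ai] na].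
have ia : a < i.
  by rewrite ltn_neqAle val_eqE eq_sym na /= -(eqP bi) bst_le.
have jn : i.-1 < n by have := ltn_ord i; lia.
pose j := Ordinal jn.
have bj : inB t j.
  rewrite /inB eqn_leq /=; apply/andP; split; first by rewrite -(eqP bi); apply: bst_mono; lia.
  by rewrite -{1}(bst_idem K t); apply: bst_mono; move: ia => /=; lia.
have sj : succ j i by rewrite /succ (eqP bj) (eqP bi) eqxx andbT /=; move: ia => /=; lia.
exists j; last by rewrite (nxE _ _ sj).
rewrite inE bj /=; apply/removP; split; first by have := ai _ sj; lia.
by move=> i' si'; rewrite -(succ_inj' sj si'); apply: ai.
Qed.

Lemma add_rem_swap c i j : i != j -> part c ->
  addable c i && remov (inc c i) j = remov c j && addable (dec c j) i.
Proof.
move=> nij pc; have nji : (j == i) = false by rewrite eq_sym (negbTE nij).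
apply/andP/andP => -[].
  move=> /addableP ai /removP; rewrite ffunE nji addn0 => -[c0 r]; split.
    by apply/removP; split=> // i' /r; rewrite ffunE; lia.
  apply/addableP => j' sj; rewrite !ffunE (negbTE nij) subn0.
  have [e|_] := eqVneq j' j; last by rewrite subn0; apply: ai.
  by rewrite e in sj *; have := r _ sj; rewrite ffunE eqxx; lia.
move=> /removP[c0 r] /addableP ad; split.
  by apply/addableP => j' /ad; rewrite !ffunE (negbTE nij); lia.
apply/removP; rewrite ffunE nji addn0; split=> // i' si; rewrite ffunE.
have [e|_] := eqVneq i' i; last by rewrite addn0; apply: r.
by rewrite e in si *; have := ad _ si; rewrite !ffunE eqxx (negbTE nij); lia.
Qed.

Lemma dec_inc c i : dec (inc c i) i = c.
Proof. by apply/ffunP => v; rewrite !ffunE addnK. Qed.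

Lemma inc_dec c i : 0 < c i -> inc (dec c i) i = c.
Proof. by move=> h; apply/ffunP => v; rewrite !ffunE; case: (eqVneq v i) => [->|_]; rewrite /= ?subn0 ?addn0 ?subnK. Qed.

Lemma dec_inc_swap c i j : i != j -> dec (inc c i) j = inc (dec c j) i.
Proof.
move=> nij; apply/ffunP => v; rewrite !ffunE.
by case: (eqVneq v j) => [->|_]; rewrite ?subn0 // eq_sym (negbTE nij) !addn0.
Qed.

Lemma sum_add_box_expand t c : part c ->
  \sum_(i | inB t i && addable c i) latcount t.+1 (inc c i) =
  #|[pred i | inB t i && addable c i]| * latcount t c +
  \sum_(i | inB t i && addable c i) \sum_(j | inB t j && (j != i) && remov (inc c i) j)
     latcount t (dec (inc c i) j).
Proof.
move=> pc; rewrite -sum1_card big_distrl -big_split /=; apply: eq_bigr => i /andP[bi ai].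
rewrite latcount_rec ?part_inc // (bigD1 i) /=.
  by rewrite dec_inc mul1n; congr (_ + _); apply: eq_bigl => j; rewrite andbAC.
rewrite bi; apply/removP; rewrite ffunE eqxx; split; first by rewrite addn1.
move=> i' si; rewrite ffunE eq_sym (negbTE (succ_neq si)) addn0 addn1 ltnS.
exact: (partP _ pc) _ _ si.
Qed.

(* Adding a box and then removing one differs from removing and then adding by the identity. *)
Lemma sum_add_box t c : t < n -> part c -> bsize t c = t - bst t ->
  \sum_(i | inB t i && addable c i) latcount t.+1 (inc c i) = (t - bst t).+1 * latcount t c.
Proof.
elim: t c => [|t IH] c tn pc sc; rewrite sum_add_box_expand // card_add_rem //.
  have c0 j : inB 0 j -> c j = 0.
    by move=> bj; apply/eqP; move: sc; rewrite /bsize => /eqP; rewrite sum_nat_eq0 => /forall_inP/(_ j bj).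
  rewrite big1 => [|i /andP[bi ai]]; last first.
    rewrite big1 // => j /andP[/andP[bj nj] /removP[]]; rewrite ffunE c0 // (negbTE nj); lia.
  rewrite eq_card0 ?addn0 // => j; rewrite !inE; apply/negP => /andP[bj /removP[]].
  by rewrite c0.
(* Without a link [t.+1] opens a new block, still empty: nothing can be removed, and only the first
   row can grow. *)
case E: (glue K t); last first.
  have e0 : t.+1 - bst t.+1 = 0 by rewrite /= E subnn.
  rewrite e0 in sc *.
  have c0 j : inB t.+1 j -> c j = 0.
    by move=> bj; apply/eqP; move: sc; rewrite /bsize => /eqP; rewrite sum_nat_eq0 => /forall_inP/(_ j bj).
  rewrite big1 => [|i /andP[bi ai]]; last first.
    rewrite big1 // => j /andP[/andP[bj nj] /removP[]]; rewrite ffunE c0 // (negbTE nj); lia.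
  rewrite eq_card0 ?addn0 // => j; rewrite !inE; apply/negP => /andP[bj /removP[]].
  by rewrite c0.
have eb : bst t.+1 = bst t by rewrite /= E.
have eB i : inB t.+1 i = inB t i by rewrite /inB eb.
(* Remove a box j from [c] and apply the induction hypothesis to [dec c j]. Adding back the same box
   returns [c], once for each removable row; adding another box gives the double sum, by
   [add_rem_swap]. *)
have key : (t.+1 - bst t.+1) * latcount t.+1 c = #|[pred j | inB t.+1 j && remov c j]| * latcount t.+1 c +
    \sum_(i | inB t.+1 i && addable c i) \sum_(j | inB t.+1 j && (j != i) && remov (inc c i) j)
     latcount t.+1 (dec (inc c i) j).
  have e1 : t.+1 - bst t.+1 = (t - bst t).+1 by rewrite eb subSn ?bst_le.
  rewrite e1 {1}latcount_rec // big_distrr -sum1_card [in RHS]big_distrl.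
  have e2 : \sum_(i | inB t.+1 i && addable c i) \sum_(j | inB t.+1 j && (j != i) && remov (inc c i) j)
     latcount t.+1 (dec (inc c i) j) =
     \sum_(j | inB t.+1 j && remov c j) \sum_(i | inB t.+1 i && (i != j) && addable (dec c j) i)
     latcount t.+1 (inc (dec c j) i).
    rewrite (exchange_big_dep (fun j => inB t.+1 j && remov c j)) /=; last first.
      move=> i j /andP[bi ai] /andP[/andP[bj nj] rj]; rewrite bj /=.
      rewrite eq_sym in nj.
      by have := add_rem_swap nj pc; rewrite ai rj => /esym/andP[].
    apply: eq_bigr => j /andP[bj rj]; rewrite big_mkcond [RHS]big_mkcond; apply: eq_bigr => i _.
    have [-> |nij] := eqVneq i j; first by rewrite !(eqxx, andbF).
    rewrite bj (dec_inc_swap _ nij) /= !andbT.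
    by have := add_rem_swap nij pc; rewrite rj /= => <-; rewrite andbA.
  rewrite [X in _ = _ + X]e2 -big_split; apply: eq_big => [j|j /andP[bj rj]]; first by rewrite inE eB.
  rewrite -eB in bj.
  have [c0 rc] := removP _ _ rj.
  change ((t - bst t).+1 * latcount t (dec c j) = 1 * latcount t.+1 c +
    \sum_(i | inB t.+1 i && (i != j) && addable (dec c j) i) latcount t.+1 (inc (dec c j) i)).
  rewrite -IH ?part_dec //; [|by lia|].
    rewrite (bigD1 j) /=; last first.
      rewrite -eB bj; apply/addableP => j' sj; rewrite !ffunE eqxx (negbTE (succ_neq sj)).
      by have := (partP _ pc) _ _ sj; lia.
    rewrite inc_dec // mul1n; congr (_ + _); apply: eq_bigl => i.
    by rewrite eB andbAC.
  apply: succn_inj; rewrite -e1 -sc /bsize (bigD1 j) /=; last by rewrite -eB.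
  rewrite [in RHS](bigD1 j) //= ffunE eqxx -addSn subn1 prednK //; congr (_ + _).
  rewrite (eq_bigl (fun i => inB t.+1 i && (i != j))); last by move=> i; rewrite eB.
  by apply: eq_bigr => i /andP[_ ni]; rewrite ffunE (negbTE ni) subn0.
by rewrite mulSn [RHS]mulSn key addnA.
Qed.

Lemma bsize_cont t s : t < n -> s \in latwords t -> bsize t (cont s) = t - bst t.
Proof.
move=> tn sL; rewrite /bsize.
have -> : \sum_(i | inB t i) cont s i = count (inB t) s.
  under eq_bigr do rewrite ffunE.
  elim: {sL} s => [|a s IH] /=; first by rewrite big1.
  rewrite big_split /= IH; congr (_ + _); rewrite big_mkcond (bigD1 a) //= eqxx big1; first by case: ifP.
  by move=> i ni; rewrite eq_sym (negbTE ni) if_same.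
have -> : count (inB t) s = count (pred1 (bst t)) (map (fun i => bst i) s).
  by rewrite count_map; apply: eq_count => i.
rewrite (latwords_bst sL) count_map.
have := count_predC (fun m => m < bst t) (iota 0 t); rewrite size_iota.
have -> : count (fun m => m < bst t) (iota 0 t) = bst t.
  have e1 : t = bst t + (t - bst t) by rewrite subnKC ?bst_le.
  rewrite e1 iotaD count_cat -e1 add0n.
  rewrite (@eq_in_count _ _ predT); last by move=> m; rewrite mem_iota add0n => /= ->.
  rewrite count_predT size_iota (@eq_in_count _ _ pred0) ?count_pred0 ?addn0 //.
  by move=> m; rewrite mem_iota => /andP[h _]; rewrite /= ltnNge h.
move=> e1; have -> : t - bst t = count (predC (fun m => m < bst t)) (iota 0 t).
  by rewrite -[X in X - _]e1 addKn.
apply: eq_in_count => m; rewrite mem_iota /= add0n -leqNgt => mt.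
apply/eqP/idP => [<-|h]; first exact: bst_le.
apply/eqP; rewrite eqn_leq (bst_mono K (ltnW mt)) /= -{1}(bst_idem K t); exact: bst_mono.
Qed.

(** For t = n the right side is the product of the factorials of the block sizes, the order of the
    Young subgroup. *)
Lemma sum_pairs t : t <= n -> \sum_(s <- latwords t) latcount t (cont s) = \prod_(m < t) (m - bst m).+1.
Proof.
elim: t => [_|t IH tn].
  rewrite big_ord0 /latcount /= !big_seq1; by rewrite eqxx.
rewrite big_ord_recr /= -IH; last exact: ltnW.
rewrite sum_latwordsS big_distrl big_seq [RHS]big_seq; apply: eq_bigr => s sL.
rewrite (eq_bigr (fun i => latcount t.+1 (inc (cont s) i))); last by move=> i _; rewrite cont_rcons.
by rewrite sum_add_box ?(latwords_part sL) ?bsize_cont // mulnC.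
Qed.
End Count.

Section Bounds.
Variables (n : nat) (K : {set 'I_n.-1}).
Local Open Scope nat_scope.
Implicit Types (f : 'I_n -> 'I_n) (t : nat).

Lemma pcntS f t (tn : t < n) v : pcnt f t.+1 v = pcnt f t v + (f (Ordinal tn) == v).
Proof.
rewrite /pcnt; case: (boolP (f (Ordinal tn) == v)) => e.
  rewrite addn1 (cardsD1 (Ordinal tn)) inE /= ltnSn e add1n; congr _.+1; apply: eq_card => p.
  by rewrite !inE -val_eqE /= ltnS ltn_neqAle andbA.
rewrite addn0; apply: eq_card => p; rewrite !inE ltnS leq_eqVlt.
case: (eqVneq (val p) t) => [ep|] //=; rewrite -ep ltnn /=.
have -> : p = Ordinal tn by apply: val_inj.
exact: negbTE.
Qed.

Definition wseq f t := [seq f p | p <- take t (enum 'I_n)].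

Lemma wseqS f t (tn : t < n) : wseq f t.+1 = rcons (wseq f t) (f (Ordinal tn)).
Proof.
rewrite /wseq (take_nth (Ordinal tn)) ?size_enum_ord // map_rcons.
by rewrite (nth_ord_enum (Ordinal tn) (Ordinal tn)).
Qed.

Lemma cont_wseq f t : t <= n -> cont (wseq f t) = [ffun v => pcnt f t v].
Proof.
elim: t => [_|t IH tn].
  rewrite /wseq take0; apply/ffunP => v; rewrite !ffunE /=.
  by rewrite /pcnt (_ : [set p | _] = set0) ?cards0 //; apply/setP => p; rewrite !inE.
by rewrite wseqS cont_rcons IH 1?ltnW //; apply/ffunP => v; rewrite !ffunE pcntS eq_sym.
Qed.

Lemma wseq_latwords f t : cpt K f -> lattice K f -> t <= n -> wseq f t \in latwords K t.
Proof.
move=> cf lf; elim: t => [_|t IH tn]; first by rewrite /wseq take0 mem_seq1.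
rewrite wseqS; apply/mem_latwordsS; split; [by apply: IH; apply: ltnW|by rewrite /inB cf|].
apply/addableP => j /andP[/eqP ej /eqP bj]; rewrite (cont_wseq _ (ltnW tn)) !ffunE.
have kn : j < n.-1 by have := ltn_ord (f (Ordinal tn)); lia.
pose k := Ordinal kn.
have ej' : lo k = j by apply: val_inj.
have ei : hi k = f (Ordinal tn) by apply: val_inj.
have kK : k \in K by rewrite mem_K ej' ei bj.
have := lf k t.+1 kK; rewrite !pcntS ej' ei eqxx.
by have -> : (f (Ordinal tn) == j) = false; [rewrite -val_eqE /= -ej gtn_eqF|rewrite addn0 addn1].
Qed.

Lemma pairs_bound (xs : seq ({ffun 'I_n -> 'I_n} * {ffun 'I_n -> 'I_n})) : uniq xs ->
  (forall u, u \in xs -> [/\ cpt K u.1, lattice K u.1, cpt K u.2, lattice K u.2 &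
       forall v, cnt u.1 v = cnt u.2 v]) ->
  size xs <= \prod_(m < n) (m - bst K m).+1.
Proof.
move=> uxs h; rewrite -sum_pairs //.
pose LL := [seq (s, s') | s <- latwords K n, s' <- [seq s' <- latwords K n | cont s' == cont s]].
have -> : \sum_(s <- latwords K n) latcount K n (cont s) = size LL.
  rewrite size_allpairs_dep sumnE big_map; apply: eq_bigr => s _.
  by rewrite size_filter -sum1_count [RHS]big_mkcond.
pose m (u : {ffun 'I_n -> 'I_n} * {ffun 'I_n -> 'I_n}) := (wseq u.1 n, wseq u.2 n).
have wi : injective (fun f : {ffun 'I_n -> 'I_n} => wseq f n).
  move=> f g; rewrite /wseq take_oversize ?size_enum_ord // => e; apply/ffunP => p.
  by move/eq_in_map: e; apply; rewrite mem_enum.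
have mi : injective m by move=> [a b] [a' b'] [/wi-> /wi->].
rewrite -(size_map m); apply: uniq_leq_size; first by rewrite map_inj_uniq.
move=> _ /mapP[u /h[c1 l1 c2 l2 e] ->]; apply/allpairsPdep.
exists (wseq u.1 n), (wseq u.2 n); split=> //; first exact: wseq_latwords.
rewrite mem_filter wseq_latwords // andbT !cont_wseq //; apply/eqP/ffunP => v; rewrite !ffunE.
have pe (f : {ffun 'I_n -> 'I_n}) : pcnt f n v = cnt f v.
  by rewrite /pcnt /cnt; apply: eq_card => p; rewrite !inE ltn_ord.
by rewrite !pe e.
Qed.

(** As in the Fisher-Yates shuffle, choosing for every m a point [c m] of its block, not after m,
    yields distinct products: the earlier factors fix m, so the product through m sends m to [c m].
    This bounds the order of [SK K] from below. *)
Definition tprod (c : {ffun 'I_n -> 'I_n}) t : 'S_n := (\prod_(m <- take t (enum 'I_n)) tperm m (c m))%g.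

Lemma tprodS c t (tn : t < n) : tprod c t.+1 = (tprod c t * tperm (Ordinal tn) (c (Ordinal tn)))%g.
Proof.
rewrite /tprod (take_nth (Ordinal tn)) ?size_enum_ord // -cats1 big_cat big_seq1.
by rewrite (nth_ord_enum (Ordinal tn) (Ordinal tn)).
Qed.

Definition below_fam := family (fun m : 'I_n => [pred a : 'I_n | (bst K m <= a) && (a <= m)]).

Lemma tprod_fix c t (p : 'I_n) : c \in below_fam -> t <= n -> t <= p -> tprod c t p = p.
Proof.
move=> /familyP cf; elim: t => [|t IH] tn tp; first by rewrite /tprod take0 big_nil perm1.
rewrite tprodS permM IH ?(ltnW tn) ?(ltnW tp) //; apply: tpermD; rewrite -val_eqE /=.
  by rewrite neq_ltn tp.
by have := cf (Ordinal tn); rewrite inE /= => /andP[_ h]; rewrite neq_ltn (leq_ltn_trans h tp).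
Qed.

Lemma tprod_inj c c' t : c \in below_fam -> c' \in below_fam -> t <= n ->
  tprod c t = tprod c' t -> forall m : 'I_n, m < t -> c m = c' m.
Proof.
move=> cf cf'; elim: t => [//|t IH] tn; rewrite !tprodS => e.
have e1 : c (Ordinal tn) = c' (Ordinal tn).
  have := congr1 (fun w : 'S_n => w (Ordinal tn)) e.
  by rewrite !permM !tprod_fix ?(ltnW tn) // !tpermL.
rewrite e1 in e; move/mulIg: e => /(IH (ltnW tn)) h m; rewrite ltnS leq_eqVlt => /orP[/eqP em|/h//].
by have -> : m = Ordinal tn by apply: val_inj.
Qed.

Lemma tprod_SK c t : c \in below_fam -> t <= n -> tprod c t \in SK K.
Proof.
move=> /familyP cf; elim: t => [|t IH] tn; first by rewrite /tprod take0 big_nil SK1.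
rewrite tprodS; apply: SKM; first by apply: IH; apply: ltnW.
have e1 : bst K (c (Ordinal tn)) = bst K (Ordinal tn).
  have := cf (Ordinal tn); rewrite inE => /andP[h1 /bst_mono h2].
  by apply/eqP; rewrite eqn_leq h2 -{1}(bst_idem K (Ordinal tn)) bst_mono.
by apply/SKP => p; case: tpermP => [->|->|].
Qed.

Lemma SK_bound : \prod_(m < n) (m - bst K m).+1 <= #|SK K|.
Proof.
apply: (@leq_trans #|below_fam|).
  rewrite card_family foldrE big_map big_enum; apply: leq_prod => m _.
  have fb (a : 'I_(m - bst K m).+1) : bst K m + a < n.
    by have := ltn_ord a; have := ltn_ord m; have := bst_le K m; lia.
  pose f a := Ordinal (fb a).
  have fi : injective f by move=> a a' /(congr1 val) /= /addnI/val_inj.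
  have := card_imset predT fi; rewrite card_ord => <-.
  apply: subset_leq_card; apply/subsetP => i /imsetP[a _ ->]; rewrite inE /=.
  by have := ltn_ord a; have := bst_le K m; lia.
have ti : {in below_fam &, injective (fun c => tprod c n)}.
  by move=> c c' cf cf' e; apply/ffunP => m; apply: (tprod_inj cf cf' (leqnn n)).
rewrite -(card_in_imset ti); apply: subset_leq_card; apply/subsetP => w /imsetP[c cf ->].
exact: tprod_SK.
Qed.
End Bounds.

(** * Freeness by comparison of ranks *)

(** Padding with zeros makes both matrices square; over a commutative ring a one-sided inverse is
    two-sided, and the upper left block of the product is the claim. *)
Lemma mulmx1C_le (S : comUnitRingType) (M N : nat) (P : 'M[S]_(N, M)) (R : 'M[S]_(M, N)) :
  (M <= N)%N -> P *m R = 1%:M -> R *m P = 1%:M.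
Proof.
move=> le; move: P R; rewrite -(subnKC le); move: (N - M)%N => k P R PR.
have : col_mx R (0 : 'M_(k, _)) *m row_mx P (0 : 'M_(_, k)) = 1%:M.
  by apply: mulmx1C; rewrite mul_row_col mulmx0 addr0.
by rewrite mul_col_row scalar_mx_block => /eq_block_mx[].
Qed.

Lemma spn_fin (S : comUnitAlgType CC) (A : algType S) (I : finType) (P : pred I) (F : I -> A) v :
  spn (fun v => exists2 i, P i & v = F i) v -> exists c : I -> S, v = \sum_(i | P i) c i *: F i.
Proof.
elim=> [|c a b [i Pi ->] _ [c' ->]].
  by exists (fun => 0); rewrite big1 // => i _; rewrite scale0r.
exists (fun j => (if j == i then c else 0) + c' j).
under [RHS]eq_bigr do rewrite scalerDl; rewrite big_split /=; congr (_ + _).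
rewrite (bigD1 i) //= eqxx big1 ?addr0 // => j /andP[_ /negbTE ->]; exact: scale0r.
Qed.

(** [d' * d^-1] preserves the letters of [pi]; a pair reversed by it would lie in one row, where
    both [d] and [d'] increase. *)
Lemma rowinc_uniq n (pi : 'I_n -> 'I_n) (d d' : 'S_n) : ndec pi -> rowinc pi d -> rowinc pi d' ->
  (forall p, pi ((d^-1)%g p) = pi ((d'^-1)%g p)) -> d = d'.
Proof.
move=> npi rd rd' e; pose u := (d' * d^-1)%g.
have pu p : pi (u p) = pi p by rewrite permM e permK.
suff u1 : u = 1%g by rewrite -[d]mul1g -u1 /u mulgKV.
apply: perm_incr_id => p p' pp; rewrite ltnNge leq_eqVlt; apply/negP => /orP[/eqP/val_inj/perm_inj ep|lt].
  by move: pp; rewrite ep ltnn.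
have epi : pi p = pi p'.
  apply/val_inj/eqP; rewrite eqn_leq (npi _ _ (ltnW pp)) /=.
  by rewrite -(pu p) -(pu p'); apply: npi; apply: ltnW.
have := rd' _ _ pp epi; have := rd _ _ lt; rewrite !pu epi => /(_ erefl).
by rewrite !permM !permKV => h1 h2; have := ltn_trans h1 h2; rewrite ltnn.
Qed.

Section Basis.
Variables (n : nat) (S : comUnitAlgType CC) (q : S) (A : algType S) (e z : nat -> A) (star : A -> A).
Hypotheses (HA : is_bH n q e z) (HS : is_bH_star n e z star) (Uq : q \is a GRing.unit).
Implicit Types (K : {set 'I_n.-1}).
Notation word := {ffun 'I_n -> 'I_n}.
Notation tri := (word * 'S_n * 'S_n)%type.

Definition stdx K (y : tri) := [/\ ndec y.1.1, cpt K y.1.1, stdp K y.1.1 y.1.2 & stdp K y.1.1 y.2].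
Definition belt_of K (y : tri) := bas_elt q e z star K y.1.1 y.1.2 y.2.
Notation bel := belt_of.

Lemma eq_bas_elt K (pi pi' : 'I_n -> 'I_n) d d' : pi =1 pi' ->
  bas_elt q e z star K pi d d' = bas_elt q e z star K pi' d d'.
Proof. by move=> e1; rewrite /bas_elt /rowsymm (eq_fibsum q e z K e1 e1). Qed.

Lemma stdp_eq K (pi pi' : 'I_n -> 'I_n) d : pi =1 pi' -> stdp K pi d -> stdp K pi' d.
Proof.
move=> e1 [h1 h2 h3]; split=> //.
  by move=> p p' pp; rewrite -!e1; apply: h1.
move=> i t iK; have := h3 i t iK.
by rewrite /pcnt; congr (_ <= _)%N; apply: eq_card => p; rewrite !inE e1.
Qed.

Lemma bas_gen_tri K pi v : bas_gen q e z star K pi v -> exists2 y, stdx K y & v = bel K y.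
Proof.
move=> [pi' [d [d' [h1 h2 h3 [h4 h5 ->]]]]].
have e1 : pi' =1 [ffun p => pi' p] by move=> p; rewrite ffunE.
exists ([ffun p => pi' p], d, d'); last by rewrite /belt_of /= (eq_bas_elt _ _ _ e1).
split=> /=; [by move=> p p'; rewrite !ffunE; apply: h1|by move=> p; rewrite ffunE; apply: h2| |]; exact: stdp_eq e1 _.
Qed.

(** The word [id] has all rows of length one, hence a trivial row stabilizer; [bas_span] at this
    word therefore spans all of [EK K * A]. *)
Lemma rowsymm_id K : rowsymm q e z K id = EK e K.
Proof.
rewrite /rowsymm /fibsum (bigD1 1%g) /=; last by apply/forallP => p; rewrite perm1.
rewrite big1 ?addr0 => [|w /andP[/forallP h nw]].
  by rewrite winv1 expr0 scale1r /TT (zw1 HA) mulr1.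
by case/eqP: nw; apply/permP => p; rewrite perm1; apply/eqP.
Qed.

Lemma EK_span K a : spn (fun v => exists2 y, stdx K y & v = bel K y) (EK e K * a).
Proof.
rewrite -(rowsymm_id K) -[rowsymm _ _ _ _ _]mul1r.
apply: (@spn_sub _ _ (bas_gen q e z star K id)); last by apply: (bas_span HA HS Uq).
exact: bas_gen_tri.
Qed.

Lemma bH_span a : spn (fun v => exists K, exists2 y, stdx K y & v = bel K y) a.
Proof.
rewrite -[a]mul1r -(sum_EK n e) mulr_suml; apply: spn_sum => K _.
by apply: spn_sub (EK_span K a) => v hv; exists K.
Qed.

Lemma bel_EK K y : EK e K * bel K y = bel K y.
Proof.
by rewrite /belt_of /bas_elt !mulrA (EK_central HA) -(mulrA (star _)) (EK_fibsum HA).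
Qed.

Lemma TT_span K a : spn (fun v => exists2 w, w \in SK K & v = TT e z K w) (EK e K * a).
Proof.
set G := fun v => _.
have : spn G (EK e K).
  by apply: spn_gen; exists 1%g; rewrite ?SK1 // /TT (zw1 HA) mulr1.
move: (EK e K); elim/(bH_ind' HA): a => [|a b ha hb|c a ha|a b ha hb|k|k] v hv.
- by rewrite mulr1.
- by rewrite mulrDr; apply: spnD; auto.
- by rewrite -scalerAr; apply: spnZ; auto.
- by rewrite mulrA; auto.
- apply: spn_mulr hv => {}v [w wK ->]; rewrite -(TT_EK HA) -mulrA (EK_e HA) -scalerAr (TT_EK HA).
  by apply/spnZ/spn_gen; exists w.
apply: spn_mulr hv => {}v [w wK ->].
case: (boolP (k \in K)) => kK; last by rewrite (TT_z0 HA) //; apply: spn0.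
have g1 : spn G (TT e z K (w * sref n k)%g).
  by apply: spn_gen; exists (w * sref n k)%g => //; apply: SKM => //; apply: SK_sref.
case: (boolP (asc w k)) => a; first by rewrite (TT_asc HA).
by rewrite (TT_desc HA) //; apply: spnD => //; apply/spnZ/spn_gen; exists w.
Qed.

Definition XK K : {set tri} := [set y | `[< stdx K y >]].
Lemma XKP K y : reflect (stdx K y) (y \in XK K).
Proof. by rewrite inE; apply: asboolP. Qed.

(** A triple is recovered from its two lattice words: [pi] is their common sorted rearrangement, and
    [rowinc_uniq] gives the permutations. *)
Lemma card_XK K : (#|XK K| <= #|SK K|)%N.
Proof.
apply: leq_trans (SK_bound K).
pose m (y : tri) : word * word :=
  ([ffun p => y.1.1 ((y.1.2^-1)%g p)], [ffun p => y.1.1 ((y.2^-1)%g p)]).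
have mi : {in XK K &, injective m}.
  move=> [[pi d] d'] [[pi2 d2] d2'] /XKP[/= h1 h2 [h3 h4 h5] [h6 h7 h8]] /XKP[/= k1 k2 [k3 k4 k5] [k6 k7 k8]].
  move=> [/ffunP e1 /ffunP e2].
  have epi : pi = pi2.
    apply/ffunP; apply: (@ndec_perm_eq _ _ _ (d2 * d^-1)%g) => // p.
    by rewrite permM; have := e1 (d2 p); rewrite !ffunE permK.
  subst pi2; congr (_, _, _); apply: (rowinc_uniq h1) => // p.
    by have := e1 p; rewrite !ffunE.
  by have := e2 p; rewrite !ffunE.
rewrite cardE -(size_map m); apply: pairs_bound.
  rewrite map_inj_in_uniq ?enum_uniq // => a b; rewrite !mem_enum; exact: mi.
move=> _ /mapP[[[pi d] d'] + ->]; rewrite mem_enum => /XKP[/= h1 h2 [h3 h4 h5] [h6 h7 h8]].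
have ext (d0 : 'S_n) : [ffun p => pi ((d0^-1)%g p)] =1 (fun p => pi ((d0^-1)%g p)) by move=> p; rewrite ffunE.
have cc (d0 : 'S_n) : d0 \in SK K -> cpt K [ffun p => pi ((d0^-1)%g p)].
  by move=> /SKV/SKP hd p; rewrite ffunE h2 hd.
have ll (d0 : 'S_n) : lattice K (fun p => pi ((d0^-1)%g p)) -> lattice K [ffun p => pi ((d0^-1)%g p)].
  move=> hl i t iK; have := hl i t iK; rewrite /pcnt.
  by congr (_ <= _)%N; apply: eq_card => p; rewrite !inE ext.
split; rewrite /=; auto.
move=> v; transitivity (cnt pi v); first by apply: (@cnt_perm _ _ _ d) => p; rewrite ffunE permK.
by symmetry; apply: (@cnt_perm _ _ _ d') => p; rewrite ffunE permK.
Qed.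

(** [PM] and [RM] express the T_w and the Murphy elements through each other. Freeness of the T_w
    gives [PM *m RM = 1]; by [card_XK] the product in the other order is 1 as well, so [RM] has
    trivial left kernel. *)
Lemma bel_free_K K (c : tri -> S) : \sum_(y in XK K) c y *: bel K y = 0 ->
  forall y, y \in XK K -> c y = 0.
Proof.
move=> c0.
have hP w : exists P : tri -> S, TT e z K w = \sum_(y in XK K) P y *: bel K y.
  apply: spn_fin; apply: spn_sub (EK_span K (zw z w)) => v [y hy ->].
  by exists y => //; apply/XKP.
have hR y : exists R : 'S_n -> S, bel K y = \sum_(w in SK K) R w *: TT e z K w.
  by apply: spn_fin; rewrite -bel_EK; apply: TT_span.
have [P hP'] := choice hP; have [R hR'] := choice hR.
pose PM : 'M[S]_(#|SK K|, #|XK K|) := \matrix_(i, j) P (enum_val i) (enum_val j).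
pose RM : 'M[S]_(#|XK K|, #|SK K|) := \matrix_(i, j) R (enum_val i) (enum_val j).
have PR : PM *m RM = 1%:M.
  apply/matrixP => i j; rewrite !mxE.
  have wK := enum_valP i; set w := enum_val i in wK *.
  pose cw u := \sum_(y in XK K) P w y * R y u - (u == w)%:R.
  have : \sum_(u in SK K) cw u *: TT e z K u = 0.
    under eq_bigr do rewrite scalerBl scaler_suml; rewrite sumrB exchange_big /=.
    have -> : \sum_(u in SK K) (u == w)%:R *: TT e z K u = TT e z K w.
      rewrite (bigD1 w) //= eqxx mulr1n scale1r big1 ?addr0 // => u /andP[_ /negbTE->].
      by rewrite mulr0n scale0r.
    rewrite hP'; apply/eqP; rewrite subr_eq0; apply/eqP; apply: eq_bigr => y _.
    by rewrite hR' scaler_sumr; apply: eq_bigr => u _; rewrite scalerA.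
  move/(TT_free HA)/(_ _ (enum_valP j))/eqP; rewrite /cw subr_eq0 => /eqP.
  rewrite (inj_eq enum_val_inj) eq_sym => <-.
  rewrite [RHS]big_enum_val; apply: eq_bigr => y _; by rewrite !mxE.
have RP := mulmx1C_le (card_XK K) PR.
have cR : forall w, w \in SK K -> \sum_(y in XK K) c y * R y w = 0.
  apply: (TT_free HA); rewrite -[RHS]c0.
  under eq_bigr do rewrite scaler_suml; rewrite exchange_big /=; apply: eq_bigr => y _.
  by rewrite hR' scaler_sumr; apply: eq_bigr => u _; rewrite scalerA.
pose cv : 'rV[S]_#|XK K| := \row_j c (enum_val j).
have cv0 : cv *m RM = 0.
  apply/rowP => j; rewrite !mxE -[RHS](cR _ (enum_valP j)) [RHS]big_enum_val.
  by apply: eq_bigr => y _; rewrite !mxE.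
have : cv = 0 by rewrite -[cv]mulmx1 -RP mulmxA cv0 mul0mx.
move=> cv1 y yX; have := congr1 (fun M : 'rV_ _ => M 0 (enum_rank_in yX y)) cv1.
by rewrite !mxE enum_rankK_in.
Qed.

(** Multiplying by [EK K] isolates the terms of one piece. The index type is arbitrary because
    multitableaux, being nested lists, do not form a finite type. *)
Lemma bel_free (I : eqType) (l : seq I) (gK : I -> {set 'I_n.-1}) (gy : I -> tri) (c : I -> S) :
  uniq l -> (forall x, x \in l -> stdx (gK x) (gy x)) ->
  {in l &, forall x x', gK x = gK x' -> gy x = gy x' -> x = x'} ->
  \sum_(x <- l) c x *: bel (gK x) (gy x) = 0 -> forall x, x \in l -> c x = 0.
Proof.
move=> ul sl il s0 x0 x0l; set K := gK x0.
pose c' y := \sum_(x <- l | (gK x == K) && (gy x == y)) c x.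
have c'0 : \sum_(y in XK K) c' y *: bel K y = 0.
  have := congr1 (fun v => EK e K * v) s0; rewrite mulr0 => {}s0; rewrite -[RHS]s0.
  under eq_bigr do rewrite /c' scaler_suml big_mkcond /=.
  rewrite exchange_big mulr_sumr !big_seq; apply: eq_bigr => x xl.
  have -> : EK e K * (c x *: bel (gK x) (gy x)) = (gK x == K)%:R *: (c x *: bel (gK x) (gy x)).
    rewrite -scalerAr; have [eK|nK] := eqVneq (gK x) K; first by rewrite eK bel_EK mulr1n scale1r.
    by rewrite -bel_EK mulrA (EK_mul HA) eq_sym (negbTE nK) mulr0n !scale0r mul0r scaler0.
  have [eK|nK] := eqVneq (gK x) K; last by rewrite mulr0n scale0r big1.
  rewrite mulr1n scale1r eK (bigD1 (gy x)) /=; last by apply/XKP; rewrite -eK; apply: sl.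
  by rewrite eqxx big1 ?addr0 // => y /andP[_ /negbTE ny]; rewrite eq_sym ny.
have := bel_free_K c'0 (y := gy x0); rewrite /c' => <-; last by apply/XKP; apply: sl.
rewrite big_mkcond (bigD1_seq x0) //= !eqxx big_seq_cond big1 ?addr0 // => x /andP[xl /negP nx].
case: ifP => // /andP[/eqP h1 /eqP h2]; case: nx; apply/eqP; exact: il.
Qed.
End Basis.

(** The product in [EJ] runs over all n points, but the last point has no successor to be joined
    with. *)
Lemma prod_ord_pred (R : pzSemiRingType) n (P : pred nat) (F : nat -> R) : ~~ P n.-1 ->
  \prod_(i < n | P i) F i = \prod_(i < n.-1 | P i) F i.
Proof.
case: n => [|m] nP; first by rewrite !big_ord0.
by rewrite big_mkcond big_ord_recr /= (negbTE nP) mulr1 -big_mkcond.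
Qed.

(** * Linear set partitions *)

Section LinearPartitions.
Variable n : nat.
Implicit Types (k : 'I_n.-1) (p x y : 'I_n) (K L : {set 'I_n.-1}) (J : {set {set 'I_n}}).

Lemma bst_eqP L (x y : nat) : (x <= y)%N ->
  reflect (forall m, (x <= m < y)%N -> glue L m) (bst L x == bst L y).
Proof.
elim: y => [|y IH] xy.
  have -> : x = 0%N by lia.
  by rewrite eqxx; constructor => m; lia.
have [->|ne] := eqVneq x y.+1; first by rewrite eqxx; constructor => m; lia.
have {}xy : (x <= y)%N by lia.
rewrite /=; case E: (glue L y).
  apply: (iffP (IH xy)) => h m; last by move=> /andP[h1 h2]; apply: h; rewrite h1 ltnW.
  by rewrite ltnS => /andP[h1]; rewrite leq_eqVlt => /orP[/eqP-> //|h2]; apply: h; rewrite h1.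
have -> : (bst L x == y.+1) = false by apply/negbTE; have := bst_le L x; lia.
by constructor => /(_ y); rewrite E xy ltnSn => /(_ isT).
Qed.

Definition PK L : {set {set 'I_n}} := preim_partition (fun p : 'I_n => bst L p) setT.
Definition gl J : {set 'I_n.-1} := [set k | pblock J (lo k) == pblock J (hi k)].

Lemma PK_partition L : partition (PK L) setT. Proof. exact: preim_partitionP. Qed.

Lemma mem_pblock_PK L x y : (y \in pblock (PK L) x) = (bst L x == bst L y).
Proof.
by rewrite pblock_equivalence_partition ?inE // => a b c _ _ _; split=> // /eqP->.
Qed.

Lemma pblock_sameE J x y : partition J setT -> (pblock J x == pblock J y) = (y \in pblock J x).
Proof. by move=> /and3P[/eqP c t _]; rewrite eq_pblock // c inE. Qed.

Lemma gl_PK L : gl (PK L) = L.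
Proof.
by apply/setP => k; rewrite inE pblock_sameE ?PK_partition // mem_pblock_PK mem_K.
Qed.

Lemma mem_pblock_self J x : partition J setT -> x \in pblock J x.
Proof. by move=> /and3P[/eqP c t _]; rewrite mem_pblock c inE. Qed.

Lemma linsp_interval J x y (t : 'I_n) : is_linsp J -> y \in pblock J x -> (x <= t <= y)%N -> t \in pblock J x.
Proof.
move=> /andP[pJ /forallP h] yx xty; have /implyP/(_ _)/forallP := h (pblock J x).
move=> /(_ _ x)/implyP/(_ _)/forallP/(_ y)/implyP/(_ yx)/forallP/(_ t)/implyP; apply=> //.
  by case/and3P: pJ => /eqP c _ _; rewrite pblock_mem // c inE.
exact: mem_pblock_self.
Qed.

(** Blocks are intervals, so two points share a block iff all links between consecutive points from
    one to the other are present, and [gl] records these links. *)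
Lemma linsp_pblock J x y : is_linsp J -> (y \in pblock J x) = (bst (gl J) x == bst (gl J) y).
Proof.
move=> lJ; have pJ : partition J setT by case/andP: lJ.
wlog xy : x y / (x <= y)%N.
  move=> H; case/orP: (leq_total x y) => /H // h.
  by rewrite -pblock_sameE // eq_sym pblock_sameE // h eq_sym.
apply/idP/(bst_eqP _ xy) => [yx m /andP[xm my]|h].
  have mk : (m < n.-1)%N by have := ltn_ord y; lia.
  rewrite (_ : m = Ordinal mk) // glueE inE pblock_sameE //.
  have lx : lo (Ordinal mk) \in pblock J x by apply: linsp_interval yx _ => //=; rewrite xm ltnW.
  have hx : hi (Ordinal mk) \in pblock J x by apply: linsp_interval yx _ => //=; rewrite my leqW.
  rewrite -pblock_sameE // in lx; rewrite -pblock_sameE // in hx.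
  by rewrite -pblock_sameE // -(eqP lx) (eqP hx).
rewrite -pblock_sameE //; apply/eqP.
move: y xy h => [m hm] /=; elim: m hm => [|m IH] hm xy h.
  by congr pblock; apply: val_inj => /=; lia.
move: xy; rewrite leq_eqVlt => /orP[/eqP e|xm]; first by congr pblock; apply: val_inj.
have hm' : (m < n)%N by lia.
rewrite (IH hm') // => [|m' /andP[h1 h2]]; last by apply: h; rewrite h1 ltnW.
have mk : (m < n.-1)%N by lia.
have := h m; rewrite -[(x <= m)%N]ltnS xm ltnSn => /(_ isT).
have -> : glue (gl J) m = (Ordinal mk \in gl J) by rewrite -glueE.
rewrite inE => /eqP e.
have -> : Ordinal hm' = lo (Ordinal mk) by apply: val_inj.
by rewrite e; congr pblock; apply: val_inj.
Qed.

Lemma PK_gl J : is_linsp J -> PK (gl J) = J.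
Proof.
move=> lJ; have pJ : partition J setT by case/andP: lJ.
rewrite -[RHS](equivalence_partition_pblock pJ) /PK /preim_partition /equivalence_partition.
apply: eq_imset => x; apply/setP => y; rewrite !inE; exact/esym/linsp_pblock.
Qed.

Lemma linsp_PK L : is_linsp (PK L).
Proof.
rewrite /is_linsp PK_partition /=; apply/forall_inP => B BP.
apply/forall_inP => x xB; apply/forall_inP => y yB; apply/forallP => t; apply/implyP => /andP[xt ty].
have tI : trivIset (PK L) by case/and3P: (PK_partition L).
have eB := def_pblock tI BP xB; move: yB; rewrite -eB !mem_pblock_PK => /eqP e.
by rewrite eqn_leq bst_mono //= e bst_mono.
Qed.

Lemma lsp_le_PK K L : lsp_le (PK K) (PK L) = (K \subset L).
Proof.
have tK : trivIset (PK K) by case/and3P: (PK_partition K).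
have tL : trivIset (PK L) by case/and3P: (PK_partition L).
have cK : cover (PK K) = setT by case/and3P: (PK_partition K) => /eqP.
have cL : cover (PK L) = setT by case/and3P: (PK_partition L) => /eqP.
apply/forall_inP/subsetP => [h k kK|sKL B BL].
  have /h/eqP e : pblock (PK L) (lo k) \in PK L by rewrite pblock_mem // cL inE.
  have : lo k \in pblock (PK L) (lo k) by apply: mem_pblock_self; apply: PK_partition.
  rewrite {1}e => /bigcupP[C /andP[CK sC] kC].
  rewrite mem_K -mem_pblock_PK; apply: (subsetP sC).
  by rewrite -(def_pblock tK CK kC) mem_pblock_PK -mem_K.
rewrite eqEsubset; apply/andP; split; last by apply/bigcupsP => C /andP[].
apply/subsetP => x xB; apply/bigcupP; exists (pblock (PK K) x); last first.
  by apply: mem_pblock_self; apply: PK_partition.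
rewrite pblock_mem ?cK ?inE //=; apply/subsetP => y.
rewrite -(def_pblock tL BL xB) !mem_pblock_PK.
wlog xy : x y {xB} / (x <= y)%N.
  move=> H; case/orP: (leq_total x y) => [/H //|yx] e.
  by rewrite eq_sym; apply: H => //; rewrite eq_sym.
move/(bst_eqP _ xy) => h; apply/(bst_eqP _ xy) => m hm.
have mk : (m < n.-1)%N by have := ltn_ord y; lia.
by have := h m hm; rewrite (_ : m = Ordinal mk) // !glueE; apply: sKL.
Qed.

(** The points that do not open a block are the [hi k] with [k] in [L]. For [K] inside [L] this
    turns the difference of the numbers of blocks, the exponent of the sign in [bEI], into
    [#|L :\: K|]. *)
Lemma card_PK L : (#|PK L| + #|L| = n)%N.
Proof.
have hi_inj : injective (@hi n) by move=> k k' /(congr1 val) /= [] /val_inj.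
pose Fx := [set p : 'I_n | bst L p == p].
have e1 : ~: Fx = @hi n @: L.
  apply/setP => p; rewrite !inE; apply/idP/imsetP => [|[k kL ->]].
    case: p => [[|m] hm] //= np; have mk : (m < n.-1)%N by lia.
    exists (Ordinal mk); last by apply: val_inj.
    by move: np; rewrite -glueE /=; case: ifP => //; rewrite eqxx.
  by rewrite /= glueE kL; have := bst_le L k; lia.
have e2 : #|PK L| = #|Fx|.
  pose cl x := [set y in [set: 'I_n] | bst L x == bst L y].
  have ci : {in Fx &, injective cl}.
    move=> x y; rewrite !inE => /eqP fx /eqP fy /setP/(_ y); rewrite !inE /= eqxx.
    by rewrite fx fy => /eqP /val_inj.
  rewrite -(card_in_imset ci); apply: eq_card => B; apply/imsetP/imsetP => -[x _ ->].
    have bn : (bst L x < n)%N by apply: leq_ltn_trans (bst_le L x) (ltn_ord x).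
    exists (Ordinal bn); first by rewrite inE /= bst_idem.
    by apply/setP => y; rewrite !inE /= bst_idem.
  by exists x; rewrite ?inE.
rewrite e2 -(card_imset _ hi_inj) -e1; have := cardsC Fx; by rewrite card_ord.
Qed.

Variables (S : comUnitAlgType CC) (A : algType S) (e : nat -> A).

Lemma EJ_gl J : partition J setT -> EJ e J = \prod_(k < n.-1 | k \in gl J) e k.+1.
Proof.
move=> pJ; transitivity (\prod_(i < n | glue (gl J) i) e i.+1).
  apply: eq_bigl => i; apply/existsP/existsP => [[j /andP[/eqP ej pij]]|[k /andP[/eqP ek]]].
    have hk : (i < n.-1)%N by have := ltn_ord j; move: ej => /=; lia.
    exists (Ordinal hk); rewrite eqxx inE /=.
    have -> : lo (Ordinal hk) = i by apply: val_inj.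
    by have -> : hi (Ordinal hk) = j by apply: val_inj.
  rewrite inE => pk; exists (hi k); rewrite /= ek eqxx /=.
  by have <- : lo k = i by apply: val_inj.
rewrite (prod_ord_pred (P := glue (gl J)) (fun i => e i.+1)); last by apply/existsP => -[k /andP[/eqP ek _]]; have := ltn_ord k; lia.
by apply: eq_bigl => k; rewrite glueE.
Qed.

Lemma EK_expand K : EK e K =
  \sum_(L : {set 'I_n.-1} | K \subset L) (-1) ^+ #|L :\: K| * \prod_(k < n.-1 | k \in L) e k.+1.
Proof.
pose F (k : 'I_n.-1) : A := if k \in K then e k.+1 else - e k.+1.
pose G (k : 'I_n.-1) : A := if k \in K then 0 else 1.
have -> : EK e K = \prod_k (F k + G k).
  by apply: eq_bigr => k _; rewrite /Efac /F /G; case: ifP => _; rewrite ?addr0 // addrC.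
rewrite bigA_distr (bigID (fun L : {set 'I_n.-1} => K \subset L)) /= [X in _ + X]big1 ?addr0; last first.
  move=> L /subsetPn[k kK kL].
  have : k \in index_enum 'I_n.-1 by rewrite mem_index_enum.
  elim: (index_enum _) => [//|a r IH]; rewrite inE big_cons => /orP[/eqP <-|/IH ->].
    by rewrite (negbTE kL) /G kK mul0r.
  by rewrite mulr0.
apply: eq_bigr => L sKL.
rewrite [in RHS]big_mkcond /= -sum1_card big_mkcond /=.
elim: (index_enum _) => [|a r IH]; first by rewrite !big_nil expr0 mul1r.
rewrite !big_cons IH in_setD; case: (boolP (a \in L)) => aL.
  rewrite /F; case: (boolP (a \in K)) => aK /=; first by rewrite ?add0n mulrA (commr_sign (e _)) -mulrA.
  by rewrite exprS mulN1r !mulNr mulrA (commr_sign (e _)) -mulrA.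
by rewrite andbF ?add0n /G (negbTE (contra (subsetP sKL a) aL)) !mul1r.
Qed.

Lemma bEI_PK K : bEI e (PK K) = EK e K.
Proof.
rewrite EK_expand /bEI (reindex_onto PK gl) /=; last by move=> J /andP[lJ _]; apply: PK_gl.
apply: eq_big => [L|L /andP[/andP[_ le] _]].
  by rewrite linsp_PK lsp_le_PK gl_PK eqxx andbT.
rewrite lsp_le_PK in le; rewrite EJ_gl ?PK_partition // gl_PK; congr (_ ^+ _ * _).
rewrite cardsD (setIidPr le); have := card_PK K; have := card_PK L; have := subset_leq_card le.
move: #|PK K| #|PK L| #|K| #|L|; lia.
Qed.
End LinearPartitions.

(** * Multipartitions and multitableaux *)

Section FlattenIndex.
Local Open Scope nat_scope.
Implicit Types (sh : seq nat) (a i j r c : nat).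
Notation ri := reshape_index.
Notation ro := reshape_offset.
Notation fi := flatten_index.

(** Translates row indices into partial sums, the form in which dominance is stated. *)
Lemma ri_lt sh i j : i < sumn sh -> (ri sh i < j) = (i < sumn (take j sh)).
Proof.
move=> lt; have hr := reshape_indexP lt; have ho := reshape_offsetP lt.
have e := reshape_indexK sh i; rewrite -{2}e /fi.
have tk m m' : m <= m' -> sumn (take m sh) <= sumn (take m' sh).
  by move=> mm; rewrite -(subnKC mm) takeD sumn_cat leq_addr.
have eS : sumn (take (ri sh i).+1 sh) = sumn (take (ri sh i) sh) + nth 0 sh (ri sh i).
  by rewrite (take_nth 0 hr) -cats1 sumn_cat /= addn0.
apply/idP/idP => [/tk|]; first by lia.
by apply: contraTT; rewrite -!leqNgt => /tk; lia.
Qed.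

Lemma ri_mono sh i j : i <= j -> j < sumn sh -> ri sh i <= ri sh j.
Proof.
move=> ij lt; rewrite leqNgt; apply/negP; rewrite ri_lt // => h.
have := ri_lt (ri sh i) (leq_ltn_trans ij lt); rewrite ltnn => /esym/negbT/negP[].
exact: leq_ltn_trans ij h.
Qed.

Lemma ri_rcons sh a i : i < sumn sh + a ->
  ri (rcons sh a) i = if i < sumn sh then ri sh i else size sh.
Proof.
move=> lt; case: ifP => hi.
  have hr := reshape_indexP hi; have ho := reshape_offsetP hi.
  have e : fi (rcons sh a) (ri sh i) (ro sh i) = i.
    by rewrite -[RHS](reshape_indexK sh) /fi -cats1 takel_cat // ltnW.
  have h : ro sh i < nth 0 (rcons sh a) (ri sh i) by rewrite nth_rcons hr.
  by have := flatten_indexKl h; rewrite e.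
have e : fi (rcons sh a) (size sh) (i - sumn sh) = i.
  by rewrite /fi -cats1 take_size_cat // subnKC // leqNgt hi.
have h : i - sumn sh < nth 0 (rcons sh a) (size sh) by rewrite nth_rcons ltnn eqxx; lia.
by have := flatten_indexKl h; rewrite e.
Qed.

Definition rstart sh i := sumn (take (ri sh i) sh).

Lemma rstart_rcons sh a i : i < sumn sh + a ->
  rstart (rcons sh a) i = if i < sumn sh then rstart sh i else sumn sh.
Proof.
move=> lt; rewrite /rstart ri_rcons //; case: ifP => hi; last by rewrite -cats1 take_size_cat.
by rewrite -cats1 takel_cat // ltnW // reshape_indexP.
Qed.

Lemma ri_cons a sh i : ri (a :: sh) i = if i < a then 0 else (ri sh (i - a)).+1.
Proof.
rewrite /ri /= subn_eq0; case: ltnP => // h; by rewrite subSn.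
Qed.

Lemma ri_inj sh sh' : all (ltn 0) sh -> all (ltn 0) sh' -> sumn sh = sumn sh' ->
  (forall i, i < sumn sh -> ri sh i = ri sh' i) -> sh = sh'.
Proof.
elim: sh sh' => [|a sh IH] [|a' sh'] //=; try by move=> *; lia.
move=> /andP[a0 p] /andP[a'0 p'] e h; have ea : a = a'.
  case: (ltngtP a a') => // lt.
    have /h : a < a + sumn sh by lia.
    by rewrite !ri_cons ltnn lt.
  have /h : a' < a + sumn sh by lia.
  by rewrite !ri_cons ltnn lt.
subst a'; congr cons; apply: IH => //; first lia.
move=> i lt; have /h : a + i < a + sumn sh by lia.
by rewrite !ri_cons ltnNge leq_addr /= addKn => -[].
Qed.

Lemma rstart_cons a sh i : rstart (a :: sh) i = if i < a then 0 else a + rstart sh (i - a).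
Proof. by rewrite /rstart ri_cons; case: ifP. Qed.

Lemma rstart_inj sh sh' : all (ltn 0) sh -> all (ltn 0) sh' -> sumn sh = sumn sh' ->
  (forall i, i < sumn sh -> rstart sh i = rstart sh' i) -> sh = sh'.
Proof.
elim: sh sh' => [|a sh IH] [|a' sh'] //=; try by move=> *; lia.
move=> /andP[a0 p] /andP[a'0 p'] e h; have ea : a = a'.
  case: (ltngtP a a') => // lt.
    have /h : a < a + sumn sh by lia.
    by rewrite !rstart_cons ltnn lt; lia.
  have /h : a' < a + sumn sh by lia.
  by rewrite !rstart_cons ltnn lt; lia.
subst a'; congr cons; apply: IH => //; first lia.
move=> i lt; have /h : a + i < a + sumn sh by lia.
by rewrite !rstart_cons ltnNge leq_addr /= addKn; lia.
Qed.

Lemma rstart_rows (b : nat -> nat) m : (forall i, b i <= i) -> (forall i, b (b i) = b i) ->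
  (forall i j, i <= j -> b i <= b j) ->
  exists sh, [/\ all (ltn 0) sh, sumn sh = m & forall i, i < m -> rstart sh i = b i].
Proof.
move=> b1 b2 b3; have [N] := ubnP m; elim: N m => // N IH [|m] lt; first by exists [::].
have bm := b1 m; have [sh [p s h]] : exists sh, [/\ all (ltn 0) sh, sumn sh = b m & forall i, i < b m -> rstart sh i = b i].
  by apply: IH; lia.
exists (rcons sh (m.+1 - b m)); split.
- by rewrite all_rcons p andbT /=; lia.
- by rewrite sumn_rcons s; lia.
move=> i im; rewrite rstart_rcons ?s; last by lia.
case: ifP => [/h //|hi]; apply/eqP; rewrite eqn_leq [X in _ && X]b3 ?andbT; last by lia.
by rewrite -{1}(b2 m) b3 // leqNgt hi.
Qed.

Lemma ri_rows (g : nat -> nat) m : g 0 = 0 -> (forall i, i.+1 < m -> g i <= g i.+1 <= (g i).+1) ->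
  exists sh, [/\ all (ltn 0) sh, sumn sh = m, (0 < m -> size sh = (g m.-1).+1) & forall i, i < m -> ri sh i = g i].
Proof.
move=> g0; have [N] := ubnP m; elim: N m => // N IH [|m] lt gs.
  by exists [::]; split.
have ex : exists o, g o == g m by exists m.
(* [o] is the position where the last row begins. *)
have [o [eo om omin]] : exists o, [/\ g o = g m, o <= m & forall j, g j = g m -> o <= j].
  case: (ex_minnP ex) => o /eqP eo h; exists o; split=> // [|j /eqP]; last exact: h.
  by apply: h.
have mono i j : i <= j -> j <= m -> g i <= g j.
  elim: j => [|j IHj]; first by rewrite leqn0 => /eqP->.
  rewrite leq_eqVlt => /orP[/eqP->//|]; rewrite ltnS => /IHj h jm.
  by apply: leq_trans (h (ltnW jm)) _; case/andP: (gs j jm).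
have [sh [p s ss h]] : exists sh, [/\ all (ltn 0) sh, sumn sh = o, (0 < o -> size sh = (g o.-1).+1) & forall i, i < o -> ri sh i = g i].
  by apply: IH => [|i io]; [lia|apply: gs; lia].
have size_sh : size sh = g m.
  rewrite -eo; case: (posnP o) => [o0|o0].
    by rewrite o0 g0; case: (sh) p s => [//|b s'] /= /andP[]; lia.
  have oS : o.-1.+1 = o by lia.
  rewrite ss //; have := gs o.-1; rewrite oS => h1; have /h1/andP[h2 h3] : o < m.+1 by lia.
  have ne : g o.-1 != g o.
    by apply/eqP => e1; have := omin o.-1; rewrite e1 eo => /(_ erefl); lia.
  lia.
exists (rcons sh (m.+1 - o)); split.
- by rewrite all_rcons p andbT /=; lia.
- by rewrite sumn_rcons s; lia.
- by rewrite size_rcons size_sh.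
move=> i im; rewrite ri_rcons ?s; last by lia.
case: ifP => [/h //|hi]; rewrite size_sh; apply/eqP; rewrite eqn_leq (mono i m) // andbT -eo; apply: mono; lia.
Qed.
End FlattenIndex.

Section Multipartition.
Local Open Scope nat_scope.
Variables (n : nat) (la : seq (seq nat)).
Notation comp := Defs.comp.
Notation ri := reshape_index.
Notation ro := reshape_offset.
Notation fi := flatten_index.
Notation row k := (nth [::] la k).
Implicit Types (p : 'I_n) (k r j : nat) (d w : 'S_n).

Definition compof (p : nat) := ri (comp la) p.
Definition compoff (p : nat) := ro (comp la) p.
Definition rw (p : nat) := ri (row (compof p)) (compoff p).
Definition colof (p : nat) := ro (row (compof p)) (compoff p).
Definition lab (p : nat) := fi (comp la) (compof p) (rw p).
Definition pos k r j := fi (comp la) k (fi (row k) r j).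
Definition Klam : {set 'I_n.-1} := [set k : 'I_n.-1 | compof (lo k) == compof (hi k)].
(* [insubd] never uses its default here: see [lab_lt]. *)
Definition pilam : {ffun 'I_n -> 'I_n} := [ffun p : 'I_n => insubd p (lab p)].

Hypothesis hla : is_mpart n la.

Lemma sumn_pos s : s != [::] -> all (ltn 0) s -> 0 < sumn s.
Proof. by case: s => [//|a s] _ /= /andP[a0 _]; rewrite addn_gt0 a0. Qed.

Lemma mp_part k : k < size la -> is_part (row k).
Proof. by move=> h; case/andP: hla => /all_nthP H _; apply: H. Qed.

Lemma mp_row_pos k : all (ltn 0) (row k).
Proof. by case: (ltnP k (size la)) => [/mp_part/and3P[]//|h]; rewrite nth_default. Qed.

Lemma mp_sum : sumn (comp la) = n. Proof. by case/andP: hla => _ /eqP. Qed.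

Lemma nth_comp k : nth 0 (comp la) k = sumn (row k).
Proof.
case: (ltnP k (size la)) => h; first by rewrite /comp (nth_map [::]).
by rewrite !nth_default // size_map.
Qed.

Lemma mp_comp_pos : all (ltn 0) (comp la).
Proof.
apply/(all_nthP 0) => k; rewrite size_map => h; rewrite nth_comp.
by apply: sumn_pos (mp_row_pos k); case/and3P: (mp_part h).
Qed.

Lemma size_row k : size (row k) <= sumn (row k).
Proof.
by have := mp_row_pos k; elim: (row k) => [//|a s IH] /= /andP[a0 /IH h]; lia.
Qed.

Section Position.
Variable p : nat.
Hypothesis pn : p < n.
Lemma compof_lt : compof p < size la.
Proof. by rewrite -(size_map sumn la); apply: reshape_indexP; rewrite mp_sum. Qed.
Lemma compoff_lt : compoff p < sumn (row (compof p)).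
Proof. by rewrite -nth_comp; apply: reshape_offsetP; rewrite mp_sum. Qed.
Lemma rw_lt : rw p < size (row (compof p)).
Proof. exact/reshape_indexP/compoff_lt. Qed.
Lemma colof_lt : colof p < nth 0 (row (compof p)) (rw p).
Proof. exact/reshape_offsetP/compoff_lt. Qed.
Lemma posK : pos (compof p) (rw p) (colof p) = p.
Proof. by rewrite /pos /rw /colof reshape_indexK reshape_indexK. Qed.
(** A component has no more rows than boxes, so the label of a row is a position inside the same
    component, from which component and row can be read off again. *)
Lemma rw_lt_comp : rw p < nth 0 (comp la) (compof p).
Proof. rewrite nth_comp; exact: leq_trans rw_lt (size_row _). Qed.
Lemma lab_lt : lab p < n.
Proof. by rewrite -mp_sum; apply: flatten_indexP; apply: rw_lt_comp. Qed.
Lemma compof_lab : compof (lab p) = compof p.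
Proof. exact: (flatten_indexKl rw_lt_comp). Qed.
Lemma compoff_lab : compoff (lab p) = rw p.
Proof. exact: (flatten_indexKr rw_lt_comp). Qed.
End Position.

Section Cell.
Variables (k r j : nat).
Hypothesis hj : j < nth 0 (row k) r.
Lemma fi_lt : fi (row k) r j < nth 0 (comp la) k.
Proof. by rewrite nth_comp; apply: flatten_indexP. Qed.
Lemma pos_lt : pos k r j < n.
Proof. by rewrite -mp_sum; apply: flatten_indexP; apply: fi_lt. Qed.
Lemma compof_pos : compof (pos k r j) = k.
Proof. exact: (flatten_indexKl fi_lt). Qed.
Lemma compoff_pos : compoff (pos k r j) = fi (row k) r j.
Proof. exact: (flatten_indexKr fi_lt). Qed.
Lemma rw_pos : rw (pos k r j) = r.
Proof. by rewrite /rw compof_pos compoff_pos flatten_indexKl. Qed.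
Lemma colof_pos : colof (pos k r j) = j.
Proof. by rewrite /colof compof_pos compoff_pos flatten_indexKr. Qed.
End Cell.

Lemma pilamE p : val (pilam p) = lab p.
Proof. by rewrite ffunE val_insubd lab_lt. Qed.

Lemma pilam_eqE p p' : (pilam p == pilam p') = (compof p == compof p') && (rw p == rw p').
Proof.
rewrite -val_eqE !pilamE; apply/eqP/andP => [e|[/eqP e1 /eqP e2]]; last by rewrite /lab e1 e2.
by rewrite -(compof_lab (ltn_ord p)) -(compoff_lab (ltn_ord p)) e compof_lab // compoff_lab // !eqxx.
Qed.

Lemma compof_mono (p p' : nat) : p <= p' -> p' < n -> compof p <= compof p'.
Proof. by move=> h hn; apply: ri_mono; rewrite ?mp_sum. Qed.

Lemma compoff_E (p : nat) : p = rstart (comp la) p + compoff p.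
Proof. by rewrite /compoff -[LHS](reshape_indexK (comp la)). Qed.

Lemma bst_Klam (p : nat) : p < n -> bst Klam p = rstart (comp la) p.
Proof.
elim: p => [|p IH] hp; first by rewrite /=; have := compoff_E 0; lia.
have kp : p < n.-1 by lia.
have -> : bst Klam p.+1 = if Ordinal kp \in Klam then bst Klam p else p.+1 by rewrite -glueE.
rewrite inE /= IH ?(ltnW hp) //; case: eqP => [e|ne]; first by rewrite /rstart -/(compof p) e.
have [o0|o1] := posnP (compoff p.+1); first by have := compoff_E p.+1; rewrite o0 addn0.
case: ne; have lt := compoff_lt hp; have e : fi (comp la) (compof p.+1) (compoff p.+1).-1 = p.
  by have := compoff_E p.+1; rewrite /fi /rstart -/(compof p.+1); lia.
by rewrite /compof -{1}e flatten_indexKl // nth_comp; lia.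
Qed.

Lemma bst_Klam_eq p p' : (bst Klam p == bst Klam p') = (compof p == compof p').
Proof.
rewrite !bst_Klam //; apply/eqP/eqP => [e|e]; last by rewrite /rstart -/(compof p) e.
have h m : m < n -> compof (rstart (comp la) m) = compof m.
  move=> hm; have -> : rstart (comp la) m = fi (comp la) (compof m) 0 by rewrite /fi addn0.
  by rewrite /compof flatten_indexKl // nth_comp; apply: leq_ltn_trans (compoff_lt hm).
by rewrite -(h p) // e h.
Qed.

Lemma pilam_cpt : cpt Klam pilam.
Proof. by move=> p; apply/eqP; rewrite bst_Klam_eq pilamE compof_lab. Qed.

Lemma pilam_ndec : ndec pilam.
Proof.
move=> p p' pp; rewrite [X in X <= _]pilamE [X in _ <= X]pilamE.
have := compof_mono pp (ltn_ord p'); rewrite leq_eqVlt => /orP[/eqP e|lt].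
  rewrite /lab e /fi leq_add2l /rw e; apply: ri_mono; last exact: compoff_lt.
  by have := compoff_E p; have := compoff_E p'; rewrite /rstart -/(compof p) -/(compof p') e; lia.
rewrite leqNgt; apply/negP => /ltnW /compof_mono; rewrite !compof_lab // => /(_ (lab_lt (ltn_ord p))).
by rewrite leqNgt lt.
Qed.

Lemma nth_tlam k : k < size la ->
  nth [::] (tlam la) k = reshape (row k) (iota (offset la k).+1 (sumn (row k))).
Proof. by move=> h; rewrite /tlam (nth_map 0) ?size_iota // nth_iota. Qed.

Lemma size_tlam : size (tlam la) = size la.
Proof. by rewrite size_map size_iota. Qed.

Lemma posE k r j : pos k r j = pos k r 0 + j.
Proof. by rewrite /pos /fi addn0 !addnA. Qed.

Lemma tlam_row k r : k < size la -> r < size (row k) ->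
  nth [::] (nth [::] (tlam la) k) r = iota (pos k r 0).+1 (nth 0 (row k) r).
Proof.
move=> hk hr; rewrite nth_tlam // nth_reshape drop_iota take_iota.
have -> : minn (nth 0 (row k) r) (sumn (row k) - sumn (take r (row k))) = nth 0 (row k) r.
  apply/minn_idPl; have := ri_lt; rewrite -{2}(cat_take_drop r (row k)) sumn_cat addKn.
  by rewrite (drop_nth 0 hr) /= leq_addr.
by rewrite /pos /fi /offset addn0 addSn.
Qed.

Lemma size_tlam_comp k : k < size la -> size (nth [::] (tlam la) k) = size (row k).
Proof. by move=> hk; rewrite nth_tlam // size_reshape. Qed.

Lemma flatten_tlam_comp k : k < size la ->
  flatten (nth [::] (tlam la) k) = iota (offset la k).+1 (sumn (row k)).
Proof. by move=> hk; rewrite nth_tlam // reshapeKr // size_iota. Qed.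

Lemma mshape_tlam : mshape (tlam la) = la.
Proof.
apply: (@eq_from_nth _ [::]); first by rewrite size_map size_tlam.
move=> k; rewrite size_map size_tlam => hk.
by rewrite (nth_map [::]) ?size_tlam // nth_tlam // -/(shape _) reshapeKl // size_iota.
Qed.

Lemma flat_tlam : flatten (map flatten (tlam la)) = iota 1 n.
Proof.
have -> : map flatten (tlam la) = reshape (comp la) (iota 1 n).
  apply: (@eq_from_nth _ [::]); first by rewrite size_map size_tlam size_reshape size_map.
  move=> k; rewrite size_map size_tlam => hk.
  rewrite (nth_map [::]) ?size_tlam // flatten_tlam_comp // nth_reshape drop_iota take_iota nth_comp.
  have -> : minn (sumn (row k)) (n - sumn (take k (comp la))) = sumn (row k).
    apply/minn_idPl; rewrite -mp_sum -{1}(cat_take_drop k (comp la)) sumn_cat addKn.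
    by rewrite (drop_nth 0) ?size_map //= nth_comp leq_addr.
  by [].
by rewrite reshapeKr // mp_sum size_iota.
Qed.

Lemma act_entryE d p : act_entry d p.+1 = (d p).+1.
Proof. by rewrite /act_entry /= valK. Qed.

Lemma act_entry_inj d : {in iota 1 n &, injective (act_entry d)}.
Proof.
move=> x y; rewrite !mem_iota !add1n !ltnS => /andP[x0 xn] /andP[y0 yn].
have hx : x.-1 < n by lia.
have hy : y.-1 < n by lia.
have -> : x = (Ordinal hx).+1 by rewrite /=; lia.
have -> : y = (Ordinal hy).+1 by rewrite /=; lia.
by rewrite !act_entryE => -[] /val_inj/perm_inj ->.
Qed.

(** Rows and components of [tlam la] hold consecutive entries, so both the row stabilizer and the
    initial kind come down to the invariance of an interval. *)
Lemma perm_act_iota d a m : a + m <= n ->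
  reflect (forall p, a <= p < a + m -> a <= d p < a + m)
    (perm_eq (map (act_entry d) (iota a.+1 m)) (iota a.+1 m)).
Proof.
move=> am; have ment p : (p.+1 \in iota a.+1 m) = (a <= p < a + m) by rewrite mem_iota addSn !ltnS.
apply: (iffP idP) => [pe p hp|h].
  by rewrite -ment -(perm_mem pe) -act_entryE map_f // ment.
have sub : {subset iota a.+1 m <= iota 1 n} by move=> x; rewrite !mem_iota; lia.
have u : uniq (map (act_entry d) (iota a.+1 m)).
  rewrite map_inj_in_uniq ?iota_uniq // => x y /sub hx /sub hy; exact: act_entry_inj.
have s : {subset map (act_entry d) (iota a.+1 m) <= iota a.+1 m}.
  move=> _ /mapP[x hx ->]; have := hx; rewrite mem_iota => hx'.
  have xn : x.-1 < n by lia.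
  have ex : x = (Ordinal xn).+1 by rewrite /=; lia.
  by rewrite ex act_entryE ment; apply: h; rewrite /=; lia.
have [_ e] := uniq_min_size u s (eq_leq (esym (size_map _ _))).
by apply: uniq_perm e; rewrite ?iota_uniq.
Qed.

Lemma row_interval k r (p : nat) : r < size (row k) -> p < n ->
  (pos k r 0 <= p < pos k r 0 + nth 0 (row k) r) = (compof p == k) && (rw p == r).
Proof.
move=> hr pn; apply/idP/andP => [/andP[h1 h2]|[/eqP<- /eqP<-]].
  have hj : p - pos k r 0 < nth 0 (row k) r by lia.
  have -> : p = pos k r (p - pos k r 0) by rewrite posE subnKC.
  by rewrite compof_pos // rw_pos // !eqxx.
by have := colof_lt pn; have := posK p; rewrite posE; lia.
Qed.

Lemma row_end k r : k < size la -> r < size (row k) -> pos k r 0 + nth 0 (row k) r <= n.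
Proof.
move=> hk hr; have r0 : 0 < nth 0 (row k) r by apply: (allP (mp_row_pos k)); apply: mem_nth.
have hj : (nth 0 (row k) r).-1 < nth 0 (row k) r by lia.
by have := pos_lt hj; rewrite posE; lia.
Qed.

Lemma all2_map (T : Type) (P : T -> T -> bool) (f : T -> T) s :
  all2 P s (map f s) = all (fun x => P x (f x)) s.
Proof. by elim: s => //= x s ->. Qed.

Lemma rowstabE w : (w \in rowstab n la) = [forall p, pilam (w p) == pilam p].
Proof.
rewrite inE /tab_act all2_map.
apply/(all_nthP [::])/forallP => [h p|h k].
  have hk := compof_lt (ltn_ord p); have hr := rw_lt (ltn_ord p).
  have := h (compof p); rewrite size_tlam => /(_ hk); rewrite all2_map => /(all_nthP [::])/(_ (rw p)).
  rewrite size_tlam_comp // => /(_ hr); rewrite tlam_row // perm_sym => /perm_act_iota.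
  move=> /(_ (row_end hk hr) p); rewrite !row_interval // !eqxx => /(_ isT).
  by rewrite pilam_eqE.
rewrite size_tlam => hk; rewrite all2_map; apply/(all_nthP [::]) => r; rewrite size_tlam_comp // => hr.
rewrite tlam_row // perm_sym; apply/perm_act_iota; first exact: row_end.
by move=> p; rewrite !row_interval // => /andP[/eqP <- /eqP <-]; rewrite -pilam_eqE.
Qed.

Lemma nth_map_tlam (f : nat -> nat) k :
  nth [::] (map (map (map f)) (tlam la)) k = map (map f) (nth [::] (tlam la) k).
Proof.
case: (ltnP k (size (tlam la))) => h; first by rewrite (nth_map [::]).
by rewrite !nth_default // size_map.
Qed.

Definition ent (T : mtab) k r j := nth 0 (nth [::] (nth [::] T k) r) j.

Lemma tab_act_row d k r : k < size la -> r < size (row k) ->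
  nth [::] (nth [::] (tab_act (tlam la) d) k) r =
  map (act_entry d) (iota (pos k r 0).+1 (nth 0 (row k) r)).
Proof.
move=> hk hr; rewrite /tab_act nth_map_tlam (nth_map [::]) ?size_tlam_comp //.
by rewrite tlam_row.
Qed.

Lemma entE d p k r j : j < nth 0 (row k) r -> p = pos k r j :> nat ->
  ent (tab_act (tlam la) d) k r j = (d p).+1.
Proof.
move=> hj ep; have pn := ltn_ord p.
have hk : k < size la by rewrite -(compof_pos hj) -ep; apply: compof_lt.
have hr : r < size (row k).
  by have := rw_lt pn; rewrite ep compof_pos // rw_pos.
rewrite /ent tab_act_row // (nth_map 0) ?size_iota // nth_iota // addSn -posE -ep.
exact: act_entryE.
Qed.

Lemma size_tab_act d : size (tab_act (tlam la) d) = size la.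
Proof. by rewrite size_map size_tlam. Qed.

Lemma size_tab_act_comp d k : k < size la -> size (nth [::] (tab_act (tlam la) d) k) = size (row k).
Proof. by move=> hk; rewrite /tab_act nth_map_tlam size_map size_tlam_comp. Qed.

Lemma mshape_act d T : mshape (tab_act T d) = mshape T.
Proof.
rewrite /mshape /tab_act -map_comp; apply: eq_map => c /=; rewrite -map_comp.
by apply: eq_map => r /=; rewrite size_map.
Qed.

Lemma flat_act d (T : mtab) :
  flatten (map flatten (tab_act T d)) = map (act_entry d) (flatten (map flatten T)).
Proof.
rewrite map_flatten /tab_act -!map_comp; congr flatten; apply: eq_map => c /=.
by rewrite map_flatten.
Qed.

Lemma mtab_eq (T T' : mtab) : mshape T = mshape T' ->
  flatten (map flatten T) = flatten (map flatten T') -> T = T'.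
Proof.
elim: T T' => [|c T IH] [|c' T'] //= [e1 e2] e3.
have es : size (flatten c) = size (flatten c') by rewrite !size_flatten /shape e1.
have /eqP : flatten c ++ flatten (map flatten T) = flatten c' ++ flatten (map flatten T') by [].
rewrite eqseq_cat // => /andP[/eqP f1 /eqP f2]; rewrite (IH _ e2 f2); congr cons.
exact: eq_from_flatten_shape.
Qed.

Lemma tab_act_inj d d' : tab_act (tlam la) d = tab_act (tlam la) d' -> d = d'.
Proof.
move=> /(congr1 (fun T : mtab => flatten (map flatten T))); rewrite !flat_act flat_tlam => /eq_in_map h.
apply/permP => p; apply: val_inj; apply: succn_inj; rewrite -!act_entryE; apply: h.
by rewrite mem_iota add1n !ltnS /=.
Qed.

Lemma dperm_act d : dperm n la (tab_act (tlam la) d) = d.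
Proof.
rewrite /dperm; case: pickP => [w /eqP/tab_act_inj //|/(_ d)]; by rewrite eqxx.
Qed.

Definition colstd d := forall k r (p p' : 'I_n), compof p = k -> compof p' = k -> rw p = r -> rw p' = r.+1 ->
  colof p = colof p' -> d p < d p'.

Lemma mp_row_le k r : nth 0 (row k) r.+1 <= nth 0 (row k) r.
Proof.
case: (ltnP k (size la)) => [/mp_part/and3P[_ s _]|h]; last by rewrite (nth_default _ h) !nth_nil.
case: (ltnP r.+1 (size (row k))) => h; last by rewrite (nth_default 0 h).
by have /(sortedP 0)/(_ r h) := s.
Qed.

Lemma tab_standard d : is_standard (tab_act (tlam la) d) <-> rowinc pilam d /\ colstd d.
Proof.
split=> [/(all_nthP [::]) st|[ri_d cs]].
  have stk k : k < size la -> comp_standard (nth [::] (tab_act (tlam la) d) k).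
    by move=> hk; apply: st; rewrite size_tab_act.
  split=> [p p' pp /eqP|k r p p' ck ck' hr hr' hc].
    rewrite pilam_eqE => /andP[/eqP ck /eqP rk].
    have hk := compof_lt (ltn_ord p); have hr := rw_lt (ltn_ord p).
    have /andP[/(all_nthP [::])/(_ (rw p)) hrow _] := stk _ hk.
    have := hrow; rewrite size_tab_act_comp // => /(_ hr).
    move/(sorted_ltn_nth ltn_trans 0) => /(_ (colof p) (colof p')).
    rewrite tab_act_row // !inE size_map size_iota colof_lt // ck rk colof_lt //.
    have ecl : colof p < colof p' by have := posK p; have := posK p'; rewrite !(posE _ _ (colof _)) -ck -rk; lia.
    move=> /(_ isT isT ecl).
    have e1 : ent (tab_act (tlam la) d) (compof p) (rw p) (colof p) = (d p).+1.
      by apply: entE; rewrite ?posK //; apply: colof_lt.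
    have e2 : ent (tab_act (tlam la) d) (compof p) (rw p) (colof p') = (d p').+1.
      by apply: entE; rewrite ?ck ?rk ?posK //; apply: colof_lt.
    by rewrite /ent tab_act_row // in e1 e2; rewrite ck rk in e1 e2; rewrite e1 e2 ltnS.
  have hk := compof_lt (ltn_ord p); rewrite ck in hk.
  have hr1 := rw_lt (ltn_ord p'); rewrite ck' hr' in hr1.
  have hc1 := colof_lt (ltn_ord p'); rewrite ck' hr' in hc1.
  have hc2 := colof_lt (ltn_ord p); rewrite ck hr in hc2.
  have /andP[_ /allP hcol] := stk _ hk.
  have := hcol r; rewrite mem_iota size_tab_act_comp // => h0.
  have /h0/allP : 0 <= r < 0 + (size (row k)).-1 by lia.
  move=> /(_ (colof p')); rewrite mem_iota tab_act_row // size_map size_iota => h1.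
  have /h1 : 0 <= colof p' < 0 + nth 0 (row k) r.+1 by lia.
  have e1 : ent (tab_act (tlam la) d) k r (colof p') = (d p).+1.
    by apply: entE; rewrite -?hc // -ck -hr posK.
  have e2 : ent (tab_act (tlam la) d) k r.+1 (colof p') = (d p').+1.
    by apply: entE; rewrite // -ck' -hr' posK.
  by rewrite /ent in e1 e2; rewrite -tab_act_row // e1 e2 ltnS.
apply/(all_nthP [::]) => k; rewrite size_tab_act => hk; apply/andP; split.
  apply/(all_nthP [::]) => r; rewrite size_tab_act_comp // => hr.
  apply/(sortedP 0) => j; rewrite [in X in X -> _]tab_act_row // size_map size_iota => hj.
  have hj' := ltnW hj.
  change (ent (tab_act (tlam la) d) k r j < ent (tab_act (tlam la) d) k r j.+1).
  rewrite (@entE _ (Ordinal (pos_lt hj')) _ _ _ hj') // (@entE _ (Ordinal (pos_lt hj)) _ _ _ hj) // ltnS.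
  apply: ri_d; first by rewrite /= posE [X in _ < X]posE; lia.
  by apply/eqP; rewrite pilam_eqE /= !compof_pos // !rw_pos // !eqxx.
apply/allP => r; rewrite mem_iota size_tab_act_comp // => hr.
have hr1 : r.+1 < size (row k) by lia.
apply/allP => j; rewrite mem_iota tab_act_row // size_map size_iota add0n => /andP[_ hj].
have hj' : j < nth 0 (row k) r by apply: leq_trans hj (mp_row_le k r).
rewrite -tab_act_row // -/(ent _ k r j) -/(ent _ k r.+1 j).
rewrite (@entE _ (Ordinal (pos_lt hj')) _ _ _ hj') // (@entE _ (Ordinal (pos_lt hj)) _ _ _ hj) // ltnS.
by apply: (cs k r); rewrite /= ?compof_pos ?rw_pos ?colof_pos.
Qed.

Lemma comp_end k : k < size la -> offset la k + sumn (row k) <= n.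
Proof.
move=> hk; rewrite /offset -[X in _ <= X]mp_sum -[X in _ <= sumn X](cat_take_drop k) sumn_cat.
by rewrite (drop_nth 0) ?size_map //= nth_comp addnA leq_addr.
Qed.

Lemma comp_interval k p : (offset la k <= p < offset la k + sumn (row k)) = (compof p == k).
Proof.
apply/idP/eqP => [/andP[h1 h2]|<-].
  have e : fi (comp la) k (p - offset la k) = p by rewrite /fi subnKC.
  by rewrite /compof -e flatten_indexKl // nth_comp; lia.
by have := compoff_E p; have := compoff_lt (ltn_ord p); rewrite /offset /rstart -/(compof p); lia.
Qed.

Lemma tab_initial d : is_initial la (tab_act (tlam la) d) <-> d \in SK Klam.
Proof.
have e k : k < size la -> flatten (nth [::] (tab_act (tlam la) d) k) =
    map (act_entry d) (iota (offset la k).+1 (sumn (row k))).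
  by move=> hk; rewrite /tab_act nth_map_tlam -map_flatten flatten_tlam_comp.
split=> [/allP h|/SKP h].
  apply/SKP => p; apply/eqP; rewrite bst_Klam_eq; have hk := compof_lt (ltn_ord p).
  have := h (compof p); rewrite mem_iota hk => /(_ isT); rewrite e // flatten_tlam_comp //.
  move/(perm_act_iota _ (comp_end hk))/(_ p); by rewrite !comp_interval eqxx; apply.
apply/allP => k; rewrite mem_iota => hk; rewrite e // flatten_tlam_comp //.
apply/(perm_act_iota _ (comp_end hk)) => p; rewrite !comp_interval => /eqP <-.
by rewrite -bst_Klam_eq h.
Qed.

Lemma act_is_mtab d : is_mtab n la (tab_act (tlam la) d).
Proof.
rewrite /is_mtab mshape_act mshape_tlam eqxx flat_act flat_tlam /=.
by apply/perm_act_iota => // p _; rewrite /=.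
Qed.

Lemma mtab_act t : is_mtab n la t -> exists d, t = tab_act (tlam la) d.
Proof.
move=> /andP[/eqP sh pe]; set ft := flatten _ in pe.
have sz : size ft = n by rewrite (perm_size pe) size_iota.
have mem p : nth 0 ft p \in iota 1 n by rewrite -(perm_mem pe) mem_nth // sz.
have lt p : (nth 0 ft p).-1 < n by have := mem p; rewrite mem_iota; lia.
have inj : injective (fun p => Ordinal (lt p)).
  move=> p p' /(congr1 val) /= e; apply: val_inj; apply/eqP.
  rewrite -(nth_uniq 0 (s := ft)) ?(perm_uniq pe) ?iota_uniq ?sz ?ltn_ord //.
  move: (mem p) (mem p') e; rewrite !mem_iota /=; move: (nth 0 ft p) (nth 0 ft p') => a b.
  by move=> ha hb e; apply/eqP; lia.
exists (perm inj); apply: mtab_eq; first by rewrite mshape_act mshape_tlam sh.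
rewrite flat_act flat_tlam -/ft; apply: (@eq_from_nth _ 0); first by rewrite size_map size_iota.
move=> i; rewrite sz => hi; rewrite (nth_map 0) ?size_iota // nth_iota // add1n.
rewrite (act_entryE _ (Ordinal hi)) permE /=.
by have := mem (Ordinal hi); rewrite mem_iota /=; lia.
Qed.

Lemma rw_cl_pos k r j p : p = pos k r j :> nat -> j < nth 0 (row k) r ->
  [/\ compof p = k, rw p = r & colof p = j].
Proof. by move=> -> hj; rewrite compof_pos // rw_pos // colof_pos. Qed.

Lemma pcnt_perm d t v : pcnt (fun p => pilam ((d^-1)%g p)) t v = #|[set p | (d p < t) && (pilam p == v)]|.
Proof.
rewrite /pcnt -[RHS](card_imset _ (@perm_inj _ d)); apply: eq_card => p; rewrite inE.
apply/idP/imsetP => [h|[p' + ->]]; last by rewrite inE permK.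
by exists ((d^-1)%g p); rewrite ?permKV // inE permKV.
Qed.

(** Moving up one box in its column injects row [hi i] into row [lo i] and lowers the entry, hence
    respects every prefix. *)
Lemma colstd_lattice d : colstd d -> lattice Klam (fun p => pilam ((d^-1)%g p)).
Proof.
move=> cs i t iK; rewrite !pcnt_perm; have ei : compof (lo i) = compof (hi i) by move: iK; rewrite inE => /eqP.
pose ph (p : 'I_n) : 'I_n := insubd p (pos (compof p) (rw p).-1 (colof p)).
have key p : pilam p = hi i -> [/\ pilam (ph p) = lo i, d (ph p) < d p & compof (ph p) = compof p /\ (rw (ph p)).+1 = rw p /\ colof (ph p) = colof p].
  move=> ep; have ev : lab p = i.+1 by rewrite -pilamE ep.
  have ck : compof p = compof (hi i) by rewrite /= -ev compof_lab.
  have rk : rw p = compoff (hi i) by rewrite /= -ev compoff_lab.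
  have ro1 : rw p = (compoff (lo i)).+1.
    rewrite rk; have := compoff_E (hi i); have := compoff_E (lo i).
    by rewrite /rstart -/(compof (lo i)) -/(compof (hi i)) ei /=; lia.
  have hc : colof p < nth 0 (row (compof p)) (rw p).-1.
    by apply: leq_trans (colof_lt (ltn_ord p)) _; rewrite ro1 /=; apply: mp_row_le.
  have eph : ph p = pos (compof p) (rw p).-1 (colof p) :> nat by rewrite val_insubd pos_lt.
  have [h1 h2 h3] := rw_cl_pos eph hc.
  split; last by rewrite h1 h2 h3 ro1.
    apply: val_inj; rewrite pilamE /lab h1 h2 ro1 /= ck -ei.
    exact: (reshape_indexK (comp la)).
  by apply: (cs (compof p) (rw p).-1); rewrite ?h1 ?h2 ?h3 // ro1.
have inj : {in [set p | (d p < t) && (pilam p == hi i)] &, injective ph}.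
  move=> p p'; rewrite !inE => /andP[_ /eqP e1] /andP[_ /eqP e2] e.
  have [_ _ [a1 [a2 a3]]] := key _ e1; have [_ _ [b1 [b2 b3]]] := key _ e2.
  apply: val_inj => /=; rewrite -(posK p) -(posK p').
  by rewrite -a1 -a2 -a3 e b1 b2 b3.
rewrite -(card_in_imset inj); apply: subset_leq_card; apply/subsetP => _ /imsetP[p + ->].
rewrite !inE => /andP[pt /eqP/key[-> lt _]]; rewrite eqxx andbT; exact: ltn_trans lt pt.
Qed.

(** Suppose the box [p] carries a larger entry than the box [p'] just below it, in column c. Among
    the entries up to that of [p'], the lower row fills its columns through c and the upper row at
    most those before c, against the lattice property. *)
Lemma lattice_colstd d : rowinc pilam d -> lattice Klam (fun p => pilam ((d^-1)%g p)) -> colstd d.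
Proof.
move=> rd lt k r p p' ck ck' rk rk' ec.
rewrite ltn_neqAle; apply/andP; split.
  by apply/eqP => /val_inj/perm_inj e; move: rk'; rewrite -e rk; lia.
rewrite leqNgt; apply/negP => dp.
have lab_lo : (lab p).+1 = lab p' by rewrite /lab ck ck' rk rk' /fi addnS.
have hi_n : lab p < n.-1 by have := lab_lt (ltn_ord p'); lia.
pose i := Ordinal hi_n.
have ep : pilam p = lo i by apply: val_inj; rewrite pilamE.
have ep' : pilam p' = hi i by apply: val_inj; rewrite pilamE -lab_lo.
have iK : i \in Klam by rewrite inE /= lab_lo !compof_lab // ck ck'.
(* The values of [d] start at 0, so the shortest prefix containing the entry of [p'] has length
   [(d p').+1]. *)
have := lt i (d p').+1 iK; rewrite !pcnt_perm leqNgt => /negP[].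
apply: (@leq_ltn_trans (colof p)).
  have cinj : {in [set q | (d q < (d p').+1) && (pilam q == lo i)] &, injective (fun q : 'I_n => colof q)}.
    move=> x y; rewrite !inE -ep !pilam_eqE => /andP[_ /andP[/eqP a1 /eqP a2]] /andP[_ /andP[/eqP b1 /eqP b2]] e.
    by apply: val_inj; rewrite /= -(posK x) -(posK y) a1 a2 b1 b2 e.
  rewrite -[X in _ <= X](size_iota 0) cardE -(size_map (fun q : 'I_n => colof q)); apply: uniq_leq_size.
    rewrite map_inj_in_uniq ?enum_uniq // => x y; rewrite !mem_enum; exact: cinj.
  move=> _ /mapP[q + ->]; rewrite mem_enum inE -ep => /andP[dq pq].
  rewrite mem_iota /= add0n ltnNge; apply/negP => cq.
  have pe := pq; move: pe; rewrite pilam_eqE => /andP[/eqP a1 /eqP a2].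
  have pq' : p <= q by rewrite -(posK p) -(posK q) a1 a2 !(posE _ _ (colof _)); lia.
  have : d p <= d q.
    move: pq'; rewrite leq_eqVlt => /orP[/eqP/val_inj->//|h]; apply: ltnW; apply: rd => //.
    exact/esym/eqP.
  by move: dq dp; rewrite ltnS; lia.
have hb (a : 'I_(colof p').+1) : a < nth 0 (row k) r.+1.
  by have := colof_lt (ltn_ord p'); rewrite ck' rk'; have := ltn_ord a; lia.
pose f a := Ordinal (pos_lt (hb a)).
have fi' : injective f.
  by move=> a a' /(congr1 val) /=; rewrite (posE _ _ a) (posE _ _ a') => /addnI/val_inj.
have := card_imset predT fi'; rewrite card_ord ec => <-.
apply: subset_leq_card; apply/subsetP => q /imsetP[a _ ->]; rewrite inE -ep' ltnS.
have ef : pilam (f a) = pilam p'.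
  by apply/eqP; rewrite pilam_eqE /= compof_pos // rw_pos // ck' rk' !eqxx.
rewrite ef eqxx andbT.
have : f a <= p'.
  have e3 := posK p'; rewrite ck' rk' posE in e3.
  by rewrite /= posE; have := ltn_ord a; lia.
rewrite leq_eqVlt => /orP[/eqP e1|h]; last by apply: ltnW; apply: rd.
by have -> : f a = p' by apply: val_inj.
Qed.

Lemma stdp_inT d : stdp Klam pilam d <-> inT n la (tab_act (tlam la) d).
Proof.
split=> [[h1 h2 h3]|/and3P[_ /tab_standard[h1 h2] /tab_initial h3]].
  apply/and3P; split; [exact: act_is_mtab| |exact/tab_initial].
  by apply/tab_standard; split=> //; apply: lattice_colstd.
by split=> //; apply: colstd_lattice.
Qed.

Lemma inT_stdp t : inT n la t ->
  stdp Klam pilam (dperm n la t) /\ t = tab_act (tlam la) (dperm n la t).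
Proof.
move=> h; have /and3P[/mtab_act[d ed] _ _] := h.
by rewrite ed dperm_act; split=> //; apply/stdp_inT; rewrite -ed.
Qed.

End Multipartition.

Section MultipartitionOrder.
Local Open Scope nat_scope.
Variable n : nat.
Implicit Types (la mu : seq (seq nat)) (K : {set 'I_n.-1}) (p : 'I_n).
Notation comp := Defs.comp.
Notation ri := reshape_index.
Notation ro := reshape_offset.
Notation fi := flatten_index.

Lemma Klam_comp la mu : is_mpart n la -> is_mpart n mu -> Klam n la = Klam n mu -> comp la = comp mu.
Proof.
move=> hl hm e; apply: rstart_inj; rewrite ?(mp_comp_pos hl) ?(mp_comp_pos hm) ?(mp_sum hl) ?(mp_sum hm) //.
by move=> i hi; rewrite -(bst_Klam hl hi) -(bst_Klam hm hi) e.
Qed.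

Lemma fi_comp_lt la k i : is_mpart n la -> i < sumn (nth [::] la k) -> fi (comp la) k i < n.
Proof. by move=> hl hi; rewrite -[X in _ < X](mp_sum hl); apply: flatten_indexP; rewrite nth_comp. Qed.

Lemma compof_fi la k i : i < sumn (nth [::] la k) -> compof la (fi (comp la) k i) = k.
Proof. by move=> hi; rewrite /compof flatten_indexKl // nth_comp. Qed.

Lemma rw_fi la k i : i < sumn (nth [::] la k) -> rw la (fi (comp la) k i) = ri (nth [::] la k) i.
Proof. by move=> hi; rewrite /rw compof_fi // /compoff flatten_indexKr // nth_comp. Qed.

Lemma multipartition_inj la mu : is_mpart n la -> is_mpart n mu ->
  Klam n la = Klam n mu -> pilam n la = pilam n mu -> la = mu.
Proof.
move=> hl hm eK ep; have ec := Klam_comp hl hm eK.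
have es : size la = size mu by rewrite -(size_map sumn la) -/(comp la) ec size_map.
have es' k : sumn (nth [::] la k) = sumn (nth [::] mu k) by rewrite -!nth_comp ec.
apply: (@eq_from_nth _ [::]) => // k hk; apply: ri_inj; rewrite ?(mp_row_pos hl) ?(mp_row_pos hm) //.
move=> i hi; have hn := fi_comp_lt hl hi.
have := congr1 (fun f : {ffun 'I_n -> 'I_n} => val (f (Ordinal hn))) ep.
rewrite /= (pilamE hl) (pilamE hm) /= => el.
have <- := rw_fi hi; rewrite es' in hi; have <- := rw_fi hi.
rewrite -(compoff_lab hl hn) el ec -(compoff_lab hm) -?ec //; by rewrite /compoff ec.
Qed.

(** If the first j rows of a component held fewer boxes for [la] than for [mu], the position right
    after those of [la] would come after them for [la] but still lie in them for [mu], against the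
    inequality of labels. *)
Lemma dominates_pilam la mu : is_mpart n la -> is_mpart n mu -> Klam n la = Klam n mu ->
  (forall p, pilam n la p <= pilam n mu p) -> dominates n la mu.
Proof.
move=> hl hm eK le; have ec := Klam_comp hl hm eK.
apply/allP => k _; apply/allP => j _; rewrite /offset ec leq_add2l leqNgt; apply/negP => lt.
have es' : sumn (nth [::] la k) = sumn (nth [::] mu k) by rewrite -!nth_comp ec.
set i := sumn (take j (nth [::] la k)) in lt.
have him : i < sumn (nth [::] mu k).
  apply: leq_trans lt _; rewrite -[X in _ <= sumn X](cat_take_drop j) sumn_cat; exact: leq_addr.
have hil : i < sumn (nth [::] la k) by rewrite es'.
have hn := fi_comp_lt hl hil.
have := le (Ordinal hn); rewrite [X in X <= _](pilamE hl) [X in _ <= X](pilamE hm) /=.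
rewrite /lab compof_fi // rw_fi // ec compof_fi // rw_fi // /fi leq_add2l.
have := ri_lt j him; rewrite lt => h1; have := ri_lt j hil; rewrite ltnn => /negbT; rewrite -leqNgt => h2.
by move=> h3; have := leq_trans h2 h3; rewrite leqNgt h1.
Qed.

(** The lattice property at the full length n makes the multiplicities of the labels weakly
    decreasing along each block. So the labels used in a block are consecutive from its start, and
    their multiplicities form a partition. *)
Lemma exists_multipartition K (pi : 'I_n -> 'I_n) d : ndec pi -> cpt K pi -> stdp K pi d ->
  exists la, [/\ is_mpart n la, Klam n la = K & pilam n la =1 pi].
Proof.
move=> npi cpi [_ _ lat].
have cle i : i \in K -> cnt pi (hi i) <= cnt pi (lo i).
  have e v : pcnt (fun p => pi ((d^-1)%g p)) n v = cnt pi v.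
    transitivity (cnt (fun p => pi ((d^-1)%g p)) v).
      by apply: eq_card => p; rewrite !inE ltn_ord.
    by apply: (@cnt_perm _ _ _ d) => p; rewrite permK.
  by move=> iK; have := lat i n iK; rewrite !e.
have [sh [psh ssh hsh]] := rstart_rows n (bst_le K) (bst_idem K) (@bst_mono n K).
pose s k := sumn (take k sh).
have bs k i : i < nth 0 sh k -> bst K (s k + i) = s k.
  move=> hi; rewrite -hsh; last by rewrite -ssh; apply: flatten_indexP.
  by rewrite /rstart (flatten_indexKl hi).
have sn k i : i < nth 0 sh k -> s k + i < n by move=> hi; rewrite -ssh; apply: flatten_indexP.
pose pin (m : nat) : nat := if insub m is Some p then pi p else 0.
have pinE p : pin p = pi p by rewrite /pin valK.
have pge p : bst K p <= pi p by rewrite -cpi; apply: bst_le.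
(* By [cle] a used label that does not open its block has a used predecessor: there are no empty
   rows. *)
have noskip p : bst K (pi p) != pi p :> nat -> exists p', (pi p').+1 = pi p.
  case E: (nat_of_ord (pi p)) => [|v] // bv.
  have hv : v < n.-1 by have := ltn_ord (pi p); lia.
  have ehi : pi p = hi (Ordinal hv) by apply: val_inj; rewrite /= E.
  have vK : Ordinal hv \in K.
    by rewrite -glueE; move: bv; rewrite /=; case: (glue K v) => //; rewrite eqxx.
  have c0 : 0 < cnt pi (hi (Ordinal hv)) by apply/card_gt0P; exists p; rewrite inE ehi.
  have /card_gt0P[p'] := leq_trans c0 (cle _ vK); rewrite inE => /eqP e.
  by exists p'; rewrite e.
(* The bound on [k] stands inside the existential so that [choice] yields a total function. *)
have exc k : exists c, k < size sh ->
    [/\ all (ltn 0) c, sumn c = nth 0 sh k & forall i, i < nth 0 sh k -> ri c i = pin (s k + i) - s k].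
  case: (ltnP k (size sh)) => hk; last by exists [::].
  have k0 : 0 < nth 0 sh k by apply: (allP psh); apply: mem_nth.
  have [||c [h1 h2 h3 h4]] := @ri_rows (fun i => pin (s k + i) - s k) (nth 0 sh k).
  - pose p := Ordinal (sn k 0 k0); have -> : s k + 0 = p by [].
    rewrite pinE; apply/eqP; rewrite subn_eq0 leqNgt; apply/negP => lt.
    have bp : bst K p = s k by rewrite bs.
    have [|p' ep'] := noskip p; first by rewrite cpi bp neq_ltn lt.
    have p'p : p' < p.
      by rewrite ltnNge; apply/negP => /npi; lia.
    have := bst_mono K (ltnW p'p); rewrite bp leq_eqVlt => /orP[/eqP e|h].
      by have := bst_le K p'; rewrite e; move: p'p => /=; lia.
    have : bst K (pi p') < s k by rewrite cpi.
    have : s k <= pi p' by lia.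
    move=> /(bst_mono K); rewrite -{1}(bs k 0 k0) addn0 bst_idem -[s k in X in X -> _]addn0 bs //; lia.
  - move=> i hi; pose p := Ordinal (sn k i (ltnW hi)); pose p2 := Ordinal (sn k i.+1 hi).
    have -> : s k + i = p by []. have -> : s k + i.+1 = p2 by [].
    rewrite !pinE; have le : pi p <= pi p2 by apply: npi => /=; lia.
    have g1 : s k <= pi p by rewrite -(bs k i (ltnW hi)); apply: (pge p).
    apply/andP; split; first by lia.
    suff : pi p2 <= (pi p).+1 by lia.
    rewrite leqNgt; apply/negP => lt.
    have [|p' ep'] := noskip p2.
      rewrite cpi; have -> : bst K p2 = s k by rewrite bs.
      by rewrite neq_ltn; apply/orP; left; lia.
    case: (leqP p' p) => [/npi|h]; first by lia.
    have : p2 <= p' by rewrite /=; move: h => /=; lia.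
    by move/npi; lia.
  by exists c => _; split=> // i hi; rewrite h4.
have [c hc] := choice exc.
pose la := mkseq c (size sh).
have ela k : k < size sh -> nth [::] la k = c k by move=> hk; rewrite nth_mkseq.
have ec : comp la = sh.
  apply: (@eq_from_nth _ 0); first by rewrite size_map size_mkseq.
  move=> k; rewrite size_map size_mkseq => hk.
  by rewrite (nth_map [::]) ?size_mkseq // ela //; have [] := hc k hk.
have lab_pi p : lab la p = pi p.
  have pn : p < sumn sh by rewrite ssh.
  have hk : ri sh p < size sh by apply: reshape_indexP.
  have ho : ro sh p < nth 0 sh (ri sh p) by apply: reshape_offsetP.
  have ep : s (ri sh p) + ro sh p = p by have := reshape_indexK sh p.
  rewrite /lab /rw /compoff /compof ec ela //; have [_ _ ->] // := hc _ hk.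
  rewrite ep pinE /fi -/(s (ri sh p)) subnKC //.
  by have := pge p; rewrite -{1}ep bs.
(* The length of a row is the multiplicity of its label, so [cle] will say that the row lengths are
   sorted. *)
have row_cnt k r (v : 'I_n) : k < size sh -> r < size (c k) -> v = s k + r :> nat -> cnt pi v = nth 0 (c k) r.
  move=> hk hr ev; have [pc sc hcr] := hc _ hk.
  have hp j : j < nth 0 (c k) r -> fi (c k) r j < nth 0 sh k by move=> hj; rewrite -sc; apply: flatten_indexP.
  apply/eqP; rewrite eqn_leq; apply/andP; split.
    have blk p : pi p = v -> ri sh p = k.
      move=> ep; have : bst K (pi p) = s k.
        rewrite ep ev; apply: bs; rewrite -sc; apply: leq_trans hr _.
        by elim: (c k) pc => [//|a l IH] /= /andP[a0 /IH h]; lia.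
      have pn : p < sumn sh by rewrite ssh.
      rewrite cpi -hsh // => e.
      have h0 : 0 < nth 0 sh k by apply: (allP psh); apply: mem_nth.
      have := reshape_indexK sh p; have := reshape_offsetP pn.
      rewrite /fi -/(rstart sh p) e => h1 h2.
      have h3 : 0 < nth 0 sh (ri sh p) by apply: leq_ltn_trans h1.
      have e2 : fi sh (ri sh p) 0 = fi sh k 0 by rewrite /fi !addn0 -/(rstart sh p) e.
      by rewrite -(flatten_indexKl h3) e2 (flatten_indexKl h0).
    pose m p := ro (c k) (ro sh p).
    have mE p : pi p = v -> s k + fi (c k) r (m p) = p /\ m p < nth 0 (c k) r.
      move=> ep; have pn : p < sumn sh by rewrite ssh.
      have := reshape_indexK sh p; have := reshape_offsetP pn; rewrite blk // => h1 h2.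
      have er : ri (c k) (ro sh p) = r.
        rewrite hcr //; have -> : s k + ro sh p = p by [].
        by rewrite pinE ep ev addKn.
      split; last by rewrite /m -{1}er; apply: reshape_offsetP; rewrite sc.
      by rewrite /m -{1}er reshape_indexK.
    have minj : {in [set p | pi p == v] &, injective m}.
      move=> p p'; rewrite !inE => /eqP/mE[e1 _] /eqP/mE[e2 _] e3.
      by apply: val_inj; rewrite /= -e1 -e2 e3.
    rewrite /cnt -[X in _ <= X](size_iota 0) cardE -(size_map m); apply: uniq_leq_size.
      rewrite map_inj_in_uniq ?enum_uniq // => x y; rewrite !mem_enum; exact: minj.
    by move=> _ /mapP[q + ->]; rewrite mem_enum inE => /eqP/mE[_ h]; rewrite mem_iota.
  have hb (a : 'I_(nth 0 (c k) r)) : s k + fi (c k) r a < n by apply: sn; apply: hp.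
  pose f a := Ordinal (hb a).
  have finj : injective f.
    by move=> a a' /(congr1 val) /= /addnI; rewrite /fi => /addnI/val_inj.
  have := card_imset predT finj; rewrite card_ord => <-.
  apply: subset_leq_card; apply/subsetP => q /imsetP[a _ ->]; rewrite inE; apply/eqP/val_inj => /=.
  have hfa := hp a (ltn_ord a).
  have e1 := hcr _ hfa; have e2 := flatten_indexKl (ltn_ord a).
  have g := pge (f a); rewrite -pinE /= bs // in g.
  by rewrite -pinE /= ev; rewrite e2 in e1; lia.
have hla : is_mpart n la.
  apply/andP; split; last by rewrite -/(comp la) ec ssh.
  apply/(all_nthP [::]) => k; rewrite size_mkseq => hk; rewrite ela //.
  have [pc sc hcr] := hc _ hk.
  have k0 : 0 < nth 0 sh k by apply: (allP psh); apply: mem_nth.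
  apply/and3P; split=> //; first by case: (c k) sc => //= e; rewrite -e in k0.
  apply/(sortedP 0) => r hr.
  have szc : size (c k) <= nth 0 sh k.
    by rewrite -sc; elim: (c k) pc => [//|a l IH] /= /andP[a0 /IH h]; lia.
  have h1 := sn k r.+1 (leq_trans hr szc); have hr' := ltnW hr.
  have hv : s k + r < n.-1 by lia.
  have iK : Ordinal hv \in K.
    rewrite mem_K /= -/(bst K (s k + r).+1) -addnS !bs //; first exact: leq_trans hr szc.
    exact: leq_trans hr' szc.
  have := cle _ iK; rewrite (row_cnt k r (lo (Ordinal hv))) // (row_cnt k r.+1 (hi (Ordinal hv))) //.
  by rewrite addnS.
have epi : pilam n la =1 pi by move=> p; apply: val_inj; rewrite (pilamE hla) lab_pi.
exists la; split=> //.
apply/setP => k; rewrite !mem_K !(bst_Klam hla) ?ltn_ord // ec !hsh //.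
Qed.
End MultipartitionOrder.

(** * From words back to multitableaux *)

(** The coefficient is a function of the index, so repeated indices have to be merged; hence the
    detour through a list without duplicates. *)
Lemma spn_list (S : comUnitAlgType CC) (A : algType S) (I : eqType) (P : pred I) (F : I -> A) v :
  spn (fun v => exists2 i, P i & v = F i) v ->
  exists (l : seq I) (c : I -> S), all P l /\ v = \sum_(i <- l) c i *: F i.
Proof.
move=> h; suff [l [c [_ Pl ->]]] : exists (l : seq I) (c : I -> S),
    [/\ uniq l, all P l & v = \sum_(i <- l) c i *: F i] by exists l, c.
elim: h => [|c0 a b [i Pi ->] _ [l [c [ul Pl ->]]]]; first by exists [::], (fun => 0); rewrite big_nil.
have [il|il] := boolP (i \in l).
  exists l, (fun j => (if j == i then c0 else 0) + c j); split=> //.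
  under [RHS]eq_bigr do rewrite scalerDl; rewrite big_split /=; congr (_ + _).
  rewrite (bigD1_seq i) //= eqxx big1 ?addr0 // => j /negbTE ->; exact: scale0r.
exists (i :: l), (fun j => if j == i then c0 else c j); split; rewrite /= ?il ?Pi //.
rewrite big_cons eqxx; congr (_ + _); rewrite !big_seq; apply: eq_bigr => j jl.
by case: eqP => // e; rewrite -e jl in il.
Qed.

Section Translation.
Variables (n : nat) (S : comUnitAlgType CC) (q : S) (A : algType S) (e z : nat -> A) (star : A -> A).
Hypotheses (HA : is_bH n q e z) (HS : is_bH_star n e z star) (Uq : q \is a GRing.unit).
Implicit Types (la : seq (seq nat)).

Lemma Ila_PK la : is_mpart n la -> Ila n la = PK (Klam n la).
Proof.
move=> hl; apply/setP => B; apply/imsetP/imsetP => [[k _ ->]|[x _ ->]].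
  have k0 : (0 < sumn (nth [::] la k))%N.
    rewrite -nth_comp; apply: (allP (mp_comp_pos hl)); apply: mem_nth; by rewrite size_map.
  have hn := fi_comp_lt hl k0.
  exists (Ordinal hn) => //; apply/setP => y; rewrite !inE (bst_Klam_eq hl) /= compof_fi //.
  by rewrite nth_comp comp_interval // eq_sym.
exists (Ordinal (compof_lt hl (ltn_ord x))) => //; apply/setP => y.
by rewrite !inE (bst_Klam_eq hl) /= nth_comp comp_interval // eq_sym.
Qed.

Lemma mla_rowsymm la : is_mpart n la -> mla n q e z la = rowsymm q e z (Klam n la) (pilam n la).
Proof.
move=> hl; rewrite /mla Ila_PK // bEI_PK mulr_sumr /rowsymm /fibsum; apply: eq_big => [w|w _].
  exact: rowstabE.
by rewrite ellE -scalerAr.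
Qed.

Definition idx_tri (x : seq (seq nat) * mtab * mtab) :=
  (pilam n x.1.1, dperm n x.1.1 x.1.2, dperm n x.1.1 x.2).

Lemma belt_tri x : is_mpart n x.1.1 ->
  belt n q e z star x = belt_of q e z star (Klam n x.1.1) (idx_tri x).
Proof. by move=> hl; rewrite /belt /mst mla_rowsymm. Qed.

Lemma bindex_stdx x : bindex n x -> stdx (Klam n x.1.1) (idx_tri x).
Proof.
move=> /and3P[hl hs ht]; split=> /=.
- exact: pilam_ndec.
- exact: pilam_cpt.
- by have [] := inT_stdp hl hs.
- by have [] := inT_stdp hl ht.
Qed.

Lemma bindex_inj : {in bindex n &, forall x x',
  Klam n x.1.1 = Klam n x'.1.1 -> idx_tri x = idx_tri x' -> x = x'}.
Proof.
move=> [[la s] t] [[la' s'] t'] /and3P[/= hl hs ht] /and3P[/= hl' hs' ht'] eK [ep ed ed'].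
have el := multipartition_inj hl hl' eK ep; subst la'.
have [_ ->] := inT_stdp hl hs; have [_ ->] := inT_stdp hl ht.
have [_ ->] := inT_stdp hl hs'; have [_ ->] := inT_stdp hl ht'.
by rewrite ed ed'.
Qed.

(** One standard permutation, through its lattice word, already forces [pi] to come from a
    multipartition; so compositions that are not partitions never enter the basis. *)
Lemma bas_elt_belt K (pi : 'I_n -> 'I_n) d d' : ndec pi -> cpt K pi -> stdp K pi d -> stdp K pi d' ->
  exists x, [/\ bindex n x, Klam n x.1.1 = K, pilam n x.1.1 =1 pi &
     bas_elt q e z star K pi d d' = belt n q e z star x].
Proof.
move=> npi cpi sd sd'; have [la [hl eK ep]] := exists_multipartition npi cpi sd.
have ep' : pi =1 pilam n la by move=> p; rewrite ep.
have [hs ht] : inT n la (tab_act (tlam la) d) /\ inT n la (tab_act (tlam la) d').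
  by split; apply/(stdp_inT hl); rewrite eK; apply: stdp_eq ep' _.
exists (la, tab_act (tlam la) d, tab_act (tlam la) d'); split=> //=; first by apply/and3P.
by rewrite belt_tri // /belt_of /idx_tri /= !dperm_act // eK; apply: eq_bas_elt.
Qed.

End Translation.

Theorem theorem5p10 (n : nat) (S : comUnitAlgType CC) (q : S)
    (A : algType S) (e z : nat -> A) (star : A -> A) :
  is_laurent_ring q ->
  is_bH n q e z ->
  is_bH_star n e z star ->
  cellular_bH n q e z star.
Proof.
move=> [Uq _ _] HA HS; split.
- move=> a; apply: spn_list; apply: spn_sub (bH_span HA HS Uq a) => v [K [y [h1 h2 h3 h4] ->]].
  by rewrite /belt_of; have [x [hx _ _ ->]] := bas_elt_belt q e z star h1 h2 h3 h4; exists x.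
- move=> l c ul /allP bl s0.
  apply: (@bel_free n S q A e z star HA HS Uq _ l (fun x => Klam n x.1.1) (@idx_tri n)) => //.
  + by move=> x /bl/bindex_stdx.
  + by move=> x x' /bl hx /bl hx'; apply: bindex_inj.
  rewrite -[RHS]s0 !big_seq; apply: eq_bigr => x /bl/and3P[hl _ _].
  by rewrite belt_tri.
- split; [exact: (starM HS)|split; [exact: (starK HA HS)|]].
  move=> la s t /and3P[/= hl _ _].
  by rewrite /mst (mla_rowsymm q e z hl) !(starM HS) (starK HA HS) (star_rowsymm HA HS) mulrA.
move=> la s hl hs a; have [sd es] := inT_stdp hl hs.
set K := Klam n la in sd *; set pi := pilam n la in sd *.
have npi : ndec pi := pilam_ndec hl; have cpi : cpt K pi := pilam_cpt hl.
have [v sv hv] := cell_span HA HS Uq a (dperm n la s) npi cpi.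
have : spn (fun v => exists2 u, inT n la u & v = star (zw z (dperm n la u)) * mla n q e z la) v.
  apply: spn_sub sv => u [d sdd ->]; exists (tab_act (tlam la) d); first exact/(stdp_inT hl).
  by rewrite dperm_act // mla_rowsymm.
move/spn_list => [us [r [hus ev]]]; exists us, r; split=> // t ht.
have -> : a * mst n q e z star la s t - \sum_(u <- us) r u *: mst n q e z star la u t =
   a * bas_elt q e z star K pi (dperm n la s) (dperm n la t) - v * zw z (dperm n la t).
  rewrite {1}/mst mla_rowsymm // ev mulr_suml; congr (_ - _); apply: eq_bigr => u _.
  by rewrite scalerAl.
apply: spn_list; apply: spn_sub (hv (dperm n la t)) => w [pi' [d [d' [h1 h2 h3 [p0 hp0] [h4 h5 ->]]]]].
have [x [hx eK ep ->]] := bas_elt_belt q e z star h1 h2 h4 h5.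
exists x => //; rewrite hx /=; case/and3P: hx => hl' _ _; apply/andP; split.
  by apply: dominates_pilam => // p; rewrite ep.
by apply/eqP => el; move: hp0; rewrite -ep el eqxx.
Qed.
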